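(* Let $L/K$ be a finite Galois extension with group $\Gamma=\operatorname{Gal}(L/K)$ and let $\mathcal C$ be a split fusion category over $L$. A split $K$-form of $\mathcal C$ exists if and only if the projection $p_{\mathrm{fr}}:\Pi_{\mathrm{fr}}(\mathcal C/K)\to\Gamma$ admits a group-theoretic section.
   Context: A fusion category over a field $F$ is an $F$-linear semisimple abelian category with finite-dimensional morphism spaces and finitely many isomorphism classes of simple objects, with a rigid monoidal structure such that $\operatorname{End}(\mathbf 1)=F$. It is split if $\operatorname{End}(X)=F$ for every simple $X$. A $K$-form of $\mathcal C$ is a fusion category $\mathcal C_K$ over $K$ with an $L$-linear tensor equivalence $\mathcal C_K\otimes_KL\simeq\mathcal C$ (scalar extension including idempotent completion); it is split if $\mathcal C_K$ is split. $\operatorname{Irr}(\mathcal C)$ is the set of simple isomorphism classes, with a fixed representative of each, denoted by the same letter. For $\sigma\in\Gamma$, ${}^\sigma\mathcal C$ is $\mathcal C$ with scalar multiplication twisted by $\sigma$, and ${}^\sigma X$ denotes $X$ viewed in ${}^\sigma\mathcal C$. A twisted tensor equivalence over $\sigma$ is an $L$-linear tensor equivalence $F:{}^\sigma\mathcal C\to\mathcal C$; write $(F,\sigma)$. Products: $(F,\sigma)(G,\tau)=(F\circ{}^\sigma G,\sigma\tau)$. A framed twisted equivalence is a triple $(F,\sigma,\mathbf f)$ where $F({}^\sigma X)\cong X$ for every simple $X$ and $\mathbf f=(f_X)_{X\in\operatorname{Irr}(\mathcal C)}$ is a family of isomorphisms $f_X:F({}^\sigma X)\to X$ (a frame). Two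 framed twisted equivalences $(F,\sigma,\mathbf f)$ and $(F',\sigma,\mathbf f')$ are equivalent if there is a tensor natural isomorphism $\eta:F\Rightarrow F'$ with $f'_X\circ\eta_{{}^\sigma X}=f_X$ for all $X\in\operatorname{Irr}(\mathcal C)$. The composite of $(F,\sigma,\mathbf f)$ and $(G,\tau,\mathbf g)$ has underlying functor $F\circ{}^\sigma G$ over $\sigma\tau$ and frame $(\mathbf f*\mathbf g)_X=f_X\circ F({}^\sigma g_X)$. The equivalence classes form a group $\Pi_{\mathrm{fr}}(\mathcal C/K)$, and $p_{\mathrm{fr}}$ sends the class of $(F,\sigma,\mathbf f)$ to $\sigma$. A section of $p_{\mathrm{fr}}$ is a group homomorphism $s:\Gamma\to\Pi_{\mathrm{fr}}(\mathcal C/K)$ with $p_{\mathrm{fr}}\circ s=\mathrm{id}_\Gamma$. *)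

(* Defs.v *)
From HB Require Import structures.
From Stdlib Require Import FunctionalExtensionality PropExtensionality.
From mathcomp Require Import all_boot all_order all_fingroup all_algebra.
From mathcomp Require Import all_field.

Set Implicit Arguments.
Unset Strict Implicit.
Unset Printing Implicit Defensive.

Import GRing.Theory.
Local Open Scope ring_scope.

Reserved Notation "g \c f" (at level 40, left associativity).
Reserved Notation "X \ox Y" (at level 38, left associativity).
Reserved Notation "f \om g" (at level 38, left associativity).

(* [vectType] builds finite-dimensionality into the morphism spaces. *)
Record lin_cat (F : fieldType) := LinCat {
  obj :> Type;
  mor : obj -> obj -> vectType F;
  idm : forall X, mor X X;
  comp : forall X Y Z, mor Y Z -> mor X Y -> mor X Z;
  compA : forall X Y Z W (h : mor Z W) (g : mor Y Z) (f : mor X Y),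
    comp h (comp g f) = comp (comp h g) f;
  comp1m : forall X Y (f : mor X Y), comp (idm Y) f = f;
  compm1 : forall X Y (f : mor X Y), comp f (idm X) = f;
  comp_linl : forall X Y Z (a : F) (g g' : mor Y Z) (f : mor X Y),
    comp (a *: g + g') f = a *: comp g f + comp g' f;
  comp_linr : forall X Y Z (a : F) (g : mor Y Z) (f f' : mor X Y),
    comp g (a *: f + f') = a *: comp g f + comp g f' }.

Arguments mor {F C} X Y : rename.
Arguments idm {F C} X : rename.
Arguments comp {F C X Y Z} g f : rename.
Notation "g \c f" := (comp g f).

Section Abelian.
Variables (F : fieldType) (C : lin_cat F).
Implicit Types X Y Z K : C.

Record iso X Y := Iso {
  ifw :> mor X Y;
  ibw : mor Y X;
  ifwK : ibw \c ifw = idm X;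
  ibwK : ifw \c ibw = idm Y }.

Definition isomorphic X Y : Prop := inhabited (iso X Y).

Definition is_iso X Y (f : mor X Y) : Prop := exists i : iso X Y, ifw i = f.

Definition is_zero Z : Prop :=
  forall X, (forall f : mor X Z, f = 0) /\ (forall f : mor Z X, f = 0).

Definition is_mono X Y (f : mor X Y) : Prop :=
  forall W (g h : mor W X), f \c g = f \c h -> g = h.

Definition is_epi X Y (f : mor X Y) : Prop :=
  forall W (g h : mor Y W), g \c f = h \c f -> g = h.

Definition is_kernel K X Y (f : mor X Y) (k : mor K X) : Prop :=
  f \c k = 0 /\
  forall W (g : mor W X), f \c g = 0 -> exists! u : mor W K, k \c u = g.

Definition is_cokernel X Y K (f : mor X Y) (q : mor Y K) : Prop :=
  q \c f = 0 /\
  forall W (g : mor Y W), g \c f = 0 -> exists! u : mor K W, u \c q = g.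

Definition is_dirsum n (S : 'I_n -> C) X : Prop :=
  exists (i : forall j, mor (S j) X) (p : forall j, mor X (S j)),
    [/\ forall j, p j \c i j = idm (S j),
        forall j k, j != k -> p j \c i k = 0
      & \sum_j i j \c p j = idm X].

Definition abelian_cat : Prop :=
  [/\ exists Z, is_zero Z,
      forall X Y, exists P, @is_dirsum 2 (fun j => if j == ord0 then X else Y) P,
      forall X Y (f : mor X Y),
        (exists K (k : mor K X), is_kernel f k) /\
        (exists Q (q : mor Y Q), is_cokernel f q),
      forall K X (k : mor K X), is_mono k ->
        exists Y (f : mor X Y), is_kernel f k
    & forall Y Q (q : mor Y Q), is_epi q ->
        exists X (f : mor X Y), is_cokernel f q].

Definition simple_obj X : Prop :=
  ~ is_zero X /\
  forall Y (m : mor Y X), is_mono m -> is_zero Y \/ is_iso m.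

Definition semisimple_cat : Prop :=
  forall X, exists n (S : 'I_n -> C), (forall j, simple_obj (S j)) /\ is_dirsum S X.

Definition finitely_many_simples : Prop :=
  exists n (S : 'I_n -> C), forall X, simple_obj X -> exists j, isomorphic X (S j).

Definition end_is_base X : Prop := bijective (fun a : F => a *: idm X : mor X X).

Lemma iso_id_subproof X : idm X \c idm X = idm X.
Proof. exact: comp1m. Qed.

Definition iso_id X : iso X X := Iso (iso_id_subproof X) (iso_id_subproof X).

Definition iso_inv X Y (i : iso X Y) : iso Y X := Iso (ibwK i) (ifwK i).

Lemma iso_comp_fw X Y Z (j : iso Y Z) (i : iso X Y) :
  (ibw i \c ibw j) \c (ifw j \c ifw i) = idm X.
Proof. by rewrite -compA (compA (ibw j)) ifwK comp1m ifwK. Qed.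

Lemma iso_comp_bw X Y Z (j : iso Y Z) (i : iso X Y) :
  (ifw j \c ifw i) \c (ibw i \c ibw j) = idm Z.
Proof. by rewrite -compA (compA (ifw i)) ibwK comp1m ibwK. Qed.

Definition iso_comp X Y Z (j : iso Y Z) (i : iso X Y) : iso X Z :=
  Iso (iso_comp_fw j i) (iso_comp_bw j i).

Lemma compDl X Y Z (g g' : mor Y Z) (f : mor X Y) :
  (g + g') \c f = g \c f + g' \c f.
Proof. by rewrite -[g in LHS]scale1r comp_linl scale1r. Qed.

Lemma compDr X Y Z (g : mor Y Z) (f f' : mor X Y) :
  g \c (f + f') = g \c f + g \c f'.
Proof. by rewrite -[f in LHS]scale1r comp_linr scale1r. Qed.

Lemma comp0m X Y Z (f : mor X Y) : (0 : mor Y Z) \c f = 0.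
Proof. by apply: (addrI (0 \c f)); rewrite -compDl !addr0. Qed.

Lemma compm0 X Y Z (g : mor Y Z) : g \c (0 : mor X Y) = 0.
Proof. by apply: (addrI (g \c 0)); rewrite -compDr !addr0. Qed.

Lemma compZl X Y Z a (g : mor Y Z) (f : mor X Y) : (a *: g) \c f = a *: (g \c f).
Proof. by rewrite -[a *: g]addr0 comp_linl comp0m addr0. Qed.

Lemma compZr X Y Z a (g : mor Y Z) (f : mor X Y) : g \c (a *: f) = a *: (g \c f).
Proof. by rewrite -[a *: f]addr0 comp_linr compm0 addr0. Qed.

End Abelian.

Record mon_cat (F : fieldType) := MonCat {
  mon_lin :> lin_cat F;
  unt : mon_lin;
  tob : mon_lin -> mon_lin -> mon_lin;
  tmor : forall X Y X' Y' : mon_lin,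
    mor X X' -> mor Y Y' -> mor (tob X Y) (tob X' Y');
  tmor1 : forall X Y, tmor (idm X) (idm Y) = idm (tob X Y);
  tmor_comp : forall X Y X' Y' X'' Y'' (f' : mor X' X'') (g' : mor Y' Y'')
      (f : mor X X') (g : mor Y Y'),
    tmor (f' \c f) (g' \c g) = tmor f' g' \c tmor f g;
  tmor_linl : forall X Y X' Y' (a : F) (f f' : mor X X') (g : mor Y Y'),
    tmor (a *: f + f') g = a *: tmor f g + tmor f' g;
  tmor_linr : forall X Y X' Y' (a : F) (f : mor X X') (g g' : mor Y Y'),
    tmor f (a *: g + g') = a *: tmor f g + tmor f g';
  assoc : forall X Y Z, iso (tob (tob X Y) Z) (tob X (tob Y Z));
  assoc_nat : forall X Y Z X' Y' Z' (f : mor X X') (g : mor Y Y') (h : mor Z Z'),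
    assoc X' Y' Z' \c tmor (tmor f g) h = tmor f (tmor g h) \c assoc X Y Z;
  lunit : forall X, iso (tob unt X) X;
  lunit_nat : forall X X' (f : mor X X'),
    lunit X' \c tmor (idm unt) f = f \c lunit X;
  runit : forall X, iso (tob X unt) X;
  runit_nat : forall X X' (f : mor X X'),
    runit X' \c tmor f (idm unt) = f \c runit X;
  pentagon : forall X Y Z W,
    assoc X Y (tob Z W) \c assoc (tob X Y) Z W =
    tmor (idm X) (assoc Y Z W) \c assoc X (tob Y Z) W \c
      tmor (assoc X Y Z) (idm W);
  triangle : forall X Y,
    tmor (idm X) (lunit Y) \c assoc X unt Y = tmor (runit X) (idm Y) }.

Arguments unt {F} m.
Arguments tmor {F m X Y X' Y'} f g.
Arguments assoc {F m} X Y Z.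
Arguments lunit {F m} X.
Arguments runit {F m} X.
Notation "X \ox Y" := (tob X Y).
Notation "f \om g" := (tmor f g).

Section Fusion.
Variables (F : fieldType) (C : mon_cat F).

(* The two zigzag identities for [ev : X^* (x) X -> 1] and
   [coev : 1 -> X (x) X^*], with the unit constraints on the other side. *)
Definition dual_pair (Xd X : C) : Prop :=
  exists (ev : mor (Xd \ox X) (unt C)) (coev : mor (unt C) (X \ox Xd)),
    runit X \c (idm X \om ev) \c assoc X Xd X \c (coev \om idm X) = lunit X /\
    lunit Xd \c (ev \om idm Xd) \c ibw (assoc Xd X Xd) \c (idm Xd \om coev)
      = runit Xd.

Definition rigid : Prop :=
  forall X : C, (exists Xd, dual_pair Xd X) /\ (exists Xd, dual_pair X Xd).

Definition is_fusion : Prop :=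
  [/\ abelian_cat C, semisimple_cat C, finitely_many_simples C, rigid
    & end_is_base (unt C)].

Definition split_cat : Prop := forall X : C, simple_obj X -> end_is_base X.

End Fusion.

Record fusion_cat (F : fieldType) := FusionCat {
  fus_mon :> mon_cat F;
  fusP : is_fusion fus_mon }.

Record lin_functor (F : fieldType) (A B : lin_cat F) := LinFunctor {
  fob :> A -> B;
  fmor : forall X Y : A, mor X Y -> mor (fob X) (fob Y);
  fmor1 : forall X, fmor (idm X) = idm (fob X);
  fmor_comp : forall X Y Z (g : mor Y Z) (f : mor X Y),
    fmor (g \c f) = fmor g \c fmor f;
  fmor_lin : forall X Y (a : F) (f f' : mor X Y),
    fmor (a *: f + f') = a *: fmor f + fmor f' }.

Arguments fmor {F A B} T {X Y} f : rename.

Section Functors.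
Variables (F : fieldType).
Implicit Types A B D : lin_cat F.

Definition id_functor A : lin_functor A A :=
  @LinFunctor F A A id (fun _ _ f => f) (fun _ => erefl) (fun _ _ _ _ _ => erefl)
    (fun _ _ _ _ _ => erefl).

Section Comp.
Variables (A B D : lin_cat F) (T : lin_functor B D) (S : lin_functor A B).

Lemma comp_functor1 X : fmor T (fmor S (idm X)) = idm (T (S X)).
Proof. by rewrite !fmor1. Qed.

Lemma comp_functor_comp (X Y Z : A) (g : mor Y Z) (f : mor X Y) :
  fmor T (fmor S (g \c f)) = fmor T (fmor S g) \c fmor T (fmor S f).
Proof. by rewrite !fmor_comp. Qed.

Lemma comp_functor_lin (X Y : A) (a : F) (f f' : mor X Y) :
  fmor T (fmor S (a *: f + f')) = a *: fmor T (fmor S f) + fmor T (fmor S f').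
Proof. by rewrite !fmor_lin. Qed.

Definition comp_functor : lin_functor A D :=
  LinFunctor comp_functor1 comp_functor_comp comp_functor_lin.

End Comp.

Lemma fmap_iso_subproof A B (T : lin_functor A B) X Y (g : mor Y X) (f : mor X Y) :
  g \c f = idm X -> fmor T g \c fmor T f = idm (T X).
Proof. by move=> gf; rewrite -fmor_comp gf fmor1. Qed.

Definition fmap_iso A B (T : lin_functor A B) (X Y : A) (i : iso X Y) :
    iso (T X) (T Y) :=
  Iso (fmap_iso_subproof T (ifwK i)) (fmap_iso_subproof T (ibwK i)).

Definition natural A B (T T' : lin_functor A B)
    (eta : forall X, mor (T X) (T' X)) : Prop :=
  forall X Y (f : mor X Y), eta Y \c fmor T f = fmor T' f \c eta X.

Definition nat_isomorphic A B (T T' : lin_functor A B) : Prop :=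
  exists eta : forall X, iso (T X) (T' X), natural eta.

Definition is_equivalence A B (T : lin_functor A B) : Prop :=
  exists S : lin_functor B A,
    nat_isomorphic (comp_functor S T) (id_functor A) /\
    nat_isomorphic (comp_functor T S) (id_functor B).

End Functors.

Record mon_functor (F : fieldType) (A B : mon_cat F) := MonFunctor {
  mf_fun :> lin_functor A B;
  mf_ten : forall X Y : A, iso (mf_fun X \ox mf_fun Y) (mf_fun (X \ox Y));
  mf_ten_nat : forall (X Y X' Y' : A) (f : mor X X') (g : mor Y Y'),
    mf_ten X' Y' \c (fmor mf_fun f \om fmor mf_fun g) =
    fmor mf_fun (f \om g) \c mf_ten X Y;
  mf_unt : iso (unt B) (mf_fun (unt A));
  mf_assoc : forall X Y Z : A,
    fmor mf_fun (assoc X Y Z) \c mf_ten (X \ox Y) Z \c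
      (mf_ten X Y \om idm (mf_fun Z)) =
    mf_ten X (Y \ox Z) \c (idm (mf_fun X) \om mf_ten Y Z) \c
      assoc (mf_fun X) (mf_fun Y) (mf_fun Z);
  mf_lunit : forall X : A,
    fmor mf_fun (lunit X) \c mf_ten (unt A) X \c (mf_unt \om idm (mf_fun X)) =
    lunit (mf_fun X);
  mf_runit : forall X : A,
    fmor mf_fun (runit X) \c mf_ten X (unt A) \c (idm (mf_fun X) \om mf_unt) =
    runit (mf_fun X) }.

Arguments mf_ten {F A B} T X Y : rename.
Arguments mf_unt {F A B} T : rename.

Section MonFunctors.
Variable F : fieldType.
Implicit Types A B D : mon_cat F.

Definition mon_nat_iso A B (T T' : mon_functor A B)
    (eta : forall X, iso (T X) (T' X)) : Prop :=
  [/\ natural eta,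
      forall X Y, eta (X \ox Y) \c mf_ten T X Y =
                  mf_ten T' X Y \c (eta X \om eta Y)
    & eta (unt A) \c mf_unt T = mf_unt T'].

Section Comp.
Variables (A B D : mon_cat F) (T : mon_functor B D) (S : mon_functor A B).

Definition mcomp_ten X Y : iso (T (S X) \ox T (S Y)) (T (S (X \ox Y))) :=
  iso_comp (fmap_iso T (mf_ten S X Y)) (mf_ten T (S X) (S Y)).

Definition mcomp_unt : iso (unt D) (T (S (unt A))) :=
  iso_comp (fmap_iso T (mf_unt S)) (mf_unt T).

Lemma tmor_compl (M : mon_cat F) (X X' X'' Y : M) (f' : mor X' X'') (f : mor X X') :
  (f' \c f) \om idm Y = (f' \om idm Y) \c (f \om idm Y).
Proof. by rewrite -tmor_comp comp1m. Qed.

Lemma tmor_compr (M : mon_cat F) (X X' X'' Y : M) (f' : mor X' X'') (f : mor X X') :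
  idm Y \om (f' \c f) = (idm Y \om f') \c (idm Y \om f).
Proof. by rewrite -tmor_comp comp1m. Qed.

Lemma mcomp_ten_nat (X Y X' Y' : A) (f : mor X X') (g : mor Y Y') :
  mcomp_ten X' Y' \c (fmor T (fmor S f) \om fmor T (fmor S g)) =
  fmor T (fmor S (f \om g)) \c mcomp_ten X Y.
Proof.
by rewrite /= -compA mf_ten_nat !compA -!fmor_comp mf_ten_nat.
Qed.

Lemma mf_ten_natl (X X' Y : B) (f : mor X X') :
  mf_ten T X' Y \c (fmor T f \om idm (T Y)) =
  fmor T (f \om idm Y) \c mf_ten T X Y.
Proof. by rewrite -fmor1 mf_ten_nat. Qed.

Lemma mf_ten_natr (X X' Y : B) (f : mor X X') :
  mf_ten T Y X' \c (idm (T Y) \om fmor T f) =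
  fmor T (idm Y \om f) \c mf_ten T Y X.
Proof. by rewrite -fmor1 mf_ten_nat. Qed.

Lemma mcomp_assoc (X Y Z : A) :
  fmor T (fmor S (assoc X Y Z)) \c mcomp_ten (X \ox Y) Z \c
    (mcomp_ten X Y \om idm (T (S Z))) =
  mcomp_ten X (Y \ox Z) \c (idm (T (S X)) \om mcomp_ten Y Z) \c
    assoc (T (S X)) (T (S Y)) (T (S Z)).
Proof.
rewrite /= tmor_compl tmor_compr !compA -(compA _ (mf_ten T _ _)) mf_ten_natl.
rewrite -(compA _ (mf_ten T (S X) _)) mf_ten_natr !compA -!fmor_comp.
by rewrite mf_assoc !fmor_comp -!compA (compA (mf_ten T _ _)) -mf_assoc !compA.
Qed.

Lemma mcomp_lunit (X : A) :
  fmor T (fmor S (lunit X)) \c mcomp_ten (unt A) X \c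
    (mcomp_unt \om idm (T (S X))) = lunit (T (S X)).
Proof.
rewrite /= tmor_compl !compA -(compA _ (mf_ten T _ _)) mf_ten_natl !compA.
by rewrite -!fmor_comp mf_lunit mf_lunit.
Qed.

Lemma mcomp_runit (X : A) :
  fmor T (fmor S (runit X)) \c mcomp_ten X (unt A) \c
    (idm (T (S X)) \om mcomp_unt) = runit (T (S X)).
Proof.
rewrite /= tmor_compr !compA -(compA _ (mf_ten T _ _)) mf_ten_natr !compA.
by rewrite -!fmor_comp mf_runit mf_runit.
Qed.

Definition mcomp_functor : mon_functor A D :=
  @MonFunctor F A D (comp_functor T S) mcomp_ten mcomp_ten_nat mcomp_unt
    mcomp_assoc mcomp_lunit mcomp_runit.

End Comp.

Definition inv_nat A B (T T' : mon_functor A B) (eta : forall X, iso (T X) (T' X)) X :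
    iso (T' X) (T X) :=
  iso_inv (eta X).

Definition vcomp_nat A B (T T' T'' : mon_functor A B)
    (xi : forall X, iso (T' X) (T'' X)) (eta : forall X, iso (T X) (T' X)) X :
    iso (T X) (T'' X) :=
  iso_comp (xi X) (eta X).

Definition hcomp_nat A B D (T T' : mon_functor B D) (S S' : mon_functor A B)
    (eta : forall X, iso (T X) (T' X)) (xi : forall X, iso (S X) (S' X)) X :
    iso (mcomp_functor T S X) (mcomp_functor T' S' X) :=
  iso_comp (eta (S' X)) (fmap_iso T (xi X)).

Lemma mon_nat_iso_id A B (T : mon_functor A B) :
  @mon_nat_iso A B T T (fun X => iso_id (T X)).
Proof.
split=> [X Y f|X Y|] /=.
- by rewrite comp1m compm1.
- by rewrite comp1m tmor1 compm1.
- by rewrite comp1m.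
Qed.

Lemma mon_nat_iso_inv A B (T T' : mon_functor A B)
    (eta : forall X, iso (T X) (T' X)) :
  mon_nat_iso eta -> mon_nat_iso (inv_nat eta).
Proof.
case=> nat_eta ten_eta unt_eta; split=> [X Y f|X Y|] /=.
- rewrite -[LHS]compm1 -(ibwK (eta X)) !compA; congr (_ \c _).
  by rewrite -compA -nat_eta !compA ifwK comp1m.
- rewrite -[LHS]compm1 -tmor1 -(ibwK (eta X)) -(ibwK (eta Y)) tmor_comp !compA.
  congr (_ \c _).
  by rewrite -compA -ten_eta compA ifwK comp1m.
- by rewrite -unt_eta compA ifwK comp1m.
Qed.

Lemma mon_nat_iso_vcomp A B (T T' T'' : mon_functor A B)
    (xi : forall X, iso (T' X) (T'' X)) (eta : forall X, iso (T X) (T' X)) :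
  mon_nat_iso xi -> mon_nat_iso eta -> mon_nat_iso (vcomp_nat xi eta).
Proof.
move=> [nat_xi ten_xi unt_xi] [nat_eta ten_eta unt_eta].
split=> [X Y f|X Y|] /=.
- by rewrite -compA nat_eta compA nat_xi compA.
- by rewrite -compA ten_eta compA ten_xi tmor_comp compA.
- by rewrite -compA unt_eta unt_xi.
Qed.

Lemma mon_nat_iso_hcomp A B D (T T' : mon_functor B D) (S S' : mon_functor A B)
    (eta : forall X, iso (T X) (T' X)) (xi : forall X, iso (S X) (S' X)) :
  mon_nat_iso eta -> mon_nat_iso xi -> mon_nat_iso (hcomp_nat eta xi).
Proof.
move=> [nat_eta ten_eta unt_eta] [nat_xi ten_xi unt_xi].
split=> [X Y f|X Y|] /=.
- by rewrite -compA -fmor_comp nat_xi fmor_comp !compA nat_eta.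
- have e : fmor T (xi (X \ox Y)) \c (fmor T (mf_ten S X Y) \c mf_ten T (S X) (S Y)) =
      fmor T (mf_ten S' X Y) \c
        (mf_ten T (S' X) (S' Y) \c (fmor T (xi X) \om fmor T (xi Y))).
    by rewrite compA -fmor_comp ten_xi fmor_comp mf_ten_nat !compA.
  rewrite -compA e compA nat_eta -compA (compA (eta _)) ten_eta.
  by rewrite tmor_comp !compA.
- by rewrite -compA (compA (fmor T (xi _))) -fmor_comp unt_xi compA nat_eta -compA
             unt_eta.
Qed.

End MonFunctors.

(* [bcoord] is the coordinate isomorphism of [V] with respect to [vbasis]. *)
Section Coordinates.
Variables (F : fieldType) (V : vectType F).

Definition bvec (i : 'I_(\dim {:V})) : V := (vbasis {:V})`_i.

Definition bcoord (v : V) : 'rV[F]_(\dim {:V}) :=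
  \row_i coord (vbasis {:V}) i v.

Lemma bcoordK (v : V) : \sum_i bcoord v 0 i *: bvec i = v.
Proof.
rewrite [RHS](coord_vbasis (memvf v)).
by apply: eq_bigr => i _; rewrite mxE.
Qed.

Lemma bcoord_linear : linear bcoord.
Proof. by move=> a u v; apply/rowP => i; rewrite !mxE linearP. Qed.

HB.instance Definition _ :=
  GRing.isLinear.Build F V 'rV[F]_(\dim {:V}) _ bcoord bcoord_linear.

Lemma bcoord_sum (c : 'I_(\dim {:V}) -> F) :
  bcoord (\sum_i c i *: bvec i) = \row_i c i.
Proof.
apply/rowP => i; rewrite !mxE coord_sum_free //.
exact: basis_free (vbasisP _).
Qed.

Lemma bcoord_bij : bijective bcoord.
Proof.
exists (fun x : 'rV[F]_(\dim {:V}) => \sum_i x 0 i *: bvec i); first exact: bcoordK.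
by move=> x; rewrite bcoord_sum; apply/rowP => i; rewrite mxE.
Qed.

End Coordinates.

Arguments bvec {F} V i.

Section Twist.
Variables (K : fieldType) (L : splittingFieldType K).
Local Notation Gal := (gal_of {:L}).
Implicit Types s t : Gal.

(* The product of [gal_of] is written in diagrammatic order (see [galM]);
   [gcomp] is the composition of field automorphisms. *)
Definition gcomp s t : Gal := (t * s)%g.

Lemma gcompE s t (a : L) : gcomp s t a = s (t a).
Proof. by rewrite /gcomp galM // memvf. Qed.

Lemma galVK s : cancel (s^-1)%g s.
Proof. by move=> a; rewrite -galM ?memvf // mulVg gal_id. Qed.

Lemma galKV s : cancel s (s^-1)%g.
Proof. by move=> a; rewrite -galM ?memvf // mulgV gal_id. Qed.

Lemma gcompVE s t (a : L) : ((gcomp s t)^-1)%g a = (t^-1)%g ((s^-1)%g a).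
Proof. by rewrite /gcomp invMg galM // memvf. Qed.

(* The twist acts by [s^-1], so that the twist by [s] of the twist by [t] is the
   twist by the composite [s o t], as the product law of twisted equivalences
   requires: an L-linear functor out of the twist is [s]-semilinear. *)
Definition twisted s (V : Type) : Type := V.

Section TwistedSpace.
Variables (s : Gal) (V : vectType L).
Local Notation W := (twisted s V).

HB.instance Definition _ := GRing.Zmodule.on W.

Definition twist_scale (a : L) (v : W) : W := (s^-1)%g a *: (v : V).

Lemma twist_scaleA a b v : twist_scale a (twist_scale b v) = twist_scale (a * b) v.
Proof. by rewrite /twist_scale scalerA rmorphM. Qed.

Lemma twist_scale1 : left_id 1 twist_scale.
Proof. by move=> v; rewrite /twist_scale rmorph1 scale1r. Qed.

Lemma twist_scaleDr : right_distributive twist_scale +%R.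
Proof. by move=> a u v; rewrite /twist_scale scalerDr. Qed.

Lemma twist_scaleDl v : {morph twist_scale^~ v : a b / a + b}.
Proof. by move=> a b; rewrite /twist_scale rmorphD scalerDl. Qed.

HB.instance Definition _ := GRing.Zmodule_isLmodule.Build L W
  twist_scaleA twist_scale1 twist_scaleDr twist_scaleDl.

Lemma twisted_vect : Vector.axiom (\dim {:V}) W.
Proof.
exists (fun v : W => map_mx s (bcoord (v : V))) => [a u v|].
  apply/rowP => i; rewrite !mxE /= linearP rmorphD rmorphM /=.
  by rewrite galVK.
have [g gK Kg] := bcoord_bij V.
exists (fun x : 'rV[L]_(\dim {:V}) => g (map_mx (s^-1)%g x)) => x.
  by rewrite -[RHS]gK; congr g; apply/rowP => i; rewrite !mxE galKV.
by rewrite Kg; apply/rowP => i; rewrite !mxE galVK.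
Qed.

HB.instance Definition _ := Lmodule_hasFinDim.Build L W twisted_vect.

End TwistedSpace.

Definition twist_lin s (C : lin_cat L) : lin_cat L := {|
  obj := C;
  mor := fun X Y : C => twisted s (mor X Y);
  idm := @idm L C;
  comp := @comp L C;
  compA := @compA L C;
  comp1m := @comp1m L C;
  compm1 := @compm1 L C;
  comp_linl := fun X Y Z a => @comp_linl L C X Y Z ((s^-1)%g a);
  comp_linr := fun X Y Z a => @comp_linr L C X Y Z ((s^-1)%g a) |}.


Definition tw_obj s (C : lin_cat L) (X : C) : twist_lin s C := X.

Definition tw_iso s (C : lin_cat L) (X Y : C) (i : iso X Y) :
    iso (tw_obj s X) (tw_obj s Y) :=
  @Iso L (twist_lin s C) X Y (ifw i) (ibw i) (ifwK i) (ibwK i).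

Definition twist s (C : mon_cat L) : mon_cat L := {|
  mon_lin := twist_lin s C;
  unt := unt C;
  tob := @tob L C;
  tmor := @tmor L C;
  tmor1 := @tmor1 L C;
  tmor_comp := @tmor_comp L C;
  tmor_linl := fun X Y X' Y' a => @tmor_linl L C X Y X' Y' ((s^-1)%g a);
  tmor_linr := fun X Y X' Y' a => @tmor_linr L C X Y X' Y' ((s^-1)%g a);
  assoc := fun X Y Z => tw_iso s (@assoc L C X Y Z);
  assoc_nat := @assoc_nat L C;
  lunit := fun X => tw_iso s (@lunit L C X);
  lunit_nat := @lunit_nat L C;
  runit := fun X => tw_iso s (@runit L C X);
  runit_nat := @runit_nat L C;
  pentagon := @pentagon L C;
  triangle := @triangle L C |}.

Section TwistFunctor.
Variables (s t : Gal).

(* For [G] defined on the twist of [C] by [t], the functor with the same values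
   on the twist by [s o t], where the two-step twist is read as a single one. *)
Lemma twist_fun_lin (C D : lin_cat L) (G : lin_functor (twist_lin t C) D)
    (X Y : twist_lin (gcomp s t) C) (a : L) (f f' : mor X Y) :
  @fmor L _ _ G X Y (a *: f + f') =
  a *: (@fmor L _ _ G X Y f : mor (tw_obj s (G X)) (tw_obj s (G Y)))
    + (@fmor L _ _ G X Y f' : mor (tw_obj s (G X)) (tw_obj s (G Y))).
Proof.
have -> : a *: f + f' =
    ((s^-1)%g a *: (f : @mor L (twist_lin t C) X Y) + (f' : @mor L (twist_lin t C) X Y)).
  by congr (_ + _); rewrite /GRing.scale /= /twist_scale gcompVE.
exact: (@fmor_lin L (twist_lin t C) D G X Y ((s^-1)%g a) f f').
Qed.

Definition twist_fun (C D : lin_cat L) (G : lin_functor (twist_lin t C) D) :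
    lin_functor (twist_lin (gcomp s t) C) (twist_lin s D) :=
  @LinFunctor L (twist_lin (gcomp s t) C) (twist_lin s D) (fob G)
    (fun X Y f => @fmor L _ _ G X Y f) (@fmor1 L _ _ G) (@fmor_comp L _ _ G)
    (@twist_fun_lin C D G).

Definition twist_mfun (C D : mon_cat L) (G : mon_functor (twist t C) D) :
    mon_functor (twist (gcomp s t) C) (twist s D) :=
  @MonFunctor L (twist (gcomp s t) C) (twist s D) (twist_fun G)
    (fun X Y => tw_iso s (mf_ten G X Y)) (@mf_ten_nat L _ _ G)
    (tw_iso s (mf_unt G)) (@mf_assoc L _ _ G) (@mf_lunit L _ _ G)
    (@mf_runit L _ _ G).

Lemma twist_inv_lin (C D : lin_cat L) (G : lin_functor D (twist_lin t C))
    (X Y : twist_lin s D) (a : L) (f f' : mor X Y) :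
  (@fmor L _ _ G X Y (a *: f + f') : @mor L (twist_lin (gcomp s t) C) (G X) (G Y)) =
  a *: (@fmor L _ _ G X Y f : @mor L (twist_lin (gcomp s t) C) (G X) (G Y))
    + (@fmor L _ _ G X Y f' : @mor L (twist_lin (gcomp s t) C) (G X) (G Y)).
Proof.
transitivity ((s^-1)%g a *: @fmor L _ _ G X Y f + @fmor L _ _ G X Y f').
  exact: (@fmor_lin L D (twist_lin t C) G X Y ((s^-1)%g a) f f').
by congr (_ + _); rewrite /GRing.scale /= /twist_scale gcompVE.
Qed.

Definition twist_inv (C D : lin_cat L) (G : lin_functor D (twist_lin t C)) :
    lin_functor (twist_lin s D) (twist_lin (gcomp s t) C) :=
  @LinFunctor L (twist_lin s D) (twist_lin (gcomp s t) C) (fob G)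
    (fun X Y f => @fmor L _ _ G X Y f) (@fmor1 L _ _ G) (@fmor_comp L _ _ G)
    (@twist_inv_lin C D G).

Lemma twist_fun_equivalence (C D : lin_cat L) (G : lin_functor (twist_lin t C) D) :
  is_equivalence G -> is_equivalence (twist_fun G).
Proof.
case=> H [[eta Heta] [eps Heps]]; exists (twist_inv H); split.
- exists (fun X => @Iso L (twist_lin (gcomp s t) C) (H (G X)) X
    (ifw (eta X)) (ibw (eta X)) (ifwK (eta X)) (ibwK (eta X))).
  exact: Heta.
- exists (fun X => @Iso L (twist_lin s D) (G (H X)) X
    (ifw (eps X)) (ibw (eps X)) (ifwK (eps X)) (ibwK (eps X))).
  exact: Heps.
Qed.

End TwistFunctor.

Lemma comp_equivalence (A B D : lin_cat L) (T : lin_functor B D)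
    (S : lin_functor A B) :
  is_equivalence T -> is_equivalence S -> is_equivalence (comp_functor T S).
Proof.
move=> [T' [[eT nT] [dT mT]]] [S' [[eS nS] [dS mS]]].
exists (comp_functor S' T'); split.
- exists (fun X => iso_comp (eS X) (fmap_iso S' (eT (S X)))) => X Y f /=.
  move: (nT _ _ (fmor S f)) (nS _ _ f) => /= h1 h2.
  by rewrite -compA -fmor_comp h1 fmor_comp !compA h2.
- exists (fun X => iso_comp (dT X) (fmap_iso T (dS (T' X)))) => X Y f /=.
  move: (mS _ _ (fmor T' f)) (mT _ _ f) => /= h1 h2.
  by rewrite -compA -fmor_comp h1 fmor_comp !compA h2.
Qed.

Section Framed.
Variable C : mon_cat L.

Record irr_reps := IrrReps {
  irr :> finType;
  rep : irr -> C;
  rep_simple : forall i, simple_obj (rep i);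
  rep_inj : forall i j, isomorphic (rep i) (rep j) -> i = j;
  rep_surj : forall X, simple_obj X -> exists i, isomorphic X (rep i) }.

Record twisted_equiv s := TwistedEquiv {
  te_fun :> mon_functor (twist s C) C;
  te_equiv : is_equivalence te_fun }.

(* An L-linear functor out of the twist by [s] is [s]-semilinear. *)
Lemma te_semilinear s (T : twisted_equiv s) (X Y : C) (a : L) (f : mor X Y) :
  @fmor L _ _ (te_fun T) X Y (a *: f) = s a *: @fmor L _ _ (te_fun T) X Y f.
Proof.
have f0 : @fmor L _ _ (te_fun T) X Y 0 = 0.
  have := @fmor_lin L _ _ (te_fun T) X Y (-1) 0 0.
  by rewrite !scaleN1r oppr0 addr0 addNr.
have := @fmor_lin L _ _ (te_fun T) X Y (s a) f 0; rewrite addr0 f0 addr0 => <-.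
by congr fmor; rewrite /GRing.scale /= /twist_scale galKV.
Qed.

Definition te_comp s t (T : twisted_equiv s) (S : twisted_equiv t) :
    twisted_equiv (gcomp s t) :=
  TwistedEquiv (te_fun := mcomp_functor T (twist_mfun s S))
    (comp_equivalence (te_equiv T) (twist_fun_equivalence s (te_equiv S))).

Variable I : irr_reps.

Record framed s := Framed {
  fr_te :> twisted_equiv s;
  frame : forall i : I, iso (fr_te (tw_obj s (rep i))) (rep i) }.

Definition fr_comp s t (T : framed s) (S : framed t) : framed (gcomp s t) :=
  @Framed (gcomp s t) (te_comp T S)
    (fun i => iso_comp (frame T i) (fmap_iso T (tw_iso s (frame S i)))).

Definition fr_equiv s (T T' : framed s) : Prop :=
  exists eta : forall X, iso (T X) (T' X),
    mon_nat_iso eta /\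
    forall i, frame T' i \c eta (tw_obj s (rep i)) = frame T i.

Lemma fr_equiv_refl s (T : framed s) : fr_equiv T T.
Proof.
exists (fun X => iso_id (T X)); split=> [|i]; last exact: compm1.
exact: mon_nat_iso_id.
Qed.

Lemma fr_equiv_sym s (T T' : framed s) : fr_equiv T T' -> fr_equiv T' T.
Proof.
case=> eta [mon_eta fr_eta]; exists (inv_nat eta); split=> [|i].
  exact: mon_nat_iso_inv.
by rewrite /= -fr_eta -compA ibwK compm1.
Qed.

Lemma fr_equiv_trans s (T T' T'' : framed s) :
  fr_equiv T T' -> fr_equiv T' T'' -> fr_equiv T T''.
Proof.
move=> [eta [mon_eta fr_eta]] [xi [mon_xi fr_xi]].
exists (vcomp_nat xi eta); split=> [|i]; first exact: mon_nat_iso_vcomp.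
by rewrite /= compA fr_xi fr_eta.
Qed.

Lemma fr_comp_equiv s t (T T' : framed s) (S S' : framed t) :
  fr_equiv T T' -> fr_equiv S S' -> fr_equiv (fr_comp T S) (fr_comp T' S').
Proof.
move=> [eta [mon_eta fr_eta]] [xi [mon_xi fr_xi]].
have mon_txi : @mon_nat_iso L _ _ (twist_mfun s S) (twist_mfun s S')
                 (fun X => tw_iso s (xi X)) by exact: mon_xi.
exists (hcomp_nat eta (fun X => tw_iso s (xi X) :
          iso (twist_mfun s S X) (twist_mfun s S' X))).
split=> [|i]; first exact: mon_nat_iso_hcomp.
have [nat_eta _ _] := mon_eta.
have nat_i := nat_eta _ _ (tw_iso s (frame S' i)).
have fr_Txi : fmor T (tw_iso s (frame S' i)) \c
    fmor T (tw_iso s (xi (tw_obj t (rep i)))) = fmor T (tw_iso s (frame S i)).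
  by rewrite -fmor_comp; congr (fmor _ _); exact: fr_xi.
rewrite -[RHS]/(frame T i \c fmor T (tw_iso s (frame S i))).
rewrite -fr_Txi -fr_eta compA -(compA (frame T' i)) nat_i compA.
exact: compA.
Qed.

(* An element of the group of framed twisted equivalences: an automorphism [s]
   together with an equivalence class of framed twisted equivalences over [s]. *)
Record Pi_fr := PiFr {
  p_fr : Gal;
  fr_class : framed p_fr -> Prop;
  fr_classP : exists T, fr_class = fr_equiv T }.

Lemma Pi_fr_mul_subproof (x y : Pi_fr) :
  exists U, (fun V => exists T S,
     [/\ fr_class (p := x) T, fr_class (p := y) S & fr_equiv (fr_comp T S) V])
   = fr_equiv U.
Proof.
case: (fr_classP x) (fr_classP y) => [T ->] [S ->]; exists (fr_comp T S).
apply: functional_extensionality => V; apply: propositional_extensionality.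
split=> [[T' [S' [TT' SS' TSV]]] | TSV].
  exact: fr_equiv_trans (fr_comp_equiv TT' SS') TSV.
by exists T, S; split=> //; exact: fr_equiv_refl.
Qed.

Definition Pi_fr_mul (x y : Pi_fr) : Pi_fr := PiFr (Pi_fr_mul_subproof x y).

(* Group homomorphism from the Galois group, under composition of automorphisms,
   splitting [p_fr]; preservation of products is all that has to be required. *)
Definition is_section (sec : Gal -> Pi_fr) : Prop :=
  (forall s, p_fr (sec s) = s) /\
  (forall s t, sec (gcomp s t) = Pi_fr_mul (sec s) (sec t)).

End Framed.
End Twist.

(* The scalar extension of [V] to [L] is modelled as the L-vector space on the
   basis [bvec V]; [ext_in v] stands for [v (x) 1] and [bext B] is the L-bilinear
   extension of a K-bilinear map [B] (see [ext_ind] and [bext_in]). *)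
Section ExtSpace.
Variables (K : fieldType) (L : fieldExtType K).

Definition ext_space (V : vectType K) : vectType L := 'rV[L]_(\dim {:V}).

Definition ext_in (V : vectType K) (v : V) : ext_space V :=
  map_mx (in_alg L) (bcoord v).

Lemma ext_in_linear (V : vectType K) (a : K) (u v : V) :
  ext_in (a *: u + v) = a%:A *: ext_in u + ext_in v.
Proof. by rewrite /ext_in linearP map_mxD map_mxZ. Qed.

Lemma ext_inD (V : vectType K) (u v : V) : ext_in (u + v) = ext_in u + ext_in v.
Proof. by rewrite -[u in LHS]scale1r ext_in_linear !scale1r. Qed.

Lemma ext_in0 (V : vectType K) : ext_in (0 : V) = 0.
Proof. by apply: (addrI (ext_in 0)); rewrite -ext_inD !addr0. Qed.

Lemma ext_inZ (V : vectType K) (a : K) (u : V) : ext_in (a *: u) = a%:A *: ext_in u.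
Proof. by rewrite -[a *: u]addr0 ext_in_linear ext_in0 addr0. Qed.

Lemma ext_in_sum (V : vectType K) n (v : 'I_n -> V) :
  ext_in (\sum_i v i) = \sum_i ext_in (v i).
Proof. by apply: (big_morph (@ext_in V) (@ext_inD V) (ext_in0 V)). Qed.

Lemma ext_in_bvec (V : vectType K) i : ext_in (bvec V i) = delta_mx 0 i.
Proof.
apply/rowP => j; rewrite !mxE /bvec coord_free ?(basis_free (vbasisP _)) //=.
by rewrite eq_sym; case: (_ == _); rewrite ?scale1r ?scale0r.
Qed.

Lemma ext_ind (V : vectType K) (P : ext_space V -> Prop) :
  (forall v, P (ext_in v)) -> (forall a x y, P x -> P y -> P (a *: x + y)) ->
  forall x, P x.
Proof.
move=> Pin Plin x; rewrite (row_sum_delta x).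
elim/big_rec: _ => [|i y _ Py]; first by rewrite -(ext_in0 V).
by apply: Plin => //; rewrite -ext_in_bvec.
Qed.

Definition bext (V W U : vectType K) (B : V -> W -> U)
    (x : ext_space V) (y : ext_space W) : ext_space U :=
  \sum_i \sum_j (x 0 i * y 0 j) *: ext_in (B (bvec V i) (bvec W j)).

Section Bext.
Variables (V W U : vectType K) (B : V -> W -> U).

Lemma bext_linl a x x' y :
  bext B (a *: x + x') y = a *: bext B x y + bext B x' y.
Proof.
rewrite /bext scaler_sumr -big_split; apply: eq_bigr => i _ /=.
rewrite scaler_sumr -big_split; apply: eq_bigr => j _ /=.
by rewrite !mxE mulrDl scalerDl -mulrA scalerA.
Qed.

Lemma bext_linr a x y y' :
  bext B x (a *: y + y') = a *: bext B x y + bext B x y'.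
Proof.
rewrite /bext scaler_sumr -big_split; apply: eq_bigr => i _ /=.
rewrite scaler_sumr -big_split; apply: eq_bigr => j _ /=.
by rewrite !mxE mulrDr scalerDl mulrCA scalerA.
Qed.

Hypothesis B_linl : forall a v v' w, B (a *: v + v') w = a *: B v w + B v' w.
Hypothesis B_linr : forall a v w w', B v (a *: w + w') = a *: B v w + B v w'.

Lemma bilin_suml n (c : 'I_n -> K) (v : 'I_n -> V) w :
  B (\sum_i c i *: v i) w = \sum_i c i *: B (v i) w.
Proof.
have B0 : B 0 w = 0.
  by have := B_linl (-1) 0 0 w; rewrite !scaleN1r oppr0 addr0 addNr.
by elim/big_rec2: _ => [|i x y _ <-]; rewrite ?B0 ?B_linl.
Qed.

Lemma bilin_sumr n (c : 'I_n -> K) v (w : 'I_n -> W) :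
  B v (\sum_i c i *: w i) = \sum_i c i *: B v (w i).
Proof.
have B0 : B v 0 = 0.
  by have := B_linr (-1) v 0 0; rewrite !scaleN1r oppr0 addr0 addNr.
by elim/big_rec2: _ => [|i x y _ <-]; rewrite ?B0 ?B_linr.
Qed.

Lemma bext_in v w : bext B (ext_in v) (ext_in w) = ext_in (B v w).
Proof.
rewrite -[v in RHS]bcoordK -[w in RHS]bcoordK bilin_suml ext_in_sum.
apply: eq_bigr => i _; rewrite bilin_sumr ext_inZ ext_in_sum scaler_sumr.
apply: eq_bigr => j _; rewrite ext_inZ scalerA; congr (_ *: _).
by rewrite !mxE.
Qed.

End Bext.
End ExtSpace.

(* The category with the objects of [C] and morphism spaces extended to [L]. *)
Section BaseExtension.
Variables (K : fieldType) (L : fieldExtType K).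

Section Lin.
Variable C : lin_cat K.

Definition emor (X Y : C) : vectType L := ext_space L (mor X Y).

Definition ecomp (X Y Z : C) : emor Y Z -> emor X Y -> emor X Z :=
  bext (@comp K C X Y Z).

Lemma ecomp_in (X Y Z : C) (g : mor Y Z) (f : mor X Y) :
  ecomp (ext_in L g) (ext_in L f) = ext_in L (g \c f).
Proof.
by apply: bext_in => *; [rewrite comp_linl | rewrite comp_linr].
Qed.

Lemma ecompA (X Y Z W : C) (h : emor Z W) (g : emor Y Z) (f : emor X Y) :
  ecomp h (ecomp g f) = ecomp (ecomp h g) f.
Proof.
elim/ext_ind: h => [h|a h h' IH IH']; last first.
  by rewrite /ecomp !bext_linl; congr (_ *: _ + _).
elim/ext_ind: g => [g|a g g' IH IH'].
  elim/ext_ind: f => [f|a f f' IH IH']; first by rewrite !ecomp_in compA.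
  by rewrite /ecomp !bext_linr; congr (_ *: _ + _).
by rewrite /ecomp bext_linl !bext_linr bext_linl; congr (_ *: _ + _).
Qed.

Lemma ecomp1m (X Y : C) (f : emor X Y) : ecomp (ext_in L (idm Y)) f = f.
Proof.
elim/ext_ind: f => [f|a f f' IH IH']; first by rewrite ecomp_in comp1m.
by rewrite /ecomp bext_linr; congr (_ *: _ + _).
Qed.

Lemma ecompm1 (X Y : C) (f : emor X Y) : ecomp f (ext_in L (idm X)) = f.
Proof.
elim/ext_ind: f => [f|a f f' IH IH']; first by rewrite ecomp_in compm1.
by rewrite /ecomp bext_linl; congr (_ *: _ + _).
Qed.

Definition base_ext_lin : lin_cat L :=
  @LinCat L C emor (fun X => ext_in L (idm X)) ecomp ecompA ecomp1m ecompm1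
    (fun X Y Z => bext_linl (@comp K C X Y Z))
    (fun X Y Z => bext_linr (@comp K C X Y Z)).

Lemma eiso_subproof (X Y : C) (g : mor Y X) (f : mor X Y) :
  g \c f = idm X -> ecomp (ext_in L g) (ext_in L f) = ext_in L (idm X).
Proof. by move=> gf; rewrite ecomp_in gf. Qed.

Definition eiso (X Y : C) (i : iso X Y) : @iso L base_ext_lin X Y :=
  @Iso L base_ext_lin X Y (ext_in L (ifw i)) (ext_in L (ibw i))
    (eiso_subproof (ifwK i)) (eiso_subproof (ibwK i)).

End Lin.

Section Mon.
Variable C : mon_cat K.
Local Notation D := (base_ext_lin C).

Definition etmor (X Y X' Y' : D) :
    @mor L D X X' -> @mor L D Y Y' -> @mor L D (X \ox Y) (X' \ox Y') :=
  bext (@tmor K C X Y X' Y').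

Lemma etmor_in (X Y X' Y' : C) (f : mor X X') (g : mor Y Y') :
  etmor (ext_in L f) (ext_in L g) = ext_in L (f \om g).
Proof.
by apply: bext_in => *; [rewrite tmor_linl | rewrite tmor_linr].
Qed.

Lemma etmor1 (X Y : D) : etmor (idm X) (idm Y) = @idm L D (X \ox Y).
Proof. by rewrite etmor_in tmor1. Qed.

Lemma etmor_comp (X Y X' Y' X'' Y'' : D) (f' : mor X' X'') (g' : mor Y' Y'')
    (f : mor X X') (g : mor Y Y') :
  etmor (f' \c f) (g' \c g) = etmor f' g' \c etmor f g.
Proof.
elim/ext_ind: f' => [f'|a u v IH IH']; last first.
  by rewrite comp_linl /etmor !bext_linl comp_linl; congr (_ *: _ + _).
elim/ext_ind: g' => [g'|a u v IH IH']; last first.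
  by rewrite comp_linl /etmor !bext_linr comp_linl; congr (_ *: _ + _).
elim/ext_ind: f => [f|a u v IH IH']; last first.
  by rewrite comp_linr /etmor !bext_linl comp_linr; congr (_ *: _ + _).
elim/ext_ind: g => [g|a u v IH IH']; last first.
  by rewrite comp_linr /etmor !bext_linr comp_linr; congr (_ *: _ + _).
rewrite [X in etmor X _]ecomp_in [X in etmor _ X]ecomp_in !etmor_in [RHS]ecomp_in.
by apply: (congr1 (@ext_in K L _)); exact: tmor_comp.
Qed.

Lemma eassoc_nat (X Y Z X' Y' Z' : D) (f : mor X X') (g : mor Y Y')
    (h : mor Z Z') :
  eiso (assoc X' Y' Z') \c etmor (etmor f g) h =
  etmor f (etmor g h) \c eiso (assoc X Y Z).
Proof.
elim/ext_ind: f => [f|a u v IH IH']; last first.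
  by rewrite /etmor !bext_linl comp_linr comp_linl; congr (_ *: _ + _).
elim/ext_ind: g => [g|a u v IH IH']; last first.
  rewrite /etmor bext_linl !bext_linr bext_linl comp_linr comp_linl.
  by congr (_ *: _ + _).
elim/ext_ind: h => [h|a u v IH IH']; last first.
  by rewrite /etmor !bext_linr comp_linr comp_linl; congr (_ *: _ + _).
rewrite !etmor_in [LHS]ecomp_in [RHS]ecomp_in; apply: (congr1 (@ext_in K L _)); exact: assoc_nat.
Qed.

Lemma elunit_nat (X X' : D) (f : mor X X') :
  eiso (lunit X') \c etmor (idm (unt C : D)) f = f \c eiso (lunit X).
Proof.
elim/ext_ind: f => [f|a u v IH IH']; last first.
  by rewrite /etmor !bext_linr comp_linr comp_linl; congr (_ *: _ + _).
rewrite etmor_in [LHS]ecomp_in [RHS]ecomp_in; apply: (congr1 (@ext_in K L _)); exact: lunit_nat.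
Qed.

Lemma erunit_nat (X X' : D) (f : mor X X') :
  eiso (runit X') \c etmor f (idm (unt C : D)) = f \c eiso (runit X).
Proof.
elim/ext_ind: f => [f|a u v IH IH']; last first.
  by rewrite /etmor !bext_linl comp_linr comp_linl; congr (_ *: _ + _).
rewrite etmor_in [LHS]ecomp_in [RHS]ecomp_in; apply: (congr1 (@ext_in K L _)); exact: runit_nat.
Qed.

Lemma epentagon (X Y Z W : D) :
  eiso (assoc X Y (tob Z W)) \c eiso (assoc (tob X Y) Z W) =
  etmor (idm X) (eiso (assoc Y Z W)) \c eiso (assoc X (tob Y Z) W) \c
    etmor (eiso (assoc X Y Z)) (idm W).
Proof.
rewrite !etmor_in [LHS]ecomp_in.
rewrite -[RHS]/(ecomp (ecomp (ext_in L _) (ext_in L _)) (ext_in L _)) !ecomp_in.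
apply: (congr1 (@ext_in K L _)); exact: pentagon.
Qed.

Lemma etriangle (X Y : D) :
  etmor (idm X) (eiso (lunit Y)) \c eiso (assoc X (unt C) Y) =
  etmor (eiso (runit X)) (idm Y).
Proof.
rewrite !etmor_in [LHS]ecomp_in; apply: (congr1 (@ext_in K L _)); exact: triangle.
Qed.

Definition base_ext : mon_cat L :=
  @MonCat L D (unt C) (@tob K C) etmor etmor1 etmor_comp
    (fun X Y X' Y' a f f' g => bext_linl (@tmor K C X Y X' Y') a f f' g)
    (fun X Y X' Y' a f g g' => bext_linr (@tmor K C X Y X' Y') a f g g')
    (fun X Y Z => eiso (assoc X Y Z)) eassoc_nat
    (fun X => eiso (lunit X)) elunit_nat (fun X => eiso (runit X)) erunit_nat
    epentagon etriangle.

End Mon.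
End BaseExtension.

(* Idempotent completion (Karoubi envelope). *)
Section Karoubi.
Variable F : fieldType.

Section Lin.
Variable C : lin_cat F.

Record kobj := KObj {
  kob :> C;
  kid : mor kob kob;
  kidK : kid \c kid = kid }.

Implicit Types A B D E : kobj.

Definition kdefect A B (f : mor (kob A) (kob B)) : mor (kob A) (kob B) :=
  kid B \c f \c kid A - f.

Lemma kdefect_linear A B : linear (@kdefect A B).
Proof.
move=> a f g; rewrite /kdefect comp_linr comp_linl scalerBr opprD addrACA.
by [].
Qed.

HB.instance Definition _ A B :=
  GRing.isLinear.Build F (mor (kob A) (kob B)) (mor (kob A) (kob B)) _
    (@kdefect A B) (@kdefect_linear A B).

(* Morphisms [f : A -> B] of the underlying objects with [kid B o f o kid A = f]
   (see [kmorP]). *)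
Definition kspace A B : {vspace mor (kob A) (kob B)} := lker (linfun (@kdefect A B)).

Definition kmor A B : vectType F := subvs_of (kspace A B).

Lemma kmorP A B (f : mor (kob A) (kob B)) :
  reflect (kid B \c f \c kid A = f) (f \in kspace A B).
Proof. by rewrite memv_ker lfunE /= subr_eq0; exact: eqP. Qed.

Lemma kmor_l A B (f : kmor A B) : kid B \c vsval f = vsval f.
Proof. by have /kmorP <- := subvsP f; rewrite !compA kidK. Qed.

Lemma kmor_r A B (f : kmor A B) : vsval f \c kid A = vsval f.
Proof. by have /kmorP <- := subvsP f; rewrite -compA kidK. Qed.

Lemma kmor_in A B (f : mor (kob A) (kob B)) :
  kid B \c f = f -> f \c kid A = f -> f \in kspace A B.
Proof. by move=> e1 e2; apply/kmorP; rewrite e1 e2. Qed.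

Lemma kid_in A : kid A \in kspace A A.
Proof. by apply: kmor_in; exact: kidK. Qed.

Definition kidm A : kmor A A := Subvs (kid_in A).

Lemma kcomp_in A B D (g : kmor B D) (f : kmor A B) :
  vsval g \c vsval f \in kspace A D.
Proof. by apply: kmor_in; [rewrite compA kmor_l | rewrite -compA kmor_r]. Qed.

Definition kcomp A B D (g : kmor B D) (f : kmor A B) : kmor A D :=
  Subvs (kcomp_in g f).

Lemma kcompA A B D E (h : kmor D E) (g : kmor B D) (f : kmor A B) :
  kcomp h (kcomp g f) = kcomp (kcomp h g) f.
Proof. by apply: val_inj; exact: compA. Qed.

Lemma kcomp1m A B (f : kmor A B) : kcomp (kidm B) f = f.
Proof. by apply: val_inj; exact: kmor_l. Qed.

Lemma kcompm1 A B (f : kmor A B) : kcomp f (kidm A) = f.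
Proof. by apply: val_inj; exact: kmor_r. Qed.

Lemma kcomp_linl A B D a (g g' : kmor B D) (f : kmor A B) :
  kcomp (a *: g + g') f = a *: kcomp g f + kcomp g' f.
Proof. by apply: val_inj; exact: comp_linl. Qed.

Lemma kcomp_linr A B D a (g : kmor B D) (f f' : kmor A B) :
  kcomp g (a *: f + f') = a *: kcomp g f + kcomp g f'.
Proof. by apply: val_inj; exact: comp_linr. Qed.

Definition karoubi_lin : lin_cat F :=
  LinCat kcompA kcomp1m kcompm1 kcomp_linl kcomp_linr.

Section KIso.
Variables (A B : kobj) (i : iso (kob A) (kob B)).
Hypothesis i_kid : kid B \c i = i \c kid A.

Lemma ibw_kid : kid A \c ibw i = ibw i \c kid B.
Proof.
rewrite -[LHS]comp1m -(ifwK i) -compA (compA (ifw i)) -i_kid.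
by rewrite -compA ibwK compm1.
Qed.

Lemma kiso_fw_in : i \c kid A \in kspace A B.
Proof.
apply: kmor_in; last by rewrite -compA kidK.
by rewrite compA i_kid -compA kidK.
Qed.

Lemma kiso_bw_in : kid A \c ibw i \in kspace B A.
Proof.
apply: kmor_in; first by rewrite compA kidK.
by rewrite -compA -ibw_kid compA kidK.
Qed.

Definition kiso_fw : kmor A B := Subvs kiso_fw_in.
Definition kiso_bw : kmor B A := Subvs kiso_bw_in.

Lemma kiso_fwK : kcomp kiso_bw kiso_fw = kidm A.
Proof.
apply: val_inj; rewrite /= -compA (compA (ibw i)) ifwK comp1m.
exact: kidK.
Qed.

Lemma kiso_bwK : kcomp kiso_fw kiso_bw = kidm B.
Proof.
apply: val_inj; rewrite /= -compA (compA (kid A)) kidK.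
by rewrite compA -i_kid -compA ibwK compm1.
Qed.

Definition kiso : @iso F karoubi_lin A B :=
  @Iso F karoubi_lin A B kiso_fw kiso_bw kiso_fwK kiso_bwK.

End KIso.
End Lin.

Section Mon.
Variable C : mon_cat F.
Local Notation kobj := (kobj C).
Implicit Types A B D E : kobj.

Lemma ktob_subproof A B :
  (kid A \om kid B) \c (kid A \om kid B) = kid A \om kid B.
Proof. by rewrite -tmor_comp !kidK. Qed.

Definition ktob A B : kobj := KObj (ktob_subproof A B).

Definition kunt : kobj := KObj (comp1m (idm (unt C))).

Lemma ktmor_in A B A' B' (f : kmor A A') (g : kmor B B') :
  vsval f \om vsval g \in kspace (ktob A B) (ktob A' B').
Proof.
by apply: kmor_in; rewrite -tmor_comp; [rewrite !kmor_l | rewrite !kmor_r].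
Qed.

Definition ktmor A B A' B' (f : kmor A A') (g : kmor B B') :
    kmor (ktob A B) (ktob A' B') :=
  Subvs (ktmor_in f g).

Lemma ktmor1 A B : ktmor (kidm A) (kidm B) = kidm (ktob A B).
Proof. exact: val_inj. Qed.

Lemma ktmor_comp A B A' B' A'' B'' (f' : kmor A' A'') (g' : kmor B' B'')
    (f : kmor A A') (g : kmor B B') :
  ktmor (kcomp f' f) (kcomp g' g) = kcomp (ktmor f' g') (ktmor f g).
Proof. by apply: val_inj; exact: tmor_comp. Qed.

Lemma ktmor_linl A B A' B' a (f f' : kmor A A') (g : kmor B B') :
  ktmor (a *: f + f') g = a *: ktmor f g + ktmor f' g.
Proof. by apply: val_inj; exact: tmor_linl. Qed.

Lemma ktmor_linr A B A' B' a (f : kmor A A') (g g' : kmor B B') :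
  ktmor f (a *: g + g') = a *: ktmor f g + ktmor f g'.
Proof. by apply: val_inj; exact: tmor_linr. Qed.

Lemma kassoc_subproof A B D :
  kid (ktob A (ktob B D)) \c assoc (kob A) (kob B) (kob D) =
  assoc (kob A) (kob B) (kob D) \c kid (ktob (ktob A B) D).
Proof. by rewrite assoc_nat. Qed.

Definition kassoc A B D :
    @iso F (karoubi_lin C) (ktob (ktob A B) D) (ktob A (ktob B D)) :=
  @kiso C (ktob (ktob A B) D) (ktob A (ktob B D)) (assoc _ _ _) (kassoc_subproof A B D).

Lemma klunit_subproof A :
  kid A \c lunit (kob A) = lunit (kob A) \c kid (ktob kunt A).
Proof. by rewrite lunit_nat. Qed.

Definition klunit A : @iso F (karoubi_lin C) (ktob kunt A) A :=
  @kiso C (ktob kunt A) A (lunit _) (klunit_subproof A).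

Lemma krunit_subproof A :
  kid A \c runit (kob A) = runit (kob A) \c kid (ktob A kunt).
Proof. by rewrite runit_nat. Qed.

Definition krunit A : @iso F (karoubi_lin C) (ktob A kunt) A :=
  @kiso C (ktob A kunt) A (runit _) (krunit_subproof A).

(* Naturality of [kiso] from naturality of the underlying isomorphisms. *)
Lemma kiso_nat A B A' B' (i : iso (kob A) (kob B)) (i' : iso (kob A') (kob B'))
    (Hi : kid B \c i = i \c kid A) (Hi' : kid B' \c i' = i' \c kid A')
    (f : kmor A A') (g : kmor B B') :
  i' \c vsval f = vsval g \c i ->
  kcomp (kiso_fw Hi') f = kcomp g (kiso_fw Hi).
Proof.
move=> fg; apply: val_inj => /=.
by rewrite -compA kmor_l compA -fg -compA kmor_r.
Qed.

Lemma kassoc_nat A B D A' B' D' (f : kmor A A') (g : kmor B B') (h : kmor D D') :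
  kcomp (ifw (kassoc A' B' D')) (ktmor (ktmor f g) h) =
  kcomp (ktmor f (ktmor g h)) (ifw (kassoc A B D)).
Proof. by apply: kiso_nat; exact: assoc_nat. Qed.

Lemma klunit_nat A A' (f : kmor A A') :
  kcomp (ifw (klunit A')) (ktmor (kidm kunt) f) = kcomp f (ifw (klunit A)).
Proof. by apply: kiso_nat; exact: lunit_nat. Qed.

Lemma krunit_nat A A' (f : kmor A A') :
  kcomp (ifw (krunit A')) (ktmor f (kidm kunt)) = kcomp f (ifw (krunit A)).
Proof. by apply: kiso_nat; exact: runit_nat. Qed.

Lemma kpentagon A B D E :
  kcomp (ifw (kassoc A B (ktob D E))) (ifw (kassoc (ktob A B) D E)) =
  kcomp (kcomp (ktmor (kidm A) (ifw (kassoc B D E))) (ifw (kassoc A (ktob B D) E)))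
    (ktmor (ifw (kassoc A B D)) (kidm E)).
Proof.
apply: val_inj => /=.
set e := ((kid A \om kid B) \om kid D) \om kid E.
have eE : e \c e = e by rewrite /e -!tmor_comp !kidK.
have -> : assoc (kob A) (kob B) (kob D \ox kob E) \c
      ((kid A \om kid B) \om (kid D \om kid E)) \c
      (assoc (kob A \ox kob B) (kob D) (kob E) \c e) =
    assoc (kob A) (kob B) (kob D \ox kob E) \c
      assoc (kob A \ox kob B) (kob D) (kob E) \c e.
  rewrite -compA (compA (_ \om _)) -assoc_nat -(compA (ifw (assoc _ _ _))) -/e eE.
  by rewrite compA.
rewrite pentagon.
have -> : kid A \om (assoc (kob B) (kob D) (kob E) \c ((kid B \om kid D) \om kid E)) =
    (idm (kob A) \om assoc (kob B) (kob D) (kob E)) \c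
      (kid A \om ((kid B \om kid D) \om kid E)).
  by rewrite -tmor_comp comp1m.
have -> : (assoc (kob A) (kob B) (kob D) \c ((kid A \om kid B) \om kid D)) \om kid E =
    (assoc (kob A) (kob B) (kob D) \om idm (kob E)) \c e.
  by rewrite -tmor_comp comp1m.
set a1 := idm _ \om _; set a3 := _ \om idm _.
set a2 := ifw (assoc (kob A) (kob B \ox kob D) (kob E)).
set e1 := kid A \om _; set e2 := _ \om kid E.
have e12 : e1 \c a2 = a2 \c e2 by rewrite /e1 /a2 /e2 assoc_nat.
have e22 : e2 \c e2 = e2 by rewrite /e2 -!tmor_comp !kidK.
have e23 : e2 \c a3 = a3 \c e.
  by rewrite /e2 /a3 /e -!tmor_comp comp1m compm1 -assoc_nat.
rewrite -[RHS]compA -[RHS]compA -[in RHS](compA a2) [in RHS](compA e1) e12.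
rewrite -[in RHS](compA a2).
rewrite [in RHS](compA e2 e2) e22 [in RHS](compA e2) e23 -[in RHS](compA a3) eE.
by rewrite !compA.
Qed.

Lemma ktriangle A B :
  kcomp (ktmor (kidm A) (ifw (klunit B))) (ifw (kassoc A kunt B)) =
  ktmor (ifw (krunit A)) (kidm B).
Proof.
apply: val_inj => /=.
set e := (kid A \om idm (unt C)) \om kid B.
have -> : kid A \om (lunit (kob B) \c (idm (unt C) \om kid B)) =
    (idm (kob A) \om lunit (kob B)) \c (kid A \om (idm (unt C) \om kid B)).
  by rewrite -tmor_comp comp1m.
have -> : (runit (kob A) \c (kid A \om idm (unt C))) \om kid B =
    (runit (kob A) \om idm (kob B)) \c e.
  by rewrite -tmor_comp comp1m.
rewrite -triangle -!compA; congr (_ \c _).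
rewrite compA -assoc_nat -compA; congr (_ \c _).
by rewrite /e -!tmor_comp !kidK comp1m.
Qed.

Definition karoubi : mon_cat F :=
  @MonCat F (karoubi_lin C) kunt ktob ktmor ktmor1 ktmor_comp ktmor_linl ktmor_linr
    kassoc kassoc_nat klunit klunit_nat krunit krunit_nat kpentagon ktriangle.

End Mon.
End Karoubi.

Definition scalar_ext (K : fieldType) (L : fieldExtType K) (C : mon_cat K) :
    mon_cat L :=
  karoubi (base_ext L C).

(* [CK] is a K-form of [C]; functors are linear by definition of [lin_functor]. *)
Definition is_form (K : fieldType) (L : fieldExtType K) (C : fusion_cat L)
    (CK : fusion_cat K) : Prop :=
  exists T : mon_functor (scalar_ext L CK) C, is_equivalence T.

(* Main.v *)
(* Descent.  Write E = C_K (x) L without idempotent completion; if C_K is split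
   then E is already equivalent to C.  The Galois group acts on E by conjugating
   the coefficients of morphisms and fixing the objects; transporting this action
   along E = C, with frames that come from objects of C_K, gives a section.

   Conversely, representatives (F_s, f_s) of a section come with tensor
   isomorphisms mu : F_s F_t -> F_(st) compatible with the frames.  The fixed
   category has as objects the X with structure maps u_s : F_s X -> X satisfying
   u_(st) mu = u_s F_s(u_t), and as morphisms the equivariant ones; the frames turn
   the simple objects into such equivariant objects.  By Galois descent for vector
   spaces Hom = Hom^Gamma (x) L, and every object of C carries an equivariant
   structure, being a direct sum of simple ones.  Semisimplicity descends in the
   form that each f has some g with f g f = f, by averaging g against an element of
   trace one. *)

From HB Require Import structures.
From Stdlib Require Import ClassicalEpsilon ProofIrrelevance.
From Stdlib Require Import FunctionalExtensionality PropExtensionality.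
From mathcomp Require Import all_boot all_order all_fingroup all_algebra.
From mathcomp Require Import all_field.
Require Import Defs.

Set Implicit Arguments.
Unset Strict Implicit.
Unset Printing Implicit Defensive.

Import GRing.Theory.
Local Open Scope ring_scope.

(** * Regular morphisms and semisimplicity *)

(** Conjugation fixes the objects of E but moves those of its idempotent completion, because an
    object there is an idempotent with coefficients in L. Hence a form is first brought back to an
    equivalence between E itself and C.

    In the converse no cocycle has to be trivialised: equality of framed classes supplies mu
    together with its compatibility with the frames, which says exactly that the frames are
    equivariant structures on the simple objects. A section does not identify F_1 with the identity
    functor; that identification is extracted from mu at (1, 1), using that F_1 is fully faithful.

    Averaging cannot divide by the order of the Galois group, which may vanish in K; invertibility
    of the Galois matrix gives an element of trace one in every characteristic. The condition f g f
    = f is affine in g, so it survives averaging when f is invariant. Together with split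
    idempotents it yields kernels, cokernels and splittings of monomorphisms and epimorphisms, and
    so replaces any direct descent of the abelian and semisimple axioms. *)

Section LinearCategories.
Variables (F : fieldType) (C : lin_cat F).
Implicit Types X Y Z : C.

Lemma compNl X Y Z (g : mor Y Z) (f : mor X Y) : (- g) \c f = - (g \c f).
Proof. by rewrite -scaleN1r compZl scaleN1r. Qed.

Lemma compNr X Y Z (g : mor Y Z) (f : mor X Y) : g \c (- f) = - (g \c f).
Proof. by rewrite -scaleN1r compZr scaleN1r. Qed.

Lemma compBl X Y Z (g g' : mor Y Z) (f : mor X Y) :
  (g - g') \c f = g \c f - g' \c f.
Proof. by rewrite compDl compNl. Qed.

Lemma compBr X Y Z (g : mor Y Z) (f f' : mor X Y) :
  g \c (f - f') = g \c f - g \c f'.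
Proof. by rewrite compDr compNr. Qed.

Lemma comp_suml (J : finType) X Y Z (g : J -> mor Y Z) (f : mor X Y) :
  (\sum_j g j) \c f = \sum_j g j \c f.
Proof. exact: (big_morph (fun g => g \c f) (fun g g' => compDl g g' f) (comp0m _ f)). Qed.

Lemma comp_sumr (J : finType) X Y Z (g : mor Y Z) (f : J -> mor X Y) :
  g \c (\sum_j f j) = \sum_j g \c f j.
Proof. exact: (big_morph (fun f => g \c f) (fun f f' => compDr g f f') (compm0 _ g)). Qed.

Lemma iso_sig X Y (f : mor X Y) : is_iso f -> {i : iso X Y | ifw i = f}.
Proof. exact: constructive_indefinite_description. Qed.

Lemma is_iso_intro X Y (f : mor X Y) (g : mor Y X) :
  g \c f = idm X -> f \c g = idm Y -> is_iso f.
Proof. by move=> gf fg; exists (Iso gf fg). Qed.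

Lemma iso_monic X Y (i : iso X Y) W (f g : mor W X) : i \c f = i \c g -> f = g.
Proof. by move=> e; rewrite -[f]comp1m -[g]comp1m -(ifwK i) -!compA e. Qed.

Lemma iso_epic X Y (i : iso X Y) W (f g : mor Y W) : f \c i = g \c i -> f = g.
Proof. by move=> e; rewrite -[f]compm1 -[g]compm1 -(ibwK i) !compA e. Qed.

Lemma isomorphic_sym X Y : isomorphic X Y -> isomorphic Y X.
Proof. by case=> i; exists; exact: iso_inv. Qed.

Lemma is_zeroP X : is_zero X <-> idm X = 0.
Proof.
split=> [/(_ X)[h _]|e Y]; first exact: h.
split=> f; first by rewrite -[f]comp1m e comp0m.
by rewrite -[f]compm1 e compm0.
Qed.

Lemma end_is_base_neq0 X : end_is_base X -> idm X <> 0.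
Proof.
case=> h hK _ e; have := hK 1; have := hK 0; rewrite e !scaler0 => -> /eqP.
by rewrite eq_sym oner_eq0.
Qed.

Lemma end_is_base_scalar X : end_is_base X ->
  forall f : mor X X, exists a, f = a *: idm X.
Proof. by case=> h _ hK f; exists (h f); rewrite hK. Qed.

Lemma end_is_base_intro X : idm X <> 0 ->
  (forall f : mor X X, exists a, f = a *: idm X) -> end_is_base X.
Proof.
move=> n0 h; have h' f := constructive_indefinite_description _ (h f).
exists (fun f => sval (h' f)) => [a|f]; last by case: (h' f).
case: (h' _) => b /= /eqP; rewrite -subr_eq0 -scalerBl scaler_eq0.
by case/orP => [|/eqP //]; rewrite subr_eq0 => /eqP ->.
Qed.

Lemma end_is_base_iso X Y : isomorphic X Y -> end_is_base X -> end_is_base Y.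
Proof.
case=> i bX; apply: end_is_base_intro => [e|f].
  apply: (end_is_base_neq0 bX).
  by rewrite -(ifwK i) -[ibw i]compm1 e compm0 comp0m.
have [a e] := end_is_base_scalar bX (ibw i \c f \c i); exists a.
apply: (@iso_monic _ _ (iso_inv i)); apply: (iso_epic (i := i)) => /=.
by rewrite e compZr compm1 compZl ifwK.
Qed.

(** Von Neumann regularity. This is the form of semisimplicity that passes to the invariants of a
    Galois action. *)
Definition regular_mor X Y (f : mor X Y) : Prop :=
  exists g : mor Y X, f \c g \c f = f.

Definition idem_split : Prop :=
  forall X (e : mor X X), e \c e = e ->
  exists Z (i : mor Z X) (p : mor X Z), p \c i = idm Z /\ i \c p = e.

(** [is_dirsum] over an arbitrary finite index type, so that a summand can be adjoined by passing
    from ['I_n] to [option 'I_n]. *)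
Definition dsum (J : finType) (S : J -> C) X : Prop :=
  exists (i : forall j, mor (S j) X) (p : forall j, mor X (S j)),
    [/\ forall j, p j \c i j = idm (S j),
        forall j k, j != k -> p j \c i k = 0
      & \sum_j i j \c p j = idm X].

Lemma dsum_ord (J : finType) (S : J -> C) X :
  dsum S X -> is_dirsum (fun j : 'I_#|J| => S (enum_val j)) X.
Proof.
case=> i [p [pi0 pi1 ip]].
exists (fun j => i (enum_val j)), (fun j => p (enum_val j)); split=> // [j k jk|].
  by apply: pi1; rewrite (inj_eq enum_val_inj).
by rewrite -ip [RHS](reindex (@enum_val J predT)) //; apply/onW_bij/enum_val_bij.
Qed.

Lemma dsum_option n (S : 'I_n -> C) X0 X' X
    (i0 : mor X0 X) (p0 : mor X X0) (i1 : mor X' X) (p1 : mor X X') :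
  p0 \c i0 = idm X0 -> p1 \c i1 = idm X' -> p0 \c i1 = 0 -> p1 \c i0 = 0 ->
  i0 \c p0 + i1 \c p1 = idm X -> is_dirsum S X' ->
  dsum (fun j : option 'I_n => if j is Some k then S k else X0) X.
Proof.
move=> e00 e11 e01 e10 e [i [p [pi0 pi1 ip]]].
exists (fun j => match j return mor (if j is Some k then S k else X0) X with
   Some k => i1 \c i k | None => i0 end).
exists (fun j => match j return mor X (if j is Some k then S k else X0) with
   Some k => p k \c p1 | None => p0 end).
split.
- by case=> [j|] //; rewrite -compA (compA p1) e11 comp1m.
- case=> [j|] [k|] // jk.
  + by rewrite -compA (compA p1) e11 comp1m pi1.
  + by rewrite -compA e10 compm0.
  + by rewrite compA e01 comp0m.
rewrite -e (bigD1 None) //=; congr (_ + _).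
rewrite -[i1 in RHS]compm1 -ip comp_sumr comp_suml.
rewrite (reindex_omap Some id) /=; last by case.
by apply: eq_big => [j|j _]; rewrite ?eqxx // !compA.
Qed.

(** A kernel inclusion is monic, so simplicity of [X] makes it zero or invertible. Invertibility
    would give [f = 0]; otherwise [f] is monic and simplicity of [Y] applies. *)
Lemma schur X Y (f : mor X Y) : simple_obj X -> simple_obj Y ->
  (exists K (k : mor K X), is_kernel f k) -> f <> 0 -> is_iso f.
Proof.
move=> [nX sX] [nY sY] [K [k [fk uk]]] f0.
have mk : is_mono k.
  move=> W g h e; have [|u [_ hu]] := uk _ (k \c g).
    by rewrite compA fk comp0m.
  by rewrite -(hu g) // -(hu h).
have [K0|[i ik]] := sX _ _ mk; last first.
  case: f0; apply: (iso_epic (i := i)); rewrite ik fk comp0m //.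
have mf : is_mono f.
  move=> W g h e; have [|u [hu _]] := uk _ (g - h).
    by rewrite compBr e subrr.
  by apply/eqP; rewrite -subr_eq0 -hu (proj1 (K0 W) u) compm0.
by have [] := sY _ _ mf.
Qed.

(** * Regularity of morphisms in a semisimple category *)

Section Regular.
Hypothesis kernels : forall X Y (f : mor X Y), exists K (k : mor K X), is_kernel f k.
Hypothesis semisimple : semisimple_cat C.

(** Some component of [f] into a simple summand of [Y] is nonzero, hence invertible by Schur's
    lemma; its inverse after the projection is the retraction. *)
Lemma simple_split_mono X Y (f : mor X Y) :
  simple_obj X -> f <> 0 -> exists h : mor Y X, h \c f = idm X.
Proof.
move=> sX /eqP f0; have [n [S [sS [i [p [_ _ ip]]]]]] := semisimple Y.
have [j pf] : exists j, p j \c f != 0.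
  apply/existsP; apply: contraNT f0 => /existsPn h.
  rewrite -[f]comp1m -ip comp_suml big1 // => j _.
  by have := h j; rewrite negbK -compA => /eqP ->; rewrite compm0.
have [u eu] := schur sX (sS j) (kernels (p j \c f)) (elimN eqP pf).
by exists (ibw u \c p j); rewrite -compA -eu ifwK.
Qed.

(* Gaussian elimination along the simple summands of [X]: [f \c g] fixes the
   components of [f] treated so far, and a component it does not fix is split
   off by Schur's lemma. *)
Lemma semisimple_regular X Y (f : mor X Y) : regular_mor f.
Proof.
have [n [S [sS [i [p [_ _ ip]]]]]] := semisimple X.
suff [g gP] : exists g : mor Y X,
    forall k, k \in index_enum 'I_n -> f \c g \c (f \c i k) = f \c i k.
  exists g; rewrite -[LHS]compm1 -[in RHS](compm1 f) -ip !comp_sumr.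
  apply: eq_bigr => k _; rewrite !compA -(compA _ f) gP ?mem_index_enum //.
elim: (index_enum _) => [|k r [g gP]]; first by exists 0.
pose d := f \c i k - f \c g \c (f \c i k).
have [d0|/eqP d0] := eqVneq d 0.
  exists g => j; rewrite inE => /orP[/eqP ->|/gP //].
  by apply/esym/eqP; rewrite -subr_eq0; apply/eqP.
have [h hd] := simple_split_mono (sS k) d0.
(* [h (1 - f g)] kills the components already fixed by [f g] and still sends [f \c i k] to
   [h \c d = idm (S k)]. *)
pose h' := h - h \c f \c g.
have h'k : h' \c (f \c i k) = idm (S k).
  by rewrite -hd /d /h' compBl compBr -!compA.
have h'r j : j \in r -> h' \c (f \c i j) = 0.
  by move=> /gP e; rewrite /h' compBl -[X in _ - X]compA -(compA h) -{1}e !compA subrr.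
(* For the new [g] the composite [f g] increases by [d \c h']: nothing changes on the earlier
   components, and the defect [d] is added on component [k]. *)
exists (g - g \c (f \c i k) \c h' + i k \c h') => j; rewrite inE.
have -> : f \c (g - g \c (f \c i k) \c h' + i k \c h') \c (f \c i j) =
   f \c g \c (f \c i j) - f \c g \c (f \c i k) \c (h' \c (f \c i j)) +
   f \c i k \c (h' \c (f \c i j)).
  by rewrite compDr compBr compDl compBl -!compA.
case/orP => [/eqP ->|jr].
  by rewrite h'k !compm1 subrr add0r.
by rewrite h'r // !compm0 subr0 addr0 gP.
Qed.

End Regular.

(** The image of an idempotent [e] is the kernel of [1 - e]. *)
Lemma kernels_idem_split :
  (forall X Y (f : mor X Y), exists K (k : mor K X), is_kernel f k) -> idem_split.
Proof.
move=> ker X e ee; have [K [k [ek uk]]] := ker _ _ (idm X - e).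
have ke : e \c k = k.
  by apply/esym/eqP; rewrite -subr_eq0 -ek compBl comp1m.
have [|u [ku _]] := uk _ e; first by rewrite compBl comp1m ee subrr.
exists K, k, u; split=> //.
have [|v [_ vu]] := uk _ k; first by rewrite ek.
by rewrite -(vu (u \c k)) ?(vu (idm K)) ?compm1 // compA ku.
Qed.

(** * Abelian structure from regular morphisms and split idempotents *)

Section AbelianOfRegular.
Hypothesis zero : exists Z : C, is_zero Z.
Hypothesis sums :
  forall X Y, exists P, @is_dirsum F C 2 (fun j => if j == ord0 then X else Y) P.
Hypothesis isplit : idem_split.
Hypothesis regular : forall X Y (f : mor X Y), regular_mor f.

(** If [f g f = f], then [1 - g f] and [1 - f g] are idempotents, and splitting them gives the
    kernel and the cokernel of [f]. A mono [k] has a retraction [g] and is the kernel of [1 - k g];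
    dually for an epi. *)
Lemma regular_abelian : abelian_cat C.
Proof.
split=> // [X Y f|K X k mk|Y Q q eq].
- have [g gP] := regular f; split.
    have [|Z [i [p [pi ip]]]] := isplit (e := idm X - g \c f).
      by rewrite compBl comp1m compBr compm1 -compA (compA f) gP subrr subr0.
    exists Z, i; split.
      by rewrite -[i]compm1 -pi (compA i) ip compA compBr compm1 compA gP subrr comp0m.
    move=> W h fh; exists (p \c h); split.
      by rewrite compA ip compBl comp1m -compA fh compm0 subr0.
    by move=> u <-; rewrite compA pi comp1m.
  have [|Z [i [p [pi ip]]]] := isplit (e := idm Y - f \c g).
    by rewrite compBl comp1m compBr compm1 compA gP subrr subr0.
  exists Z, p; split.
    by rewrite -[p]comp1m -pi -(compA p) ip -compA compBl comp1m gP subrr compm0.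
  move=> W h hf; exists (h \c i); split.
    by rewrite -compA ip compBr compm1 compA hf comp0m subr0.
  by move=> u <-; rewrite -compA pi compm1.
- have [g gP] := regular k.
  have gk : g \c k = idm K by apply: mk; rewrite compA gP compm1.
  exists X, (idm X - k \c g); split; first by rewrite compBl comp1m gP subrr.
  move=> W h; rewrite compBl comp1m => /eqP; rewrite subr_eq0 => /eqP e.
  exists (g \c h); split; first by rewrite compA.
  by move=> u <-; rewrite compA gk comp1m.
- have [g gP] := regular q.
  have qg : q \c g = idm Q by apply: eq; rewrite gP comp1m.
  exists Y, (idm Y - g \c q); split; first by rewrite compBr compm1 compA gP subrr.
  move=> W h; rewrite compBr compm1 => /eqP; rewrite subr_eq0 => /eqP e.
  exists (h \c g); split; first by rewrite -compA.
  by move=> u <-; rewrite -compA qg compm1.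
Qed.

End AbelianOfRegular.

(** * Split semisimplicity from a finite family of objects with scalar endomorphisms that detects
    zero objects *)

Section SplitSemisimple.
Hypothesis isplit : idem_split.
Hypothesis regular : forall X Y (f : mor X Y), regular_mor f.

(** A mono [m] has a retraction [g] by regularity, and the idempotent [m g] is a scalar, so it is 0
    or 1. *)
Lemma end_base_simple X : end_is_base X -> simple_obj X.
Proof.
move=> bX; split=> [/is_zeroP|Y m mm]; first exact: end_is_base_neq0.
have [g gP] := regular m.
have gm : g \c m = idm Y by apply: mm; rewrite compA gP compm1.
have [a ea] := end_is_base_scalar bX (m \c g).
have aa : a * a = a.
  have := end_is_base_neq0 bX; have : m \c g \c (m \c g) = m \c g by rewrite compA gP.
  rewrite ea compZl compZr comp1m scalerA => /eqP; rewrite -subr_eq0 -scalerBl.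
  by rewrite scaler_eq0 subr_eq0 => /orP[/eqP //|/eqP -> []].
have [a0|a0] := eqVneq a 0.
  left; apply/is_zeroP; rewrite -gm; apply: mm.
  by rewrite compA ea a0 scale0r comp0m compm0.
right; apply: (is_iso_intro (g := g)) => //.
by rewrite ea (_ : a = 1) ?scale1r //; apply: (mulfI a0); rewrite mulr1.
Qed.

Lemma end_base_split_mono X Y (f : mor X Y) :
  end_is_base X -> f <> 0 -> exists g : mor Y X, g \c f = idm X.
Proof.
move=> bX f0; have [g gP] := regular f.
have [a ea] := end_is_base_scalar bX (g \c f).
have a0 : a != 0.
  apply/eqP => a0; case: f0.
  by rewrite -gP -compA ea a0 scale0r compm0.
by exists (a^-1 *: g); rewrite compZl ea scalerA mulVf ?scale1r.
Qed.

Variables (J : finType) (S : J -> C).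
Hypothesis S_base : forall j, end_is_base (S j).
Hypothesis S_gen : forall X, (forall j (f : mor (S j) X), f = 0) -> is_zero X.

Lemma gen_neq0 X : ~ is_zero X -> exists j (f : mor (S j) X), f <> 0.
Proof.
move=> nX; apply: Classical_Prop.NNPP => h; apply: nX; apply: S_gen => j f.
by apply: Classical_Prop.NNPP => f0; apply: h; exists j, f.
Qed.

Lemma gen_simple X : simple_obj X -> exists j, isomorphic X (S j).
Proof.
move=> [nX sX]; have [j [f f0]] := gen_neq0 nX.
have [g gf] := end_base_split_mono (S_base j) f0; exists j.
have mf : is_mono f.
  by move=> W h k e; rewrite -[h]comp1m -[k]comp1m -gf -!compA e.
have [/is_zeroP/(end_is_base_neq0 (S_base j)) []|[i _]] := sX _ _ mf.
by exists; exact: iso_inv.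
Qed.

Lemma gen_finitely_many : finitely_many_simples C.
Proof.
exists #|J|, (fun j => S (enum_val j)) => X /gen_simple[j hj].
by exists (enum_rank j); rewrite enum_rankK.
Qed.

Lemma gen_split X : simple_obj X -> end_is_base X.
Proof.
move=> /gen_simple[j /isomorphic_sym hj]; exact: end_is_base_iso hj (S_base j).
Qed.

(** Termination measure for splitting off summands. The map sending [g] to [i g p] embeds [End X']
    in [End X], and its image misses [e]: every [e] in the image satisfies [i p e = e], whereas here
    [p e = 0]. *)
Lemma retract_dim X X' (i : mor X' X) (p : mor X X') (e : mor X X) :
  p \c i = idm X' -> p \c e = 0 -> e <> 0 ->
  (\dim {:mor X' X'} < \dim {:mor X X})%N.
Proof.
move=> pi pe e0.
pose phi (g : mor X' X') : mor X X := i \c g \c p.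
have phi_lin : linear phi by move=> a g h; rewrite /phi comp_linr comp_linl.
pose phiL : {linear mor X' X' -> mor X X} := HB.pack phi
  (GRing.isLinear.Build _ _ _ _ phi phi_lin).
have ker0 : lker (linfun phiL) = 0%VS.
  apply/eqP; rewrite -subv0; apply/subvP => g; rewrite memv_ker lfunE /= memv0 => /eqP e1.
  have : p \c (i \c g \c p) \c i = 0 by rewrite [i \c g \c p]e1 compm0 comp0m.
  by rewrite !compA pi comp1m -compA pi compm1 => ->.
rewrite -(limg_dim_eq (f := linfun phiL) (U := fullv)) ?ker0 ?capv0 //.
rewrite ltn_neqAle dimvS ?subvf // andbT; apply/eqP => ed.
have /eqP ef : (linfun phiL @: fullv)%VS == {:mor X X}%VS by rewrite eqEdim subvf ed leqnn.
have : e \in (linfun phiL @: fullv)%VS by rewrite ef memvf.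
case/memv_imgP => g _; rewrite lfunE /= => eg; apply: e0.
have : i \c p \c e = e by rewrite eg /phi !compA -(compA i p) pi compm1.
by rewrite -compA pe compm0.
Qed.

Lemma gen_semisimple : semisimple_cat C.
Proof.
(* Induction on the dimension of [End X]: a nonzero map [f] from some [S j] splits, and the
   complement, the image of [1 - f g], has a smaller endomorphism space. *)
suff: forall n X, (\dim {:mor X X} < n)%N -> exists n (S : 'I_n -> C),
    (forall j, simple_obj (S j)) /\ is_dirsum S X.
  by move=> h X; apply: h (ltnSn _).
elim=> // n IHn X dX.
have [X0|nX] := Classical_Prop.classic (is_zero X).
  exists 0%N, (fun=> X); split=> [[]//|]; exists (fun=> 0), (fun=> 0).
  by split=> [[]//|[]//|]; rewrite big_ord0; apply/esym/is_zeroP.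
have [j [f f0]] := gen_neq0 nX.
have [g gf] := end_base_split_mono (S_base j) f0.
have [|X' [i [p [pi ip]]]] := isplit (e := idm X - f \c g).
  by rewrite compBl comp1m compBr compm1 compA -(compA f) gf compm1 subrr subr0.
have pf : p \c f = 0.
  by rewrite -[p]comp1m -pi -(compA p) ip -compA compBl comp1m -compA gf compm1 subrr compm0.
have gi : g \c i = 0.
  by rewrite -[i]compm1 -pi (compA i) ip compA compBr compm1 compA gf comp1m subrr comp0m.
have [|m [T [sT dT]]] := IHn X'.
  rewrite -ltnS; apply: leq_trans dX; rewrite ltnS.
  apply: (retract_dim (i := i) (p := p) (e := f \c g)) => //.
    by rewrite compA pf comp0m.
  by move=> e; apply: f0; rewrite -[f]compm1 -gf compA e comp0m.
have ee : f \c g + i \c p = idm X by rewrite ip addrC subrK.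
exists #|{: option 'I_m}|, (fun k => if enum_val k is Some k' then T k' else S j).
split; last exact: dsum_ord (dsum_option gf pi gi pf ee dT).
move=> k /=; case: (enum_val k) => [k'|]; first exact: sT.
exact: end_base_simple.
Qed.

End SplitSemisimple.
End LinearCategories.

(** * Coherence and duals *)

Section Monoidal.
Variables (F : fieldType) (C : mon_cat F).
Implicit Types X Y Z W : C.

Lemma tmor_exch X X' Y Y' (f : mor X X') (g : mor Y Y') :
  (f \om idm Y') \c (idm X \om g) = (idm X' \om g) \c (f \om idm Y).
Proof. by rewrite -!tmor_comp !comp1m !compm1. Qed.

Definition tmor_iso X Y X' Y' (i : iso X X') (j : iso Y Y') : iso (X \ox Y) (X' \ox Y').
Proof.
exists (ifw i \om ifw j) (ibw i \om ibw j).
  by rewrite -tmor_comp !ifwK tmor1.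
by rewrite -tmor_comp !ibwK tmor1.
Defined.

Lemma iassoc_nat X Y Z X' Y' Z' (f : mor X X') (g : mor Y Y') (h : mor Z Z') :
  ibw (assoc X' Y' Z') \c (f \om (g \om h)) = (f \om g) \om h \c ibw (assoc X Y Z).
Proof.
apply: (@iso_monic _ _ _ _ (assoc X' Y' Z')); apply: (@iso_epic _ _ _ _ (assoc X Y Z)).
by rewrite !compA ibwK comp1m -!compA ifwK compm1 assoc_nat.
Qed.

Lemma unt_tmor_inj X Y (f g : mor X Y) : idm (unt C) \om f = idm (unt C) \om g -> f = g.
Proof. by move=> e; apply: (@iso_epic _ _ _ _ (lunit X)); rewrite -!lunit_nat e. Qed.

(** Kelly's argument: after tensoring with the unit object, the equation follows from the pentagon
    for [1, 1, X, Y] and the triangle, and tensoring with the unit is faithful. *)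
Lemma lunit_ten X Y : lunit (X \ox Y) \c assoc (unt C) X Y = lunit X \om idm Y.
Proof.
apply: unt_tmor_inj.
apply: (@iso_epic _ _ _ _
  (iso_comp (assoc _ _ _) (tmor_iso (assoc (unt C) (unt C) X) (iso_id Y)))) => /=.
rewrite tmor_compr -compA (compA (idm _ \om assoc _ _ _)) -pentagon.
rewrite compA triangle compA -assoc_nat -tmor1 -assoc_nat.
by rewrite -compA -tmor_comp triangle comp1m.
Qed.

End Monoidal.

(* The opposite tensor product turns left duals into right duals. *)
Section Reverse.
Variables (F : fieldType) (C : mon_cat F).
Implicit Types X Y Z W : C.

Lemma iassoc_pentagon X Y Z W :
  ibw (assoc (X \ox Y) Z W) \c ibw (assoc X Y (Z \ox W)) =
  (ibw (assoc X Y Z) \om idm W) \c ibw (assoc X (Y \ox Z) W) \c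
    (idm X \om ibw (assoc Y Z W)).
Proof.
have e := pentagon X Y Z W.
pose l := iso_comp (assoc X Y (Z \ox W)) (assoc (X \ox Y) Z W).
apply: (@iso_epic _ _ _ _ l).
have -> : ibw (assoc (X \ox Y) Z W) \c ibw (assoc X Y (Z \ox W)) = ibw l by [].
rewrite ifwK {l}/= e -!compA (compA (idm X \om _)) -tmor_comp ifwK comp1m tmor1 comp1m.
by rewrite (compA (ibw _)) ifwK comp1m -tmor_comp ifwK comp1m tmor1.
Qed.

Lemma iassoc_triangle X Y :
  (runit X \om idm Y) \c ibw (assoc X (unt C) Y) = idm X \om lunit Y.
Proof. by rewrite -triangle -compA ibwK compm1. Qed.

Definition rev_mon : mon_cat F := {|
  mon_lin := C;
  unt := unt C;
  tob := fun X Y : C => Y \ox X;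
  tmor := fun X Y X' Y' f g => g \om f;
  tmor1 := fun X Y => tmor1 Y X;
  tmor_comp := fun X Y X' Y' X'' Y'' f' g' f g => tmor_comp g' f' g f;
  tmor_linl := fun X Y X' Y' a f f' g => tmor_linr a g f f';
  tmor_linr := fun X Y X' Y' a f g g' => tmor_linl a g g' f;
  assoc := fun X Y Z => iso_inv (assoc Z Y X);
  assoc_nat := fun X Y Z X' Y' Z' f g h => iassoc_nat h g f;
  lunit := @runit F C;
  lunit_nat := @runit_nat F C;
  runit := @lunit F C;
  runit_nat := @lunit_nat F C;
  pentagon := fun X Y Z W => iassoc_pentagon W Z Y X;
  triangle := fun X Y => iassoc_triangle Y X |}.

Lemma runit_ten X Y :
  runit (X \ox Y) = (idm X \om runit Y) \c assoc X Y (unt C) :> mor _ _.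
Proof.
have /= := @lunit_ten F rev_mon Y X => <-.
by rewrite -compA ifwK compm1.
Qed.

Lemma tmor_unt_inj X Y (f g : mor X Y) : f \om idm (unt C) = g \om idm (unt C) -> f = g.
Proof. exact: (@unt_tmor_inj F rev_mon). Qed.

(** Tensored with the unit, the two sides are compared by [lunit_ten] and the triangle. What remains
    is that [lunit] at [1 \ox 1] equals [idm 1 \om lunit 1], which is naturality of [lunit] at
    [lunit 1]. *)
Lemma lunit_runit_unt : lunit (unt C) = runit (unt C) :> mor _ _.
Proof.
apply: tmor_unt_inj; rewrite -lunit_ten -triangle; congr (_ \c _).
apply: (@iso_monic _ _ _ _ (lunit (unt C))).
exact/esym/lunit_nat.
Qed.

End Reverse.

(** * The adjunction given by a dual pair *)

Section Duals.
Variables (F : fieldType) (C : mon_cat F).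
Implicit Types X Y Z W : C.
Variables (Xd X : C) (ev : mor (Xd \ox X) (unt C)) (coev : mor (unt C) (X \ox Xd)).
Hypothesis zig1 : runit X \c (idm X \om ev) \c assoc X Xd X \c (coev \om idm X) = lunit X.
Hypothesis zig2 : lunit Xd \c (ev \om idm Xd) \c ibw (assoc Xd X Xd) \c
  (idm Xd \om coev) = runit Xd.

(** Half of the bijection between [Hom(Z, Xd)] and [Hom(Z \ox X, 1)]: [key] recovers a map from its
    pairing with [ev], by inserting [coev] and using the second zigzag. *)
Lemma ev_inj Z (h h' : mor Z Xd) : ev \c (h \om idm X) = ev \c (h' \om idm X) -> h = h'.
Proof.
have key (g : mor Z Xd) : g \c runit Z =
    lunit Xd \c ((ev \c (g \om idm X)) \om idm Xd) \c ibw (assoc Z X Xd) \c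
    (idm Z \om coev).
  rewrite tmor_compl -2!(compA (lunit Xd)) -(compA (ev \om _)) -iassoc_nat tmor1.
  by rewrite -!compA tmor_exch !compA zig2 runit_nat.
by move=> e; apply: (@iso_epic _ _ _ _ (runit Z)); rewrite !key e.
Qed.

Lemma ev_surj Z (k : mor (Z \ox X) (unt C)) : exists h : mor Z Xd, ev \c (h \om idm X) = k.
Proof.
(* The mate of [k]: create [X \ox Xd] by [coev], then consume [Z \ox X] by [k]. The first zigzag
   shows that pairing it with [ev] returns [k]. *)
exists (lunit Xd \c (k \om idm Xd) \c ibw (assoc Z X Xd) \c (idm Z \om coev) \c
   ibw (runit Z)).
rewrite !tmor_compl -lunit_ten.
have e1 : ev \c lunit (Xd \ox X) = lunit (unt C) \c (idm _ \om ev) by rewrite lunit_nat.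
have e2 : runit (unt C) \c ((idm (unt C) \om ev) \c
    (assoc (unt C) Xd X \c ((k \om idm Xd) \om idm X))) =
    k \c (idm Z \om runit X) \c (idm Z \om (idm X \om ev)) \c
      (assoc Z X (Xd \ox X) \c assoc (Z \ox X) Xd X).
  rewrite assoc_nat tmor1 (compA (idm (unt C) \om ev)) -tmor_exch.
  rewrite !compA runit_nat runit_ten -!compA -[idm (Z \ox X)]tmor1.
  by rewrite (compA (assoc Z X (unt C))) assoc_nat -!compA.
rewrite !compA e1 lunit_runit_unt -!compA (compA (assoc (unt C) _ _)).
rewrite (compA (idm (unt C) \om ev)) (compA (runit _)) e2 pentagon.
rewrite -!compA (compA (assoc Z X Xd \om _)) -tmor_compl ibwK tmor1 comp1m.
rewrite (compA (assoc _ _ _)) assoc_nat -!compA.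
rewrite (compA (idm Z \om assoc _ _ _)) -tmor_compr.
rewrite (compA (idm Z \om (idm X \om _))) -tmor_compr.
rewrite (compA (idm Z \om runit X)) -tmor_compr !compA zig1.
by rewrite -(compA k) triangle -compA -tmor_compl ibwK tmor1 compm1.
Qed.

(** The same injectivity with a coefficient object [Y]. For [Z] the unit and [Y = X] it says that
    [ev] determines [coev]. *)
Lemma ev_inj_ten Y Z (c c' : mor Z (Y \ox Xd)) :
  (idm Y \om ev) \c assoc Y Xd X \c (c \om idm X) =
  (idm Y \om ev) \c assoc Y Xd X \c (c' \om idm X) -> c = c'.
Proof.
have key (g : mor Z (Y \ox Xd)) : g \c runit Z =
    (runit Y \om idm Xd) \c
    (((idm Y \om ev) \c assoc Y Xd X \c (g \om idm X)) \om idm Xd) \c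
    ibw (assoc Z X Xd) \c (idm Z \om coev).
  rewrite tmor_compl -2!(compA (runit Y \om idm Xd)) -(compA (_ \om idm Xd)) -iassoc_nat tmor1.
  rewrite -!compA tmor_exch tmor_compl -!compA (compA (assoc _ _ _ \om _)).
  (* The pentagon for [Y, Xd, X, Xd], with associators moved across the equation. *)
  have -> : (assoc Y Xd X \om idm Xd) \c ibw (assoc (Y \ox Xd) X Xd) =
      ibw (assoc Y (Xd \ox X) Xd) \c (idm Y \om ibw (assoc Xd X Xd)) \c
        assoc Y Xd (X \ox Xd).
    apply: (@iso_epic _ _ _ _ (assoc (Y \ox Xd) X Xd)).
    rewrite -!compA ifwK compm1 pentagon !compA -(compA (ibw _)).
    by rewrite -tmor_compr ifwK tmor1 compm1 ifwK comp1m.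
  rewrite -!compA (compA (assoc Y Xd (X \ox Xd))) -tmor1 assoc_nat.
  rewrite -!compA (compA (_ \om idm Xd) (ibw _)) -iassoc_nat -!compA.
  rewrite (compA (runit Y \om _)) iassoc_triangle.
  rewrite (compA (idm Y \om (idm Xd \om _))) -!compA.
  rewrite (compA (idm Y \om ibw _)) -tmor_compr.
  rewrite (compA (idm Y \om (ev \om _))) -tmor_compr.
  rewrite (compA (idm Y \om lunit Xd)) -tmor_compr !compA zig2.
  by rewrite -runit_ten runit_nat.
by move=> e; apply: (@iso_epic _ _ _ _ (runit Z)); rewrite !key e.
Qed.

End Duals.

(** * Equivalences and monoidal inverses *)

Section Equivalences.
Variable F : fieldType.

Lemma fmor_tmor (A B : mon_cat F) (T : mon_functor A B) (X Y X' Y' : A)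
    (f : mor X X') (g : mor Y Y') :
  fmor T (f \om g) = mf_ten T X' Y' \c (fmor T f \om fmor T g) \c ibw (mf_ten T X Y).
Proof. by rewrite mf_ten_nat -compA ibwK compm1. Qed.

Section FullyFaithful.
Variables (A B : lin_cat F) (T : lin_functor A B).

Definition fully_faithful : Prop :=
  (forall X Y, injective (@fmor F A B T X Y)) /\
  (forall X Y (h : mor (T X) (T Y)), exists f : mor X Y, fmor T f = h).

Definition ess_surjective : Prop := forall Y : B, exists X : A, isomorphic (T X) Y.

Lemma natural_iso_inj (S : lin_functor B A) (eta : forall X, iso (S (T X)) X) :
  @natural F A A (comp_functor S T) (id_functor A) eta ->
  forall X Y, injective (@fmor F A B T X Y).
Proof.
move=> nat_eta X Y f g e; apply: (@iso_epic _ _ _ _ (eta X)).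
by have /= <- := nat_eta _ _ f; have /= <- := nat_eta _ _ g; rewrite e.
Qed.

End FullyFaithful.

Lemma equivalence_fully_faithful (A B : lin_cat F) (T : lin_functor A B) :
  is_equivalence T -> fully_faithful T.
Proof.
case=> S [[eta nat_eta] [eps nat_eps]]; split; first exact: natural_iso_inj nat_eta.
have S_inj := natural_iso_inj nat_eps.
move=> X Y h; exists (eta Y \c fmor S h \c ibw (eta X)); apply: S_inj.
apply: (@iso_monic _ _ _ _ (eta Y)); have /= -> := nat_eta _ _ (eta Y \c fmor S h \c ibw (eta X)).
by rewrite -!compA ifwK compm1.
Qed.

Lemma equivalence_ess_surjective (A B : lin_cat F) (T : lin_functor A B) :
  is_equivalence T -> ess_surjective T.
Proof. by case=> S [_ [eps _]] Y; exists (S Y); exists; exact: (eps Y). Qed.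

Section Lift.
Variables (A B : lin_cat F) (T : lin_functor A B).
Hypothesis ffT : fully_faithful T.

Lemma fflift_subproof (X Y : A) (h : mor (T X) (T Y)) : {f : mor X Y | fmor T f = h}.
Proof. exact: constructive_indefinite_description (proj2 ffT X Y h). Qed.

Definition fflift (X Y : A) (h : mor (T X) (T Y)) : mor X Y := sval (fflift_subproof h).

Lemma ffliftK (X Y : A) (h : mor (T X) (T Y)) : fmor T (fflift h) = h.
Proof. exact: svalP (fflift_subproof h). Qed.

Lemma fflift_iso_subproof (X Y : A) (g : mor (T Y) (T X)) (f : mor (T X) (T Y)) :
  g \c f = idm (T X) -> fflift g \c fflift f = idm X.
Proof. by move=> gf; apply: (proj1 ffT); rewrite fmor_comp !ffliftK fmor1. Qed.

Definition fflift_iso (X Y : A) (i : iso (T X) (T Y)) : iso X Y :=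
  Iso (fflift_iso_subproof (ifwK i)) (fflift_iso_subproof (ibwK i)).

Hypothesis esT : ess_surjective T.

Lemma inv_ob_subproof (Y : B) : {X : A | isomorphic (T X) Y}.
Proof. exact: constructive_indefinite_description (esT Y). Qed.

Definition inv_ob (Y : B) : A := sval (inv_ob_subproof Y).

Definition inv_iso (Y : B) : iso (T (inv_ob Y)) Y :=
  epsilon (svalP (inv_ob_subproof Y)) (fun=> True).

Definition inv_mor (Y Y' : B) (f : mor Y Y') : mor (inv_ob Y) (inv_ob Y') :=
  fflift (ibw (inv_iso Y') \c f \c inv_iso Y).

Lemma inv_mor1 Y : inv_mor (idm Y) = idm (inv_ob Y).
Proof. by apply: (proj1 ffT); rewrite ffliftK compm1 ifwK fmor1. Qed.

Lemma inv_mor_comp (X Y Z : B) (g : mor Y Z) (f : mor X Y) :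
  inv_mor (g \c f) = inv_mor g \c inv_mor f.
Proof.
apply: (proj1 ffT); rewrite fmor_comp !ffliftK.
by rewrite -!compA (compA (ifw _)) ibwK comp1m.
Qed.

Lemma inv_mor_lin (X Y : B) (a : F) (f f' : mor X Y) :
  inv_mor (a *: f + f') = a *: inv_mor f + inv_mor f'.
Proof. by apply: (proj1 ffT); rewrite fmor_lin !ffliftK comp_linr comp_linl. Qed.

Definition inv_functor : lin_functor B A := LinFunctor inv_mor1 inv_mor_comp inv_mor_lin.

Lemma inv_iso_nat (Y Y' : B) (f : mor Y Y') :
  inv_iso Y' \c fmor T (inv_mor f) = f \c inv_iso Y.
Proof. by rewrite ffliftK !compA ibwK comp1m. Qed.

Definition inv_counit (X : A) : iso (inv_ob (T X)) X := fflift_iso (inv_iso (T X)).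

Lemma inv_counit_nat (X Y : A) (f : mor X Y) :
  inv_counit Y \c inv_mor (fmor T f) = f \c inv_counit X.
Proof. by apply: (proj1 ffT); rewrite !fmor_comp !ffliftK !compA ibwK comp1m. Qed.

Lemma inv_functor_equivalence : is_equivalence inv_functor.
Proof.
exists T; split; first by exists inv_iso; exact: inv_iso_nat.
by exists inv_counit; exact: inv_counit_nat.
Qed.

Lemma ff_es_equivalence : is_equivalence T.
Proof.
exists inv_functor; split; first by exists inv_counit; exact: inv_counit_nat.
by exists inv_iso; exact: inv_iso_nat.
Qed.

End Lift.

Section MonoidalInverse.
Variables (A B : mon_cat F) (T : mon_functor A B).
Hypotheses (ffT : fully_faithful T) (esT : ess_surjective T).
Local Notation S := (inv_functor ffT esT).
Definition inv_unit (Y : B) : iso (T (S Y)) Y := inv_iso esT Y.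
Local Notation d := inv_unit.

(** The constraint that makes [inv_unit] a monoidal transformation ([T_inv_ten]), lifted along the
    fully faithful [T]. Each coherence law of the inverse is checked after applying [T], where it
    reduces to the law in [B]. *)
Definition inv_ten (X Y : B) : iso (S X \ox S Y) (S (X \ox Y)) :=
  fflift_iso ffT (iso_comp (iso_inv (d (X \ox Y)))
    (iso_comp (tmor_iso (d X) (d Y)) (iso_inv (mf_ten T (S X) (S Y))))).

Definition inv_unt : iso (unt A) (S (unt B)) :=
  fflift_iso ffT (iso_comp (iso_inv (d (unt B))) (iso_inv (mf_unt T))).

Lemma T_inv_ten X Y : d (X \ox Y) \c fmor T (inv_ten X Y) \c mf_ten T (S X) (S Y) =
  d X \om d Y.
Proof. by rewrite ffliftK /= !compA ibwK comp1m -compA ifwK compm1. Qed.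

Lemma T_inv_tenR X Y :
  d (X \ox Y) \c (fmor T (inv_ten X Y) \c mf_ten T (S X) (S Y)) = d X \om d Y.
Proof. by rewrite compA T_inv_ten. Qed.

Lemma T_inv_unt : d (unt B) \c (fmor T inv_unt \c mf_unt T) = idm (unt B).
Proof. by rewrite ffliftK /= !compA ibwK comp1m ifwK. Qed.

Lemma T_inv_tenA X Y W (w : mor W _) :
  d (X \ox Y) \c (fmor T (inv_ten X Y) \c (mf_ten T (S X) (S Y) \c w)) = (d X \om d Y) \c w.
Proof. by rewrite !compA T_inv_ten. Qed.

Lemma T_inv_nat (Y Y' : B) (f : mor Y Y') :
  d Y' \c fmor T (fmor S f) = f \c d Y.
Proof. exact: inv_iso_nat. Qed.

Lemma T_inv_natA (Y Y' : B) (f : mor Y Y') W (w : mor W _) :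
  d Y' \c (fmor T (fmor S f) \c w) = f \c (d Y \c w).
Proof. by rewrite compA T_inv_nat compA. Qed.

Lemma inv_ten_nat (X Y X' Y' : B) (f : mor X X') (g : mor Y Y') :
  inv_ten X' Y' \c (fmor S f \om fmor S g) = fmor S (f \om g) \c inv_ten X Y.
Proof.
apply: (proj1 ffT); rewrite !fmor_comp.
apply: (@iso_monic _ _ _ _ (d _)); apply: (@iso_epic _ _ _ _ (mf_ten T _ _)).
rewrite -!compA -mf_ten_nat T_inv_tenA T_inv_natA T_inv_tenR.
by rewrite -!tmor_comp !T_inv_nat.
Qed.

Lemma inv_assoc (X Y Z : B) :
  fmor S (assoc X Y Z) \c inv_ten (X \ox Y) Z \c (inv_ten X Y \om idm (S Z)) =
  inv_ten X (Y \ox Z) \c (idm (S X) \om inv_ten Y Z) \c assoc (S X) (S Y) (S Z).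
Proof.
apply: (proj1 ffT); rewrite !fmor_comp.
apply: (@iso_monic _ _ _ _ (d _)).
apply: (@iso_epic _ _ _ _ (iso_comp (mf_ten T _ _) (tmor_iso (mf_ten T _ _) (iso_id _)))).
rewrite /= -!compA T_inv_natA (compA (fmor T (_ \om idm _))) -mf_ten_natl -!compA T_inv_tenA.
rewrite -!tmor_comp !compm1 T_inv_tenR assoc_nat.
rewrite (compA (fmor T (assoc _ _ _))) mf_assoc -!compA.
rewrite (compA (fmor T (idm _ \om _))) -mf_ten_natr -!compA T_inv_tenA.
by rewrite (compA (idm _ \om _)) -!tmor_comp comp1m (compA (_ \om _)) -!tmor_comp compm1
  T_inv_tenR.
Qed.

Lemma inv_lunit (X : B) :
  fmor S (lunit X) \c inv_ten (unt B) X \c (inv_unt \om idm (S X)) = lunit (S X).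
Proof.
apply: (proj1 ffT); rewrite !fmor_comp; apply: (@iso_monic _ _ _ _ (d _)).
apply: (@iso_epic _ _ _ _ (iso_comp (mf_ten T _ _) (tmor_iso (mf_unt T) (iso_id _)))).
rewrite /= -!compA T_inv_natA (compA (fmor T (_ \om idm _))) -mf_ten_natl -!compA T_inv_tenA.
rewrite -!tmor_comp !compm1 T_inv_unt (compA (fmor T _)) mf_lunit.
by rewrite -lunit_nat.
Qed.

Lemma inv_runit (X : B) :
  fmor S (runit X) \c inv_ten X (unt B) \c (idm (S X) \om inv_unt) = runit (S X).
Proof.
apply: (proj1 ffT); rewrite !fmor_comp; apply: (@iso_monic _ _ _ _ (d _)).
apply: (@iso_epic _ _ _ _ (iso_comp (mf_ten T _ _) (tmor_iso (iso_id _) (mf_unt T)))).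
rewrite /= -!compA T_inv_natA (compA (fmor T (idm _ \om _))) -mf_ten_natr -!compA T_inv_tenA.
rewrite -!tmor_comp !compm1 T_inv_unt (compA (fmor T _)) mf_runit.
by rewrite -runit_nat.
Qed.

Definition inv_mon_functor : mon_functor B A :=
  @MonFunctor F B A S inv_ten inv_ten_nat inv_unt inv_assoc inv_lunit inv_runit.

Lemma T_inv_counit (X : A) : fmor T (inv_counit ffT esT X) = d (T X).
Proof. exact: ffliftK. Qed.

Lemma inv_counit_ten (X Y : A) :
  inv_counit ffT esT (X \ox Y) \c (fmor S (mf_ten T X Y) \c inv_ten (T X) (T Y)) =
  inv_counit ffT esT X \om inv_counit ffT esT Y.
Proof.
apply: (proj1 ffT); rewrite !fmor_comp fmor_tmor !T_inv_counit.
apply: (@iso_epic _ _ _ _ (mf_ten T _ _)).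
rewrite -!compA T_inv_natA T_inv_tenR /=.
by rewrite (_ : ibw _ \c mf_ten T _ _ = idm _) ?compm1 // ifwK.
Qed.

Lemma inv_counit_unt :
  inv_counit ffT esT (unt A) \c (fmor S (mf_unt T) \c inv_unt) = idm (unt A).
Proof.
apply: (proj1 ffT); rewrite !fmor_comp T_inv_counit fmor1.
apply: (@iso_epic _ _ _ _ (mf_unt T)).
by rewrite -!compA T_inv_natA T_inv_unt compm1 comp1m.
Qed.

End MonoidalInverse.
End Equivalences.

(** * Galois descent for vector spaces *)

(** Restriction of scalars. The alias gives the K-structure a carrier of its own, apart from the
    L-structure on [V]. *)
Definition restr (K : fieldType) (L : fieldExtType K) (V : Type) : Type := V.

Section Restriction.
Variables (K : fieldType) (L : fieldExtType K).

Section Space.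
Variable V : vectType L.
Local Notation W := (restr L V).

HB.instance Definition _ := GRing.Zmodule.on W.

Definition restr_scale (a : K) (v : W) : W := a%:A *: (v : V).

Lemma restr_scaleA a b v : restr_scale a (restr_scale b v) = restr_scale (a * b) v.
Proof. by rewrite /restr_scale scalerA -scalerAl mul1r scalerA. Qed.

Lemma restr_scale1 : left_id 1 restr_scale.
Proof. by move=> v; rewrite /restr_scale !scale1r. Qed.

Lemma restr_scaleDr : right_distributive restr_scale +%R.
Proof. by move=> a u v; rewrite /restr_scale scalerDr. Qed.

Lemma restr_scaleDl v : {morph restr_scale^~ v : a b / a + b}.
Proof. by move=> a b; rewrite /restr_scale !scalerDl. Qed.

HB.instance Definition _ := GRing.Zmodule_isLmodule.Build K W
  restr_scaleA restr_scale1 restr_scaleDr restr_scaleDl.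

Lemma restrZ (a : K) (v : W) : a *: v = a%:A *: (v : V) :> V.
Proof. by []. Qed.

Lemma restr_vect : Vector.axiom (\dim {:V} * \dim {:L}) W.
Proof.
exists (fun v : W => mxvec (\matrix_(i, j) bcoord (bcoord (v : V) 0 i) 0 j)).
  move=> a u v; rewrite -linearP; congr mxvec; apply/matrixP => i j.
  have e : bcoord (a *: u + v : V) 0 i = a *: bcoord (u : V) 0 i + bcoord (v : V) 0 i.
    by rewrite [a *: u]/(a%:A *: (u : V)) linearP !mxE mulr_algl.
  by rewrite [LHS]mxE e linearP !mxE.
have [g gK Kg] := bcoord_bij V; have [h hK Kh] := bcoord_bij L.
exists (fun x : 'rV[K]_(\dim {:V} * \dim {:L}) => g (\row_i h (row i (vec_mx x)))) => x.
  rewrite -[RHS]gK; congr g; apply/rowP => i; rewrite !mxE -[RHS]hK; congr h.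
  by apply/rowP => j; rewrite mxvecK !mxE.
rewrite -[RHS]vec_mxK; congr mxvec; apply/matrixP => i j.
by rewrite mxE Kg [X in bcoord X]mxE Kh mxE.
Qed.

HB.instance Definition _ := Lmodule_hasFinDim.Build K W restr_vect.

End Space.
End Restriction.

Section GaloisDescent.
Variables (K : fieldType) (L : splittingFieldType K).
Hypothesis galLK : galois 1%AS {:L}%AS.
Local Notation Gal := (gal_of {:L}).

Lemma gal_fixed_scalar (x : L) : (forall s : Gal, s x = x) -> exists k : K, x = k%:A.
Proof.
move=> fx; have /galois_fixedField e := galLK.
have : x \in fixedField 'Gal({:L} / 1)%g by apply/fixedFieldP; rewrite ?memvf.
by rewrite e => /vlineP.
Qed.

(* Inverting the Galois matrix recovers a vector from its traces. *)
Lemma gal_dual_basis : exists n (c w : 'I_n -> L),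
  forall s : Gal, \sum_j c j * s (w j) = (s == 1%g)%:R.
Proof.
have [w _ [uM _ _]] := gal_matrix [set: Gal].
set M := \matrix_(i, j) _ in uM.
have s_in (s : Gal) : s \in [set: Gal] by rewrite inE.
pose r (s : Gal) := enum_rank_in (s_in s) s.
exists #|[set: Gal]|, (fun j => invmx M j (r 1%g)), (fun j => tnth w j) => s.
have /matrixP/(_ (r s) (r 1%g)) := mulmxV uM; rewrite !mxE => e.
have -> : (s == 1%g) = (r s == r 1%g).
  apply/eqP/eqP => [->//|/(congr1 enum_val)].
  by rewrite !enum_rankK_in.
rewrite -e; apply: eq_bigr => j _; rewrite mxE enum_rankK_in ?inE //.
exact: mulrC.
Qed.

(** If all traces of the [w j] vanished, summing the relation of [gal_dual_basis] over [s] would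
    give [1 = 0]. *)
Lemma gal_trace_one : exists a : L, \sum_(s : Gal) s a = 1.
Proof.
have [n [c [w cw]]] := gal_dual_basis.
have [j tj] : exists j, \sum_(s : Gal) s (w j) != 0.
  apply/existsP; apply: contraT => /existsPn h.
  have : \sum_(s : Gal) \sum_j c j * s (w j) = 0.
    rewrite exchange_big big1 // => j _; rewrite -mulr_sumr.
    by have := h j; rewrite negbK => /eqP ->; rewrite mulr0.
  rewrite (bigD1 1%g) //= [X in _ + X]big1 => [|s /negPf s1]; rewrite cw ?s1 //.
  by rewrite eqxx addr0 => /eqP; rewrite oner_eq0.
have [s|k ek] := @gal_fixed_scalar (\sum_(s : Gal) s (w j)).
  rewrite rmorph_sum [RHS](reindex_inj (@mulIg _ s)).
  by apply: eq_bigr => t _; rewrite galM ?memvf.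
(* The trace of [w j] is Galois invariant, hence a nonzero scalar [k] of the base field, and can be
   divided out. *)
exists (k^-1 *: w j).
under eq_bigr do rewrite linearZ /=.
rewrite -scaler_sumr ek scalerA mulVf ?scale1r //.
by apply: contraNneq tj => k0; rewrite ek k0 scale0r.
Qed.

Section Space.
Variables (V : vectType L) (act : Gal -> V -> V).
Hypothesis act_lin : forall s a u v, act s (a *: u + v) = s a *: act s u + act s v.
Hypothesis act1 : forall v, act 1%g v = v.
Hypothesis actM : forall s t v, act (gcomp s t) v = act s (act t v).

Lemma act0 s : act s 0 = 0.
Proof.
by have := act_lin s (-1) 0 0; rewrite rmorphN1 !scaleN1r oppr0 addr0 addNr.
Qed.

Lemma actD s u v : act s (u + v) = act s u + act s v.
Proof. by rewrite -[u]scale1r act_lin rmorph1 !scale1r. Qed.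

Lemma actZ s a v : act s (a *: v) = s a *: act s v.
Proof. by rewrite -[a *: v]addr0 act_lin act0 addr0. Qed.

Lemma act_sum (J : finType) s (v : J -> V) : act s (\sum_j v j) = \sum_j act s (v j).
Proof. exact: (big_morph (act s) (actD s) (act0 s)). Qed.

Definition act_defect s (v : restr L V) : restr L V := act s v - v.

Lemma act_defect_linear s : linear (act_defect s).
Proof.
move=> a u v; rewrite /act_defect (restrZ a u) act_lin rmorph_alg.
by rewrite opprD addrACA scalerBr.
Qed.

HB.instance Definition _ s :=
  GRing.isLinear.Build K (restr L V) (restr L V) _ (act_defect s) (act_defect_linear s).

Definition fixed_space : {vspace restr L V} :=
  (\bigcap_(s : Gal) lker (linfun (act_defect s)))%VS.

Lemma fixed_spaceP (v : V) : reflect (forall s, act s v = v) (v \in fixed_space).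
Proof.
apply: (iffP subv_bigcapP) => h s; last first.
  by move=> _; rewrite -memvE memv_ker lfunE /= /act_defect h subrr.
by have := h s isT; rewrite -memvE memv_ker lfunE /= subr_eq0 => /eqP.
Qed.

Definition act_trace v := \sum_s act s v.

Lemma act_trace_fixed v : act_trace v \in fixed_space.
Proof.
apply/fixed_spaceP => s; rewrite act_sum [RHS](reindex_inj (@mulIg _ s)).
by apply: eq_bigr => t _; rewrite -actM.
Qed.

(** Exchanging the sums leaves only the term [s = 1], by the dual basis relation. The second formula
    is the same statement for the Galois action on L itself, with the same [c] and [w]. *)
Lemma act_trace_basis : exists n (c w : 'I_n -> L),
  (forall v : V, v = \sum_j c j *: act_trace (w j *: v)) /\
  (forall x, x = \sum_j c j * \sum_(s : Gal) s (w j * x)).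
Proof.
have [n [c [w cw]]] := gal_dual_basis; exists n, c, w; split=> [v|x].
  under eq_bigr do rewrite scaler_sumr.
  rewrite exchange_big (bigD1 1%g) //= [X in _ + X]big1 ?addr0 => [|s /negPf s1].
    under eq_bigr do rewrite actZ scalerA.
    by rewrite -scaler_suml cw eqxx scale1r act1.
  under eq_bigr do rewrite actZ scalerA.
  by rewrite -scaler_suml cw s1 scale0r.
under eq_bigr do rewrite mulr_sumr.
rewrite exchange_big (bigD1 1%g) //= [X in _ + X]big1 ?addr0 => [|s /negPf s1].
  under eq_bigr do rewrite rmorphM mulrA.
  by rewrite -mulr_suml cw eqxx mul1r; exact/esym/gal_id.
under eq_bigr do rewrite rmorphM mulrA.
by rewrite -mulr_suml cw s1 mul0r.
Qed.

Definition fixed_vect : vectType K := subvs_of fixed_space.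

Definition fixed_ext (x : ext_space L fixed_vect) : V :=
  \sum_i x 0 i *: (vsval (bvec fixed_vect i) : V).

Lemma fixed_ext_lin a x y : fixed_ext (a *: x + y) = a *: fixed_ext x + fixed_ext y.
Proof.
rewrite /fixed_ext scaler_sumr -big_split; apply: eq_bigr => i _ /=.
by rewrite !mxE scalerDl scalerA.
Qed.

Lemma fixed_ext_in (v : fixed_vect) : fixed_ext (ext_in L v) = vsval v.
Proof.
rewrite -[in RHS](bcoordK v) linear_sum; apply: eq_bigr => i _ /=.
by rewrite !mxE.
Qed.

Lemma fixed_ext0 : fixed_ext 0 = 0.
Proof. by rewrite -(@ext_in0 K L) fixed_ext_in. Qed.

(** Suppose the [x_i] give an L-linear relation between basis vectors of the invariants. Multiplying
    by [b] and taking the trace gives a K-linear relation with coefficients [Tr (b x_i)]; these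
    vanish for every [b], and [x_i] is recovered from such traces. *)
Lemma fixed_ext_inj : injective fixed_ext.
Proof.
suff ker x : fixed_ext x = 0 -> x = 0.
  move=> x y e; apply/eqP; rewrite -subr_eq0; apply/eqP/ker.
  by rewrite addrC -scaleN1r fixed_ext_lin e scaleN1r addNr.
move=> ex; have [n [c [w [_ xE]]]] := act_trace_basis.
suff tr0 b i : \sum_(s : Gal) s (b * x 0 i) = 0.
  apply/rowP => i; rewrite (xE (x 0 i)) mxE big1 // => j _.
  by rewrite tr0 mulr0.
have h j : {k : K | \sum_(s : Gal) s (b * x 0 j) = k%:A}.
  apply: constructive_indefinite_description.
  apply: gal_fixed_scalar => s; rewrite rmorph_sum [RHS](reindex_inj (@mulIg _ s)).
  by apply: eq_bigr => t _; rewrite galM ?memvf.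
pose k i := sval (h i).
have kE j : \sum_(s : Gal) s (b * x 0 j) = (k j)%:A by exact: svalP (h j).
have e0 : \sum_j k j *: bvec fixed_vect j = 0.
  apply: val_inj; rewrite /= linear_sum /=.
  transitivity (act_trace (b *: fixed_ext x)); last first.
    by rewrite ex scaler0 /act_trace big1 // => s _; rewrite act0.
  rewrite /act_trace scaler_sumr; under [RHS]eq_bigr do rewrite act_sum.
  rewrite exchange_big; apply: eq_bigr => j _ /=.
  rewrite linearZ /= restrZ -kE scaler_suml; apply: eq_bigr => s _.
  have /fixed_spaceP/(_ s) e := subvsP (bvec fixed_vect j).
  by rewrite scalerA actZ e [b * _]mulrC.
rewrite kE; have := bcoord_sum k; rewrite e0 linear0 => /rowP/(_ i).
by rewrite !mxE => <-; rewrite scale0r.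
Qed.

Lemma fixed_ext_surj v : exists x, fixed_ext x = v.
Proof.
have [n [c [w [vE _]]]] := act_trace_basis.
have fix_sum (J : seq 'I_n) (u : 'I_n -> fixed_vect) :
    fixed_ext (\sum_(j <- J) c j *: ext_in L (u j)) = \sum_(j <- J) c j *: vsval (u j).
  elim: J => [|j J IHJ]; first by rewrite !big_nil fixed_ext0.
  by rewrite !big_cons fixed_ext_lin IHJ fixed_ext_in.
exists (\sum_j c j *: ext_in L (Subvs (act_trace_fixed (w j *: v)))).
by rewrite fix_sum [RHS]vE.
Qed.

Lemma fixed_neq0 (v : V) : v <> 0 -> exists u : fixed_vect, u <> 0.
Proof.
move=> v0; have [n [c [w [vE _]]]] := act_trace_basis.
apply: Classical_Prop.NNPP => h; apply: v0; rewrite (vE v) big1 // => j _.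
have -> : act_trace (w j *: v) = vsval (Subvs (act_trace_fixed (w j *: v))) by [].
rewrite (_ : Subvs _ = 0) ?scaler0 //.
by apply: Classical_Prop.NNPP => u0; apply: h; exists (Subvs (act_trace_fixed (w j *: v))).
Qed.

End Space.
End GaloisDescent.

(** * Galois descent for monoidal categories *)

Section DescentDatum.
Variables (K : fieldType) (L : splittingFieldType K).
Local Notation Gal := (gal_of {:L}).

(* The action fixes the objects: between equivariant objects [(X, u)] and
   [(Y, v)] it sends [f] to [v_s o F_s(f) o u_s^-1] (see [eact]). *)
Record descent (D : mon_cat L) := Descent {
  sact : forall X Y : D, Gal -> mor X Y -> mor X Y;
  sact_lin : forall X Y s a (f g : mor X Y),
    sact s (a *: f + g) = s a *: sact s f + sact s g;
  sact1 : forall X Y (f : mor X Y), sact 1%g f = f;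
  sactM : forall X Y s t (f : mor X Y), sact (gcomp s t) f = sact s (sact t f);
  sact_id : forall s X, sact s (idm X) = idm X;
  sact_comp : forall s X Y Z (g : mor Y Z) (f : mor X Y),
    sact s (g \c f) = sact s g \c sact s f;
  sact_tmor : forall s X Y X' Y' (f : mor X X') (g : mor Y Y'),
    sact s (f \om g) = sact s f \om sact s g;
  sact_assoc : forall s X Y Z, sact s (assoc X Y Z) = assoc X Y Z;
  sact_lunit : forall s X, sact s (lunit X) = lunit X;
  sact_runit : forall s X, sact s (runit X) = runit X }.

Variables (D : mon_cat L) (A : descent D).
Implicit Types X Y Z W : D.

Lemma sactZ s X Y a (f : mor X Y) : sact A s (a *: f) = s a *: sact A s f.
Proof. exact: (actZ (@sact_lin D A X Y)). Qed.

Definition invariant X Y (f : mor X Y) : Prop := forall s, sact A s f = f.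

Lemma invariant_inv X Y (i : iso X Y) : invariant i -> invariant (ibw i).
Proof.
move=> fi s; apply: (@iso_epic _ _ _ _ i).
by rewrite -{1}(fi s) -sact_comp !ifwK sact_id.
Qed.

Lemma invariant_id X : invariant (idm X).
Proof. by move=> s; exact: sact_id. Qed.

Lemma invariant_comp X Y Z (g : mor Y Z) (f : mor X Y) :
  invariant g -> invariant f -> invariant (g \c f).
Proof. by move=> hg hf s; rewrite sact_comp hg hf. Qed.

Lemma invariant_tmor X Y X' Y' (f : mor X X') (g : mor Y Y') :
  invariant f -> invariant g -> invariant (f \om g).
Proof. by move=> hf hg s; rewrite sact_tmor hf hg. Qed.

Definition fhom_space X Y : {vspace restr L (mor X Y)} :=
  fixed_space (@sact D A X Y).

Definition fhom X Y : vectType K := fixed_vect (@sact D A X Y).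

Lemma fhomP X Y (f : mor X Y) : reflect (invariant f) (f \in fhom_space X Y).
Proof. exact: (fixed_spaceP (@sact_lin D A X Y)). Qed.

Definition fval X Y (f : fhom X Y) : mor X Y := vsval f.

Definition fhom_of X Y (f : mor X Y) (hf : invariant f) : fhom X Y :=
  Subvs (introT (fhomP f) hf).

Lemma fvalP X Y (f : fhom X Y) : invariant (fval f).
Proof. exact/fhomP/subvsP. Qed.

Lemma fval_inj X Y : injective (@fval X Y).
Proof. exact: subvs_inj. Qed.

Definition fidm X : fhom X X := fhom_of (invariant_id X).

Definition fcomp X Y Z (g : fhom Y Z) (f : fhom X Y) : fhom X Z :=
  fhom_of (invariant_comp (fvalP g) (fvalP f)).

Lemma fcompA X Y Z W (h : fhom Z W) (g : fhom Y Z) (f : fhom X Y) :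
  fcomp h (fcomp g f) = fcomp (fcomp h g) f.
Proof. by apply: fval_inj; exact: compA. Qed.

Lemma fcomp1m X Y (f : fhom X Y) : fcomp (fidm Y) f = f.
Proof. by apply: fval_inj; exact: comp1m. Qed.

Lemma fcompm1 X Y (f : fhom X Y) : fcomp f (fidm X) = f.
Proof. by apply: fval_inj; exact: compm1. Qed.

Lemma fcomp_linl X Y Z a (g g' : fhom Y Z) (f : fhom X Y) :
  fcomp (a *: g + g') f = a *: fcomp g f + fcomp g' f.
Proof. by apply: fval_inj; exact: comp_linl. Qed.

Lemma fcomp_linr X Y Z a (g : fhom Y Z) (f f' : fhom X Y) :
  fcomp g (a *: f + f') = a *: fcomp g f + fcomp g f'.
Proof. by apply: fval_inj; exact: comp_linr. Qed.

Definition fixed_lin : lin_cat K :=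
  @LinCat K D fhom fidm fcomp fcompA fcomp1m fcompm1 fcomp_linl fcomp_linr.

Lemma fiso_subproof X Y (g : mor Y X) (f : mor X Y) (hg : invariant g) (hf : invariant f) :
  g \c f = idm X -> fcomp (fhom_of hg) (fhom_of hf) = fidm X.
Proof. by move=> e; apply: fval_inj. Qed.

Definition fiso X Y (i : iso X Y) (hi : invariant i) : @iso K fixed_lin X Y :=
  @Iso K fixed_lin X Y (fhom_of hi) (fhom_of (invariant_inv hi))
    (fiso_subproof _ _ (ifwK i)) (fiso_subproof _ _ (ibwK i)).

Definition ftmor X Y X' Y' (f : fhom X X') (g : fhom Y Y') :
    fhom (X \ox Y) (X' \ox Y') :=
  fhom_of (invariant_tmor (fvalP f) (fvalP g)).

Lemma ftmor1 X Y : ftmor (fidm X) (fidm Y) = fidm (X \ox Y).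
Proof. by apply: fval_inj; exact: tmor1. Qed.

Lemma ftmor_comp X Y X' Y' X'' Y'' (f' : fhom X' X'') (g' : fhom Y' Y'')
    (f : fhom X X') (g : fhom Y Y') :
  ftmor (fcomp f' f) (fcomp g' g) = fcomp (ftmor f' g') (ftmor f g).
Proof. by apply: fval_inj; exact: tmor_comp. Qed.

Lemma ftmor_linl X Y X' Y' a (f f' : fhom X X') (g : fhom Y Y') :
  ftmor (a *: f + f') g = a *: ftmor f g + ftmor f' g.
Proof. by apply: fval_inj; exact: tmor_linl. Qed.

Lemma ftmor_linr X Y X' Y' a (f : fhom X X') (g g' : fhom Y Y') :
  ftmor f (a *: g + g') = a *: ftmor f g + ftmor f g'.
Proof. by apply: fval_inj; exact: tmor_linr. Qed.

Definition fassoc X Y Z : @iso K fixed_lin (tob (tob X Y) Z) (tob X (tob Y Z)) :=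
  @fiso (tob (tob X Y) Z) (tob X (tob Y Z)) (assoc X Y Z)
    (fun s => sact_assoc A s X Y Z).

Definition flunit X : @iso K fixed_lin (tob (unt D) X) X :=
  @fiso (tob (unt D) X) X (lunit X) (fun s => sact_lunit A s X).

Definition frunit X : @iso K fixed_lin (tob X (unt D)) X :=
  @fiso (tob X (unt D)) X (runit X) (fun s => sact_runit A s X).

Lemma fassoc_nat X Y Z X' Y' Z' (f : fhom X X') (g : fhom Y Y') (h : fhom Z Z') :
  fcomp (ifw (fassoc X' Y' Z')) (ftmor (ftmor f g) h) =
  fcomp (ftmor f (ftmor g h)) (ifw (fassoc X Y Z)).
Proof. by apply: fval_inj; exact: assoc_nat. Qed.

Lemma flunit_nat X X' (f : fhom X X') :
  fcomp (ifw (flunit X')) (ftmor (fidm (unt D)) f) = fcomp f (ifw (flunit X)).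
Proof. by apply: fval_inj; exact: lunit_nat. Qed.

Lemma frunit_nat X X' (f : fhom X X') :
  fcomp (ifw (frunit X')) (ftmor f (fidm (unt D))) = fcomp f (ifw (frunit X)).
Proof. by apply: fval_inj; exact: runit_nat. Qed.

Lemma fpentagon X Y Z W :
  fcomp (ifw (fassoc X Y (tob Z W))) (ifw (fassoc (tob X Y) Z W)) =
  fcomp (fcomp (ftmor (fidm X) (ifw (fassoc Y Z W))) (ifw (fassoc X (tob Y Z) W)))
    (ftmor (ifw (fassoc X Y Z)) (fidm W)).
Proof. by apply: fval_inj; exact: pentagon. Qed.

Lemma ftriangle X Y :
  fcomp (ftmor (fidm X) (ifw (flunit Y))) (ifw (fassoc X (unt D) Y)) =
  ftmor (ifw (frunit X)) (fidm Y).
Proof. by apply: fval_inj; exact: triangle. Qed.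

Definition fixed_cat : mon_cat K :=
  @MonCat K fixed_lin (unt D) (@tob L D) ftmor ftmor1 ftmor_comp ftmor_linl ftmor_linr
    fassoc fassoc_nat flunit flunit_nat frunit frunit_nat fpentagon ftriangle.

Local Notation E := (base_ext L fixed_cat).

Definition fext X Y (x : @mor L E X Y) : mor X Y :=
  fixed_ext (act := @sact D A X Y) x.

Lemma fext_lin X Y a (x y : @mor L E X Y) : fext (a *: x + y) = a *: fext x + fext y.
Proof. exact: (@fixed_ext_lin _ _ _ (@sact D A X Y)). Qed.

Lemma fext_in X Y (f : fhom X Y) : fext (ext_in L f) = fval f.
Proof. exact: (@fixed_ext_in _ _ _ (@sact D A X Y)). Qed.

Lemma fext1 X : fext (@idm L E X) = idm X.
Proof. exact: fext_in. Qed.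

Lemma fext_comp X Y Z (g : @mor L E Y Z) (f : @mor L E X Y) :
  fext (g \c f) = fext g \c fext f.
Proof.
elim/ext_ind: g => [g|a u v IH IH']; last first.
  by rewrite comp_linl !fext_lin comp_linl IH IH'.
elim/ext_ind: f => [f|a u v IH IH']; last first.
  by rewrite comp_linr !fext_lin comp_linr IH IH'.
by rewrite [X in fext X]ecomp_in !fext_in.
Qed.

Definition fixed_ext_lin_functor : lin_functor E D :=
  @LinFunctor L E D id fext fext1 fext_comp fext_lin.

Lemma fext_tmor X Y X' Y' (f : @mor L E X X') (g : @mor L E Y Y') :
  fext (@tmor L E _ _ _ _ f g) = fext f \om fext g.
Proof.
elim/ext_ind: f => [f|a u v IH IH']; last first.
  by rewrite tmor_linl !fext_lin tmor_linl IH IH'.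
elim/ext_ind: g => [g|a u v IH IH']; last first.
  by rewrite tmor_linr !fext_lin tmor_linr IH IH'.
by rewrite [X in fext X]etmor_in !fext_in.
Qed.

Lemma fext_ten_nat X Y X' Y' (f : @mor L E X X') (g : @mor L E Y Y') :
  iso_id (X' \ox Y') \c (fext f \om fext g) =
  fext (@tmor L E _ _ _ _ f g) \c iso_id (X \ox Y).
Proof. by rewrite fext_tmor comp1m compm1. Qed.

Lemma fext_assoc X Y Z :
  fext (@assoc L E X Y Z) \c iso_id (X \ox Y \ox Z) \c (iso_id (X \ox Y) \om idm Z) =
  iso_id (X \ox (Y \ox Z)) \c (idm X \om iso_id (Y \ox Z)) \c assoc X Y Z.
Proof. by rewrite !tmor1 !compm1 !comp1m; exact: fext_in. Qed.

Lemma fext_lunit X :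
  fext (@lunit L E X) \c iso_id (unt D \ox X) \c (iso_id (unt D) \om idm X) = lunit X.
Proof. by rewrite !tmor1 !compm1; exact: fext_in. Qed.

Lemma fext_runit X :
  fext (@runit L E X) \c iso_id (X \ox unt D) \c (idm X \om iso_id (unt D)) = runit X.
Proof. by rewrite !tmor1 !compm1; exact: fext_in. Qed.

Definition fixed_ext_functor : mon_functor E D :=
  @MonFunctor L E D fixed_ext_lin_functor (fun X Y => iso_id (X \ox Y)) fext_ten_nat
    (iso_id (unt D)) fext_assoc fext_lunit fext_runit.

Section Galois.
Hypothesis galLK : galois 1%AS {:L}%AS.

Lemma fixed_ext_ff : fully_faithful fixed_ext_functor.
Proof.
split=> X Y; first exact: (@fixed_ext_inj _ _ galLK _ (@sact D A X Y)
    (@sact_lin D A X Y) (@sact1 D A X Y)).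
exact: fixed_ext_surj (@sact_lin D A X Y) (@sact1 D A X Y) (@sactM D A X Y).
Qed.

(* If [f] is invariant and [f \c g \c f = f], the trace of [a *: g] can replace [g]
   when [a] has trace one. *)
Lemma fixed_regular (X Y : fixed_cat) (f : mor X Y) :
  @regular_mor L D X Y (fval f) -> regular_mor f.
Proof.
case=> g gP; have [a a1] := gal_trace_one galLK.
have hh := act_trace_fixed (@sact_lin D A Y X) (@sactM D A Y X) (a *: g).
exists (Subvs hh); apply: fval_inj.
transitivity (fval f \c (\sum_(s : Gal) sact A s (a *: g)) \c fval f); first by [].
rewrite comp_sumr comp_suml.
under eq_bigr => s _ do rewrite sactZ compZr compZl -{1}(fvalP f s)
  -{2}(fvalP f s) -!sact_comp gP (fvalP f s).
by rewrite -scaler_suml a1 scale1r.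
Qed.

(** Invariants span the morphism space over L, so a nonzero morphism forces a nonzero invariant
    one. *)
Lemma fixed_hom0 (X Y : fixed_cat) :
  (forall f : mor X Y, f = 0) -> forall f : @mor L D X Y, f = 0.
Proof.
move=> h f; apply: Classical_Prop.NNPP => f0.
by have [u []] := fixed_neq0 (@sact_lin D A X Y) (@sact1 D A X Y) (@sactM D A X Y) f0.
Qed.

(** Invariance of [a *: idm X] means that every [s] fixes [a], so [a] lies in K. *)
Lemma fixed_end_is_base (X : fixed_cat) : @end_is_base L D X -> end_is_base X.
Proof.
move=> bX; have X0 := end_is_base_neq0 bX.
apply: end_is_base_intro => [/(congr1 (@fval X X)) //|f].
have [a ea] := end_is_base_scalar bX (fval f).
have [|k ek] := gal_fixed_scalar galLK (x := a); last first.
  by exists k; apply: fval_inj; rewrite ea ek.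
move=> s; have := fvalP f s; rewrite ea sactZ sact_id => /eqP.
by rewrite -subr_eq0 -scalerBl scaler_eq0 subr_eq0 => /orP[/eqP|/eqP].
Qed.

Lemma fixed_idem_split :
  (forall (X : D) (e : mor X X), e \c e = e -> invariant e ->
    exists (Z : D) (i : mor Z X) (p : mor X Z),
      [/\ p \c i = idm Z, i \c p = e, invariant i & invariant p]) ->
  idem_split fixed_cat.
Proof.
move=> h X e ee; have [|Z [i [p [pi ip hi hp]]]] := h X (fval e) _ (fvalP e).
  by rewrite -[in RHS]ee.
by exists Z, (fhom_of hi), (fhom_of hp); split; apply: fval_inj.
Qed.

Lemma fixed_dirsum n (S : 'I_n -> D) X :
  (exists (i : forall j, mor (S j) X) (p : forall j, mor X (S j)),
    [/\ forall j, p j \c i j = idm (S j), forall j k, j != k -> p j \c i k = 0,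
        \sum_j i j \c p j = idm X, forall j, invariant (i j) & forall j, invariant (p j)]) ->
  @is_dirsum K fixed_cat n S X.
Proof.
case=> i [p [pi0 pi1 ip hi hp]].
exists (fun j => fhom_of (hi j)), (fun j => fhom_of (hp j)); split.
- by move=> j; apply: fval_inj; exact: pi0.
- by move=> j k jk; apply: fval_inj; exact: pi1.
- by apply: fval_inj; rewrite /fval linear_sum; exact: ip.
Qed.

Lemma fixed_dual_pair (Xd X : D) (ev : mor (Xd \ox X) (unt D)) (coev : mor (unt D) (X \ox Xd)) :
  runit X \c (idm X \om ev) \c assoc X Xd X \c (coev \om idm X) = lunit X ->
  lunit Xd \c (ev \om idm Xd) \c ibw (assoc Xd X Xd) \c (idm Xd \om coev)
      = runit Xd ->
  invariant ev -> invariant coev -> @dual_pair K fixed_cat Xd X.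
Proof.
move=> z1 z2 he hc; exists (fhom_of he), (fhom_of hc); split; apply: fval_inj.
  exact: z1.
exact: z2.
Qed.

End Galois.
End DescentDatum.

Section InvariantCoevaluation.
Variables (K : fieldType) (L : splittingFieldType K) (D : mon_cat L) (A : descent D).

(** The first zigzag characterises [coev] by means of [ev] and the structural isomorphisms
    ([ev_inj_ten]). All of these are invariant, so the conjugates of [coev] satisfy the same
    characterisation. *)
Lemma invariant_coev (Xd X : D) (ev : mor (Xd \ox X) (unt D)) (coev : mor (unt D) (X \ox Xd)) :
  runit X \c (idm X \om ev) \c assoc X Xd X \c (coev \om idm X) = lunit X ->
  lunit Xd \c (ev \om idm Xd) \c ibw (assoc Xd X Xd) \c (idm Xd \om coev) = runit Xd ->
  invariant A ev -> invariant A coev.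
Proof.
move=> z1 z2 hev s; apply: (ev_inj_ten z2).
have e : (idm X \om ev) \c assoc X Xd X \c (coev \om idm X) = ibw (runit X) \c lunit X.
  by apply: (@iso_monic _ _ _ _ (runit X)); rewrite [in RHS]compA ibwK comp1m !compA.
have inv_e : invariant A (ibw (runit X) \c lunit X).
  apply: invariant_comp => [|t]; last exact: sact_lunit.
  by apply: invariant_inv => t; exact: sact_runit.
by rewrite e -(inv_e s) -e !sact_comp !sact_tmor !sact_id sact_assoc hev.
Qed.

End InvariantCoevaluation.

(** * Equivariant objects *)

Section Actions.
Variables (K : fieldType) (L : splittingFieldType K).
Local Notation Gal := (gal_of {:L}).

(* No associativity is required of [ga_mu]: it is implied on the equivariant
   objects defined below, which are the only ones that matter. *)
Record action (C : mon_cat L) := Action {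
  ga_ob : Gal -> C -> C;
  ga_mor : forall s (X Y : C), mor X Y -> mor (ga_ob s X) (ga_ob s Y);
  ga_mor1 : forall s X, ga_mor s (idm X) = idm (ga_ob s X);
  ga_mor_comp : forall s X Y Z (g : mor Y Z) (f : mor X Y),
    ga_mor s (g \c f) = ga_mor s g \c ga_mor s f;
  ga_mor_lin : forall s X Y a (f g : mor X Y),
    ga_mor s (a *: f + g) = s a *: ga_mor s f + ga_mor s g;
  ga_ten : forall s X Y, iso (ga_ob s X \ox ga_ob s Y) (ga_ob s (X \ox Y));
  ga_ten_nat : forall s (X Y X' Y' : C) (f : mor X X') (g : mor Y Y'),
    ga_ten s X' Y' \c (ga_mor s f \om ga_mor s g) = ga_mor s (f \om g) \c ga_ten s X Y;
  ga_unt : forall s, iso (unt C) (ga_ob s (unt C));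
  ga_assoc : forall s X Y Z,
    ga_mor s (assoc X Y Z) \c ga_ten s (X \ox Y) Z \c (ga_ten s X Y \om idm (ga_ob s Z)) =
    ga_ten s X (Y \ox Z) \c (idm (ga_ob s X) \om ga_ten s Y Z) \c
      assoc (ga_ob s X) (ga_ob s Y) (ga_ob s Z);
  ga_lunit : forall s X,
    ga_mor s (lunit X) \c ga_ten s (unt C) X \c (ga_unt s \om idm (ga_ob s X)) =
    lunit (ga_ob s X);
  ga_runit : forall s X,
    ga_mor s (runit X) \c ga_ten s X (unt C) \c (idm (ga_ob s X) \om ga_unt s) =
    runit (ga_ob s X);
  ga_mu : forall s t X, iso (ga_ob s (ga_ob t X)) (ga_ob (gcomp s t) X);
  ga_mu_nat : forall s t X Y (f : mor X Y),
    ga_mu s t Y \c ga_mor s (ga_mor t f) = ga_mor (gcomp s t) f \c ga_mu s t X;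
  ga_mu_ten : forall s t X Y,
    ga_mu s t (X \ox Y) \c (ga_mor s (ga_ten t X Y) \c ga_ten s (ga_ob t X) (ga_ob t Y)) =
    ga_ten (gcomp s t) X Y \c (ga_mu s t X \om ga_mu s t Y);
  ga_mu_unt : forall s t,
    ga_mu s t (unt C) \c (ga_mor s (ga_unt t) \c ga_unt s) = ga_unt (gcomp s t);
  ga_rho : forall X, iso (ga_ob 1%g X) X;
  ga_rho_nat : forall X Y (f : mor X Y), ga_rho Y \c ga_mor 1%g f = f \c ga_rho X;
  ga_rho_ten : forall X Y, ga_rho (X \ox Y) \c ga_ten 1%g X Y = ga_rho X \om ga_rho Y;
  ga_rho_unt : ga_rho (unt C) \c ga_unt 1%g = idm (unt C) }.

Section RevAction.
Variables (C : mon_cat L) (A : action C).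

Lemma rev_ga_assoc s (X Y Z : C) :
  ga_mor A s (ibw (assoc X Y Z)) \c ga_ten A s X (Y \ox Z) \c
    (idm (ga_ob A s X) \om ga_ten A s Y Z) =
  ga_ten A s (X \ox Y) Z \c (ga_ten A s X Y \om idm (ga_ob A s Z)) \c
    ibw (assoc (ga_ob A s X) (ga_ob A s Y) (ga_ob A s Z)).
Proof.
apply: (@iso_epic _ _ _ _ (assoc _ _ _)).
rewrite -[RHS]compA ifwK compm1 -!compA (compA (ifw (ga_ten A s X _))) -ga_assoc.
by rewrite !compA -ga_mor_comp ifwK ga_mor1 comp1m.
Qed.

(** Serves to obtain equivariant right duals from the construction for left duals. *)
Definition rev_action : action (rev_mon C) :=
  @Action (rev_mon C) (ga_ob A) (ga_mor A) (ga_mor1 A) (ga_mor_comp A) (ga_mor_lin A)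
    (fun s X Y => ga_ten A s Y X) (fun s X Y X' Y' f g => ga_ten_nat A s g f)
    (ga_unt A) (fun s X Y Z => rev_ga_assoc s Z Y X) (ga_runit A) (ga_lunit A)
    (ga_mu A) (ga_mu_nat A) (fun s t X Y => ga_mu_ten A s t Y X) (ga_mu_unt A)
    (ga_rho A) (ga_rho_nat A) (fun X Y => ga_rho_ten A Y X) (ga_rho_unt A).

End RevAction.

Section Equivariant.
Variables (C : mon_cat L) (A : action C).
Local Notation ob := (ga_ob A).
Local Notation gm := (ga_mor A).

Definition ga_iso s (X Y : C) (i : iso X Y) : iso (ob s X) (ob s Y).
Proof.
exists (gm s i) (gm s (ibw i)).
  by rewrite -ga_mor_comp ifwK ga_mor1.
by rewrite -ga_mor_comp ibwK ga_mor1.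
Defined.

Lemma ga_mor0 s X Y : gm s (0 : mor X Y) = 0.
Proof.
have := ga_mor_lin A s (-1) (0 : mor X Y) 0.
by rewrite rmorphN1 !scaleN1r oppr0 addr0 addNr.
Qed.

Lemma ga_morD s X Y (f g : mor X Y) : gm s (f + g) = gm s f + gm s g.
Proof. by rewrite -[f]scale1r ga_mor_lin rmorph1 !scale1r. Qed.

Lemma ga_mor_sum (J : finType) s X Y (f : J -> mor X Y) :
  gm s (\sum_j f j) = \sum_j gm s (f j).
Proof. exact: (big_morph (fun f => gm s f) (@ga_morD s X Y) (ga_mor0 s X Y)). Qed.

Lemma ga_ten_inat s (X Y X' Y' : C) (f : mor X X') (g : mor Y Y') :
  (gm s f \om gm s g) \c ibw (ga_ten A s X Y) = ibw (ga_ten A s X' Y') \c gm s (f \om g).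
Proof.
apply: (@iso_monic _ _ _ _ (ga_ten A s X' Y')); rewrite !compA ibwK comp1m ga_ten_nat.
by rewrite -compA ibwK compm1.
Qed.

(* Invertibility of [estr] is automatic, see [estr_is_iso]. *)
Record eobj := EObj {
  eob :> C;
  estr : forall s, mor (ob s eob) eob;
  estr1 : estr 1%g = ga_rho A eob;
  estrM : forall s t, estr (gcomp s t) \c ga_mu A s t eob = estr s \c gm s (estr t) }.

Lemma estr_is_iso (X : eobj) s : is_iso (estr X s).
Proof.
pose t := (s^-1)%g.
have st1 : gcomp s t = 1%g by rewrite /gcomp mulVg.
have ts1 : gcomp t s = 1%g by rewrite /gcomp mulgV.
have iso1 r : r = 1%g -> is_iso (estr X r).
  by move=> ->; rewrite estr1; exists (ga_rho A X).
have [i ei] := iso1 _ st1; have [j ej] := iso1 _ ts1.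
pose b := gm s (estr X t) \c ibw (ga_mu A s t X) \c ibw i.
have ub : estr X s \c b = idm X.
  by rewrite /b !compA -estrM -(compA (estr X _)) ibwK compm1 -ei ibwK.
pose c := gm t (estr X s) \c ibw (ga_mu A t s X) \c ibw j.
have uc : estr X t \c c = idm X.
  by rewrite /c !compA -estrM -(compA (estr X _)) ibwK compm1 -ej ibwK.
(* It remains to see that the right inverse [b] of [estr X s] is also a left inverse.
   [gm s (estr X t)] has a left inverse by [e1] and the right inverse [gm s c], so the two coincide;
   this is [e2]. *)
have e1 : ibw (ga_mu A s t X) \c ibw i \c estr X s \c gm s (estr X t) = idm _.
  by rewrite -(compA _ (estr X s)) -estrM -ei -compA (compA (ibw i)) ifwK comp1m ifwK.
have e2 : gm s (estr X t) \c (ibw (ga_mu A s t X) \c ibw i \c estr X s) = idm _.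
  rewrite -[RHS]ga_mor1 -uc ga_mor_comp -[LHS]compm1 -ga_mor1 -uc ga_mor_comp.
  rewrite -[LHS]compA (compA (_ \c estr X s)) e1 comp1m //.
by apply: (is_iso_intro (g := b)) => //; rewrite /b -!compA !compA in e2 *.
Qed.

Definition estri (X : eobj) s : iso (ob s X) X := sval (iso_sig (estr_is_iso X s)).

Lemma estriE X s : ifw (estri X s) = estr X s.
Proof. exact: svalP (iso_sig (estr_is_iso X s)). Qed.

Lemma estr_epic (X : eobj) s (Y : C) (f g : mor X Y) :
  f \c estr X s = g \c estr X s -> f = g.
Proof. by rewrite -estriE; exact: iso_epic. Qed.

Definition equivariant (X Y : eobj) (f : mor X Y) : Prop :=
  forall s, f \c estr X s = estr Y s \c gm s f.

Definition eact (X Y : eobj) s (f : mor X Y) : mor X Y :=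
  estr Y s \c gm s f \c ibw (estri X s).

Lemma eactE (X Y : eobj) s (f : mor X Y) : eact s f \c estr X s = estr Y s \c gm s f.
Proof. by rewrite /eact -[estr X s]estriE -compA ifwK compm1. Qed.

Lemma eact_unique (X Y : eobj) s (f g : mor X Y) :
  g \c estr X s = estr Y s \c gm s f -> eact s f = g.
Proof. by move=> e; apply: (@estr_epic X s); rewrite eactE. Qed.

Lemma equivariantP (X Y : eobj) (f : mor X Y) :
  equivariant f <-> forall s, eact s f = f.
Proof.
by split=> h s; [apply: eact_unique; exact: h | rewrite -[in LHS](h s) eactE].
Qed.

Lemma eunt1 : ibw (ga_unt A 1%g) = ga_rho A (unt C) :> mor _ _.
Proof.
by apply: (@iso_epic _ _ _ _ (ga_unt A 1%g)); rewrite ifwK ga_rho_unt.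
Qed.

Lemma euntM s t : ibw (ga_unt A (gcomp s t)) \c ga_mu A s t (unt C) =
  ibw (ga_unt A s) \c gm s (ibw (ga_unt A t)).
Proof.
apply: (@iso_epic _ _ _ _ (iso_comp (ga_iso s (ga_unt A t)) (ga_unt A s))) => /=.
rewrite -compA ga_mu_unt ifwK -compA (compA (gm s _)) -ga_mor_comp ifwK ga_mor1 comp1m.
by rewrite ifwK.
Qed.

Definition eunt : eobj := @EObj (unt C) (fun s => ibw (ga_unt A s)) eunt1 euntM.

Definition eten_str (X Y : eobj) s : mor (ob s (X \ox Y)) (X \ox Y) :=
  (estr X s \om estr Y s) \c ibw (ga_ten A s X Y).

Lemma eten1 X Y : eten_str X Y 1%g = ga_rho A (X \ox Y).
Proof. by rewrite /eten_str !estr1 -ga_rho_ten -compA ibwK compm1. Qed.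

Lemma etenM X Y s t : eten_str X Y (gcomp s t) \c ga_mu A s t (X \ox Y) =
  eten_str X Y s \c gm s (eten_str X Y t).
Proof.
apply: (@iso_epic _ _ _ _ (iso_comp (ga_iso s (ga_ten A t X Y)) (ga_ten A s _ _))) => /=.
rewrite /eten_str -!compA ga_mu_ten (compA (ibw (ga_ten A (gcomp s t) X Y))) ifwK comp1m.
rewrite -tmor_comp !estrM tmor_comp; congr (_ \c _).
rewrite ga_mor_comp -(compA (gm s (_ \om _))) (compA (gm s (ibw _))) -ga_mor_comp ifwK.
by rewrite ga_mor1 comp1m -ga_ten_nat compA ifwK comp1m.
Qed.

Definition eten (X Y : eobj) : eobj := EObj (eten1 X Y) (etenM X Y).

(** The morphisms are all those of [C] between underlying objects, so this category is still
    L-linear; the equivariant ones reappear as the invariants of [edescent]. *)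
Definition elin : lin_cat L := {|
  obj := eobj;
  mor := fun X Y : eobj => mor (eob X) (eob Y);
  idm := fun X : eobj => idm (eob X);
  comp := fun X Y Z : eobj => @comp L C X Y Z;
  compA := fun X Y Z W : eobj => @compA L C X Y Z W;
  comp1m := fun X Y : eobj => @comp1m L C X Y;
  compm1 := fun X Y : eobj => @compm1 L C X Y;
  comp_linl := fun X Y Z : eobj => @comp_linl L C X Y Z;
  comp_linr := fun X Y Z : eobj => @comp_linr L C X Y Z |}.

Definition eiso_of (X Y : eobj) (i : iso (eob X) (eob Y)) : @iso L elin X Y :=
  @Iso L elin X Y (ifw i) (ibw i) (ifwK i) (ibwK i).

Definition ecat : mon_cat L := {|
  mon_lin := elin;
  unt := eunt;
  tob := eten;
  tmor := fun X Y X' Y' : eobj => @tmor L C X Y X' Y';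
  tmor1 := fun X Y : eobj => @tmor1 L C X Y;
  tmor_comp := fun X Y X' Y' X'' Y'' : eobj => @tmor_comp L C X Y X' Y' X'' Y'';
  tmor_linl := fun X Y X' Y' : eobj => @tmor_linl L C X Y X' Y';
  tmor_linr := fun X Y X' Y' : eobj => @tmor_linr L C X Y X' Y';
  assoc := fun X Y Z : eobj => @eiso_of (eten (eten X Y) Z) (eten X (eten Y Z)) (assoc X Y Z);
  assoc_nat := fun X Y Z X' Y' Z' : eobj => @assoc_nat L C X Y Z X' Y' Z';
  lunit := fun X : eobj => @eiso_of (eten eunt X) X (lunit X);
  lunit_nat := fun X X' : eobj => @lunit_nat L C X X';
  runit := fun X : eobj => @eiso_of (eten X eunt) X (runit X);
  runit_nat := fun X X' : eobj => @runit_nat L C X X';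
  pentagon := fun X Y Z W : eobj => @pentagon L C X Y Z W;
  triangle := fun X Y : eobj => @triangle L C X Y |}.

Lemma eact_lin (X Y : eobj) s a (f g : mor X Y) :
  eact s (a *: f + g) = s a *: eact s f + eact s g.
Proof. by rewrite /eact ga_mor_lin comp_linr comp_linl. Qed.

Lemma eact1 (X Y : eobj) (f : mor X Y) : eact 1%g f = f.
Proof. by apply: eact_unique; rewrite !estr1 ga_rho_nat. Qed.

Lemma eactM (X Y : eobj) s t (f : mor X Y) : eact (gcomp s t) f = eact s (eact t f).
Proof.
apply: eact_unique; apply: (@iso_epic _ _ _ _ (ga_mu A s t X)).
rewrite -!compA estrM -ga_mu_nat !compA estrM eactE -!compA -!ga_mor_comp.
by rewrite eactE.
Qed.

Lemma eact_id (X : eobj) s : eact s (idm X) = idm X.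
Proof. by apply: eact_unique; rewrite ga_mor1 comp1m compm1. Qed.

Lemma eact_comp (X Y Z : eobj) s (g : mor Y Z) (f : mor X Y) :
  eact s (g \c f) = eact s g \c eact s f.
Proof.
by apply: eact_unique; rewrite -compA eactE compA eactE -compA -ga_mor_comp.
Qed.

Lemma eact_tmor (X Y X' Y' : eobj) s (f : mor X X') (g : mor Y Y') :
  @eact (eten X Y) (eten X' Y') s (f \om g) = eact s f \om eact s g.
Proof.
apply: eact_unique; rewrite /= /eten_str compA -tmor_comp !eactE tmor_comp.
by rewrite -!compA ga_ten_inat.
Qed.

Lemma eassoc_equivariant (X Y Z : eobj) :
  @equivariant (eten (eten X Y) Z) (eten X (eten Y Z)) (assoc X Y Z).
Proof.
move=> s /=; rewrite /eten_str.
apply: (@iso_epic _ _ _ _ (iso_comp (ga_ten A s (X \ox Y) Z)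
  (tmor_iso (ga_ten A s X Y) (iso_id _)))) => /=.
rewrite -!compA (compA (ibw (ga_ten A s (X \ox Y) Z))) ifwK comp1m.
rewrite -tmor_comp -compA ifwK !compm1 assoc_nat.
rewrite (compA (gm s (assoc _ _ _))) ga_assoc -!compA.
rewrite (compA (ibw (ga_ten A s X (Y \ox Z)))) ifwK comp1m compA -tmor_comp -compA ifwK.
by rewrite !compm1.
Qed.

Lemma elunit_equivariant (X : eobj) : @equivariant (eten eunt X) X (lunit X).
Proof.
move=> s /=; rewrite /eten_str /=.
apply: (@iso_epic _ _ _ _ (iso_comp (ga_ten A s (unt C) X)
  (tmor_iso (ga_unt A s) (iso_id _)))) => /=.
rewrite -!compA (compA (ibw (ga_ten A s (unt C) X))) ifwK comp1m -tmor_comp ifwK compm1.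
by rewrite lunit_nat (compA (gm s _)) ga_lunit.
Qed.

Lemma erunit_equivariant (X : eobj) : @equivariant (eten X eunt) X (runit X).
Proof.
move=> s /=; rewrite /eten_str /=.
apply: (@iso_epic _ _ _ _ (iso_comp (ga_ten A s X (unt C))
  (tmor_iso (iso_id _) (ga_unt A s)))) => /=.
rewrite -!compA (compA (ibw (ga_ten A s X (unt C)))) ifwK comp1m -tmor_comp ifwK compm1.
by rewrite runit_nat (compA (gm s _)) ga_runit.
Qed.

Definition edescent : descent ecat :=
  @Descent K L ecat eact eact_lin eact1 eactM (fun s X => eact_id X s)
    (fun s X Y Z => @eact_comp X Y Z s) (fun s X Y X' Y' => @eact_tmor X Y X' Y' s)
    (fun s X Y Z => proj1 (equivariantP _) (eassoc_equivariant X Y Z) s)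
    (fun s X => proj1 (equivariantP _) (elunit_equivariant X) s)
    (fun s X => proj1 (equivariantP _) (erunit_equivariant X) s).

Lemma invariantP (X Y : eobj) (f : mor X Y) :
  @invariant K L ecat edescent X Y f <-> equivariant f.
Proof. exact: iff_sym (equivariantP f). Qed.

(* The zero object ([J] empty), direct sums, and images of equivariant idempotents
   ([J] a singleton, with [p \c i] the idempotent) are all of this form. *)
Section Retract.
Variables (J : finType) (X : J -> eobj) (Z : C).
Variables (i : forall j, mor (X j) Z) (p : forall j, mor Z (X j)).
Hypothesis ip : \sum_j i j \c p j = idm Z.
Hypothesis pi : forall j k, @equivariant (X j) (X k) (p k \c i j).

(** The structure for which all [i j] and [p j] are equivariant; consistency needs only that the
    composites [p k \c i j] are. *)
Definition retract_str s : mor (ob s Z) Z := \sum_j i j \c estr (X j) s \c gm s (p j).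

Lemma retract1 : retract_str 1%g = ga_rho A Z.
Proof.
rewrite -[RHS]comp1m -ip comp_suml; apply: eq_bigr => j _.
by rewrite estr1 -!compA ga_rho_nat.
Qed.

Lemma retract_in s j : i j \c estr (X j) s = retract_str s \c gm s (i j).
Proof.
rewrite /retract_str comp_suml -[i j in LHS]comp1m -ip comp_suml comp_suml.
apply: eq_bigr => k _.
by rewrite -[RHS]compA -ga_mor_comp -[RHS]compA -pi -!compA.
Qed.

Lemma retract_out s j : p j \c retract_str s = estr (X j) s \c gm s (p j).
Proof.
rewrite /retract_str comp_sumr -[p j in RHS]compm1 -ip comp_sumr ga_mor_sum comp_sumr.
apply: eq_bigr => k _.
by rewrite !compA pi -compA -ga_mor_comp.
Qed.

Lemma retractM s t : retract_str (gcomp s t) \c ga_mu A s t Z =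
  retract_str s \c gm s (retract_str t).
Proof.
rewrite [in LHS]/retract_str comp_suml [X in gm s X]/retract_str ga_mor_sum comp_sumr.
apply: eq_bigr => j _.
rewrite -[LHS]compA -ga_mu_nat -!compA (compA (estr _ _)) estrM -!compA.
by rewrite !ga_mor_comp !compA -retract_in.
Qed.

Definition retract_obj : eobj := EObj retract1 retractM.

Lemma retract_in_equivariant j : @equivariant (X j) retract_obj (i j).
Proof. by move=> s; exact: retract_in. Qed.

Lemma retract_out_equivariant j : @equivariant retract_obj (X j) (p j).
Proof. by move=> s; exact: retract_out. Qed.

End Retract.

Section Dual.
Variables (X : eobj) (Xd : C) (ev : mor (Xd \ox X) (unt C)) (coev : mor (unt C) (X \ox Xd)).
Hypothesis zig1 : runit X \c (idm (eob X) \om ev) \c assoc (eob X) Xd X \c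
  (coev \om idm (eob X)) = lunit X.
Hypothesis zig2 : lunit Xd \c (ev \om idm Xd) \c ibw (assoc Xd X Xd) \c
  (idm Xd \om coev) = runit Xd.

(* The structure on the dual is the one that makes [ev] equivariant. *)
Definition dual_target s : mor (ob s Xd \ox ob s X) (unt C) :=
  ibw (ga_unt A s) \c gm s ev \c ga_ten A s Xd X.

Lemma dual_str_subproof s : {h : mor (ob s Xd) Xd | ev \c (h \om estr X s) = dual_target s}.
Proof.
apply: constructive_indefinite_description.
have [h eh] := ev_surj zig1 (dual_target s \c (idm _ \om ibw (estri X s))).
exists h; rewrite -[h]compm1 -[estr X s]comp1m tmor_comp compA eh -compA -tmor_comp.
by rewrite -estriE ifwK comp1m tmor1 compm1.
Qed.

Definition dual_str s : mor (ob s Xd) Xd := sval (dual_str_subproof s).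

Lemma dual_strE s : ev \c (dual_str s \om estr X s) = dual_target s.
Proof. exact: svalP (dual_str_subproof s). Qed.

Lemma ev_iso_inj Y Y' (u : mor Y' X) (h h' : mor Y Xd) : is_iso u ->
  ev \c (h \om u) = ev \c (h' \om u) -> h = h'.
Proof.
move=> [i <-] e; apply: (ev_inj zig2); apply: (@iso_epic _ _ _ _ (tmor_iso (iso_id Y) i)) => /=.
by rewrite -!compA -!tmor_comp !compm1 !comp1m.
Qed.

Lemma dual1 : dual_str 1%g = ga_rho A Xd.
Proof.
apply: (ev_iso_inj (estr_is_iso X 1%g)); rewrite dual_strE estr1 /dual_target.
by rewrite -ga_rho_ten compA -ga_rho_nat eunt1.
Qed.

(** Maps into [Xd] may be compared after pairing with an isomorphism onto [X]. Pairing with the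
    structure maps of [X] turns both sides into composites of transports of [ev], which agree since
    mu is natural and monoidal. *)
Lemma dualM s t : dual_str (gcomp s t) \c ga_mu A s t Xd = dual_str s \c gm s (dual_str t).
Proof.
have iu : is_iso (estr X (gcomp s t) \c ga_mu A s t X).
  by rewrite -estriE; exists (iso_comp (estri X (gcomp s t)) (ga_mu A s t X)).
apply: (ev_iso_inj iu); rewrite tmor_comp compA dual_strE estrM tmor_comp compA dual_strE.
rewrite /dual_target -!compA -ga_mu_ten ga_ten_nat (compA (gm s ev)) -ga_mor_comp dual_strE.
rewrite (compA (gm (gcomp s t) ev)) -ga_mu_nat /dual_target !ga_mor_comp -!compA.
by rewrite (compA (ibw _)) euntM -!compA.
Qed.

Definition dual_obj : eobj := EObj dual1 dualM.

Lemma ev_equivariant : @equivariant (eten dual_obj X) eunt ev.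
Proof.
move=> s; rewrite /= /eten_str /= compA dual_strE /dual_target -!compA ibwK.
by rewrite compm1.
Qed.

End Dual.
End Equivariant.
End Actions.

(** * Idempotent completion *)

Section KaroubiInclusion.
Variables (F : fieldType) (C : mon_cat F).
Implicit Types X Y Z : C.

Definition kinc_ob X : kobj C := KObj (comp1m (idm X)).

Lemma kinc_mor_in X Y (f : mor X Y) : f \in kspace (kinc_ob X) (kinc_ob Y).
Proof. by apply: kmor_in; rewrite /= ?comp1m ?compm1. Qed.

Definition kinc_mor X Y (f : mor X Y) : kmor (kinc_ob X) (kinc_ob Y) :=
  Subvs (kinc_mor_in f).

Lemma kinc_mor1 X : kinc_mor (idm X) = kidm (kinc_ob X).
Proof. exact: val_inj. Qed.

Lemma kinc_mor_comp X Y Z (g : mor Y Z) (f : mor X Y) :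
  kinc_mor (g \c f) = kcomp (kinc_mor g) (kinc_mor f).
Proof. exact: val_inj. Qed.

Lemma kinc_mor_lin X Y a (f g : mor X Y) :
  kinc_mor (a *: f + g) = a *: kinc_mor f + kinc_mor g.
Proof. exact: val_inj. Qed.

Definition kinc_lin : lin_functor C (karoubi C) :=
  @LinFunctor F C (karoubi C) kinc_ob kinc_mor kinc_mor1 kinc_mor_comp kinc_mor_lin.

Lemma kinc_ten_subproof X Y : kid (kinc_ob (X \ox Y)) \c iso_id (X \ox Y) =
  iso_id (X \ox Y) \c kid (ktob (kinc_ob X) (kinc_ob Y)).
Proof. by rewrite /= tmor1. Qed.

Definition kinc_ten X Y : @iso F (karoubi C) (ktob (kinc_ob X) (kinc_ob Y)) (kinc_ob (X \ox Y)) :=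
  @kiso F C (ktob (kinc_ob X) (kinc_ob Y)) (kinc_ob (X \ox Y)) (iso_id (X \ox Y))
    (kinc_ten_subproof X Y).

Lemma kinc_ten_nat X Y X' Y' (f : mor X X') (g : mor Y Y') :
  kcomp (ifw (kinc_ten X' Y')) (ktmor (kinc_mor f) (kinc_mor g)) =
  kcomp (kinc_mor (f \om g)) (ifw (kinc_ten X Y)).
Proof. by apply: val_inj; rewrite /= !tmor1 !comp1m !compm1. Qed.

Definition kinc_unt : @iso F (karoubi C) (kunt C) (kinc_ob (unt C)) := iso_id _.

Lemma kinc_assoc X Y Z :
  kcomp (kcomp (kinc_mor (assoc X Y Z)) (ifw (kinc_ten (X \ox Y) Z)))
    (ktmor (ifw (kinc_ten X Y)) (kidm (kinc_ob Z))) =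
  kcomp (kcomp (ifw (kinc_ten X (Y \ox Z))) (ktmor (kidm (kinc_ob X)) (ifw (kinc_ten Y Z))))
    (ifw (kassoc (kinc_ob X) (kinc_ob Y) (kinc_ob Z))).
Proof. by apply: val_inj; rewrite /= !(comp1m, compm1, tmor1). Qed.

Lemma kinc_lunit X :
  kcomp (kcomp (kinc_mor (lunit X)) (ifw (kinc_ten (unt C) X)))
    (ktmor (ifw kinc_unt) (kidm (kinc_ob X))) = ifw (klunit (kinc_ob X)).
Proof. by apply: val_inj; rewrite /= !(comp1m, compm1, tmor1). Qed.

Lemma kinc_runit X :
  kcomp (kcomp (kinc_mor (runit X)) (ifw (kinc_ten X (unt C))))
    (ktmor (kidm (kinc_ob X)) (ifw kinc_unt)) = ifw (krunit (kinc_ob X)).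
Proof. by apply: val_inj; rewrite /= !(comp1m, compm1, tmor1). Qed.

Definition kinc : mon_functor C (karoubi C) :=
  @MonFunctor F C (karoubi C) kinc_lin kinc_ten kinc_ten_nat kinc_unt
    kinc_assoc kinc_lunit kinc_runit.

Lemma kinc_ff : fully_faithful kinc.
Proof.
split=> X Y; first by move=> f g /(congr1 vsval).
by move=> h; exists (vsval h); apply: val_inj.
Qed.

Lemma kincl_in (A : kobj C) : kid A \in kspace A (kinc_ob (kob A)).
Proof. by apply: (@kmor_in F C A (kinc_ob (kob A))); rewrite /= ?comp1m ?kidK. Qed.

Lemma kretr_in (A : kobj C) : kid A \in kspace (kinc_ob (kob A)) A.
Proof. by apply: (@kmor_in F C (kinc_ob (kob A)) A); rewrite /= ?compm1 ?kidK. Qed.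

Definition kincl (A : kobj C) : @mor F (karoubi C) A (kinc_ob (kob A)) := Subvs (kincl_in A).

Definition kretr (A : kobj C) : @mor F (karoubi C) (kinc_ob (kob A)) A := Subvs (kretr_in A).

Lemma kretrK A : kretr A \c kincl A = idm (A : karoubi C).
Proof. by apply: val_inj; exact: kidK. Qed.

Lemma kinc_es : idem_split C -> ess_surjective kinc.
Proof.
move=> h A; have [Z [i [p [pi ip]]]] := h _ _ (kidK A); exists Z.
have hi : i \in kspace (kinc_ob Z) A.
  by apply: (@kmor_in F C (kinc_ob Z) A); rewrite /= ?compm1 // -ip -compA pi compm1.
have hp : p \in kspace A (kinc_ob Z).
  by apply: (@kmor_in F C A (kinc_ob Z)); rewrite /= ?comp1m // -ip compA pi comp1m.
exists; exists (Subvs hi) (Subvs hp); apply: val_inj; [exact: pi | exact: ip].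
Qed.

End KaroubiInclusion.

Section Composites.
Variables (F : fieldType).

Lemma ff_comp (A B D : lin_cat F) (T : lin_functor B D) (S : lin_functor A B) :
  fully_faithful T -> fully_faithful S -> fully_faithful (comp_functor T S).
Proof.
move=> [iT sT] [iS sS]; split=> X Y; first by move=> f g /iT/iS.
by move=> h; have [g <-] := sT _ _ h; have [f <-] := sS _ _ g; exists f.
Qed.

Lemma es_comp (A B D : lin_cat F) (T : lin_functor B D) (S : lin_functor A B) :
  ess_surjective T -> ess_surjective S -> ess_surjective (comp_functor T S).
Proof.
move=> eT eS Z; have [Y [j]] := eT Z; have [X [i]] := eS Y; exists X; exists.
exact: iso_comp j (fmap_iso T i).
Qed.

Lemma equivalence_idem_split (A B : lin_cat F) (T : lin_functor A B) :
  is_equivalence T -> idem_split B -> idem_split A.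
Proof.
move=> eT sB X e ee; have ffT := equivalence_fully_faithful eT.
have [Z [i [p [pi ip]]]] := sB (T X) (fmor T e) (etrans (esym (fmor_comp T e e)) (congr1 _ ee)).
have [Y [j]] := equivalence_ess_surjective eT Z.
exists Y, (fflift ffT (i \c j)), (fflift ffT (ibw j \c p)).
split; apply: (proj1 ffT); rewrite fmor_comp !ffliftK ?fmor1.
  by rewrite -compA (compA p) pi comp1m ifwK.
by rewrite -compA (compA (ifw j)) ibwK comp1m.
Qed.

(** Idempotents split in [B], hence in [A], so [A] already is its own completion; [G] is precomposed
    with a monoidal inverse of the inclusion. *)
Lemma karoubi_equivalence (A B : mon_cat F) (G : mon_functor A B) :
  is_equivalence G -> idem_split B ->
  exists T : mon_functor (karoubi A) B, is_equivalence T.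
Proof.
move=> eG sB; have es := kinc_es (equivalence_idem_split eG sB).
exists (mcomp_functor G (inv_mon_functor (kinc_ff A) es)).
exact: ff_es_equivalence (ff_comp (equivalence_fully_faithful eG)
   (equivalence_fully_faithful (inv_functor_equivalence (kinc_ff A) es)))
  (es_comp (equivalence_ess_surjective eG)
   (equivalence_ess_surjective (inv_functor_equivalence (kinc_ff A) es))).
Qed.

End Composites.

Section Forget.
Variables (K : fieldType) (L : splittingFieldType K) (C : mon_cat L) (A : action C).

Definition forget_lin : lin_functor (ecat A) C :=
  @LinFunctor L (ecat A) C (fun X => eob X) (fun _ _ f => f) (fun _ => erefl)
    (fun _ _ _ _ _ => erefl) (fun _ _ _ _ _ => erefl).

Lemma forget_ten_nat (X Y X' Y' : eobj A) (f : mor (eob X) (eob X')) (g : mor (eob Y) (eob Y')) :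
  iso_id (eob X' \ox eob Y') \c (f \om g) = (f \om g) \c iso_id (eob X \ox eob Y).
Proof. by rewrite comp1m compm1. Qed.

Lemma forget_assoc (X Y Z : eobj A) :
  assoc (eob X) (eob Y) (eob Z) \c iso_id (eob X \ox eob Y \ox eob Z) \c
     (iso_id (eob X \ox eob Y) \om idm (eob Z)) =
  iso_id (eob X \ox (eob Y \ox eob Z)) \c (idm (eob X) \om iso_id (eob Y \ox eob Z)) \c
     assoc (eob X) (eob Y) (eob Z).
Proof. by rewrite /= !tmor1 !compm1 !comp1m. Qed.

Lemma forget_lunit (X : eobj A) :
  lunit (eob X) \c iso_id (unt C \ox eob X) \c (iso_id (unt C) \om idm (eob X)) = lunit (eob X).
Proof. by rewrite /= !tmor1 !compm1. Qed.

Lemma forget_runit (X : eobj A) :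
  runit (eob X) \c iso_id (eob X \ox unt C) \c (idm (eob X) \om iso_id (unt C)) = runit (eob X).
Proof. by rewrite /= !tmor1 !compm1. Qed.

Definition forget : mon_functor (ecat A) C :=
  @MonFunctor L (ecat A) C forget_lin (fun X Y => iso_id (eob X \ox eob Y)) forget_ten_nat
    (iso_id (unt C)) forget_assoc forget_lunit forget_runit.

Lemma forget_ff : fully_faithful forget.
Proof. by split=> X Y; [move=> f g | move=> h; exists h]. Qed.

End Forget.

(** * The form attached to an action *)

Section SplitFusion.
Variables (F : fieldType) (C : fusion_cat F).

Lemma fusion_kernels (X Y : C) (f : mor X Y) : exists K (k : mor K X), is_kernel f k.
Proof. by have [[_ _ /(_ _ _ f)[]]] := fusP C. Qed.

Lemma fusion_semisimple : semisimple_cat C.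
Proof. by case: (fusP C). Qed.

Lemma fusion_idem_split : idem_split C.
Proof. exact: kernels_idem_split fusion_kernels. Qed.

Lemma fusion_regular (X Y : C) (f : mor X Y) : regular_mor f.
Proof. exact: semisimple_regular fusion_kernels fusion_semisimple _ _ f. Qed.

Lemma dirsum_iso n (S S' : 'I_n -> C) X :
  (forall j, isomorphic (S j) (S' j)) -> is_dirsum S X -> is_dirsum S' X.
Proof.
move=> h [i [p [pi0 pi1 ip]]]; pose e j : iso (S j) (S' j) := epsilon (h j) (fun=> True).
exists (fun j => i j \c ibw (e j)), (fun j => e j \c p j); split.
- by move=> j; rewrite -compA (compA (p j)) pi0 comp1m ibwK.
- by move=> j k jk; rewrite -compA (compA (p j)) pi1 // comp0m compm0.
- by rewrite -ip; apply: eq_bigr => j _; rewrite -compA (compA (ibw _)) ifwK comp1m.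
Qed.

End SplitFusion.

Section FormOfAction.
Variables (K : fieldType) (L : splittingFieldType K).
Hypothesis galLK : galois 1%AS {:L}%AS.
Variables (C : fusion_cat L) (splitC : split_cat C) (I : irr_reps C) (A : action C).
Variable u : forall (i : I) s, mor (ga_ob A s (rep i)) (rep i).
Hypothesis u1 : forall i, u i 1%g = ga_rho A (rep i).
Hypothesis uM : forall i s t,
  u i (gcomp s t) \c ga_mu A s t (rep i) = u i s \c ga_mor A s (u i t).

Definition erep (i : I) : eobj A := EObj (u1 i) (uM i).

Local Notation CK := (fixed_cat (edescent A)).

Lemma dirsum_reps (X : C) : exists n (f : 'I_n -> I), is_dirsum (fun j => rep (f j)) X.
Proof.
have [n [S [sS dS]]] := fusion_semisimple X.
pose f j := sval (constructive_indefinite_description _ (rep_surj I (sS j))).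
exists n, f; apply: dirsum_iso dS => j.
exact: svalP (constructive_indefinite_description _ (rep_surj I (sS j))).
Qed.

(** Each [p k \c i j] is an identity or zero, hence equivariant, so [Z] receives the retract
    structure. *)
Lemma equivariant_dirsum n (S : 'I_n -> eobj A) (Z : C) :
  is_dirsum (fun j => eob (S j)) Z ->
  exists Zh : eobj A, eob Zh = Z /\ @is_dirsum K CK n S Zh.
Proof.
case=> i [p [pi0 pi1 ip]].
have pi j k : @equivariant K L C A (S j) (S k) (p k \c i j).
  move=> s; have [<-|jk] := eqVneq k j.
    by rewrite !pi0 ga_mor1 comp1m compm1.
  by rewrite pi1 // ga_mor0 comp0m compm0.
exists (retract_obj ip pi); split=> //; apply: fixed_dirsum; exists i, p; split=> // j.
  by apply/invariantP; exact: retract_in_equivariant.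
by apply/invariantP; exact: retract_out_equivariant.
Qed.

Lemma fixed_zero : exists Z : CK, is_zero Z.
Proof.
have [[[Z Z0] _ _ _ _] _ _ _ _] := fusP C.
have [|Zh [_ [i [p [_ _ ip]]]]] := @equivariant_dirsum 0 (fun=> eunt A) Z.
  exists (fun=> 0), (fun=> 0); split=> [[]//|[]//|].
  by rewrite big_ord0; apply/esym/is_zeroP.
by exists Zh; apply/is_zeroP; rewrite -ip big_ord0.
Qed.

Lemma fixed_sums (X Y : CK) :
  exists P, @is_dirsum K CK 2 (fun j => if j == ord0 then X else Y) P.
Proof.
have [[_ sums _ _ _] _ _ _ _] := fusP C.
have [P dP] := sums (eob (X : eobj A)) (eob (Y : eobj A)).
have e : (fun j : 'I_2 => if j == ord0 then eob (X : eobj A) else eob (Y : eobj A)) =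
    (fun j => eob (if j == ord0 then X else Y : eobj A)).
  by apply: functional_extensionality => j; case: ifP.
by rewrite e in dP; have [Ph [_ dPh]] := equivariant_dirsum dP; exists Ph.
Qed.

Lemma fixed_split_idem : idem_split CK.
Proof.
apply: fixed_idem_split => X e ee /invariantP he.
have [Z [i [p [pi ip]]]] := fusion_idem_split (C := C) ee.
have pi' : \sum_(j : 'I_1) p \c i = idm Z by rewrite big_ord1.
have he' (j k : 'I_1) : @equivariant K L C A X X (i \c p) by rewrite ip.
exists (retract_obj (J := 'I_1) (X := fun=> X) pi' he'), i, p; split=> //.
  by apply/invariantP; exact: (retract_out_equivariant (J := 'I_1) (X := fun=> X) pi' he' ord0).
by apply/invariantP; exact: (retract_in_equivariant (J := 'I_1) (X := fun=> X) pi' he' ord0).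
Qed.

Lemma fixed_all_regular (X Y : CK) (f : mor X Y) : regular_mor f.
Proof. exact/(fixed_regular galLK)/fusion_regular. Qed.

Lemma fixed_rep_base (i : I) : @end_is_base K CK (erep i).
Proof. exact/(fixed_end_is_base galLK)/(splitC (rep_simple i)). Qed.

(** If no nonzero equivariant map leads from a simple representative to [X], then by descent no
    nonzero map does; but [X] is a direct sum of such representatives in [C]. *)
Lemma fixed_rep_gen (X : CK) : (forall i (f : @mor K CK (erep i) X), f = 0) -> is_zero X.
Proof.
move=> h; have h0 i := fixed_hom0 (h i).
have [n [f [i [p [_ _ ip]]]]] := dirsum_reps (eob (X : eobj A)).
apply/is_zeroP/fval_inj.
transitivity (idm (eob (X : eobj A))); first by [].
by rewrite -ip big1 // => j _; rewrite [i j](h0 (f j)) comp0m.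
Qed.

Lemma fixed_left_dual (X : CK) : exists Xd, dual_pair Xd X.
Proof.
have [_ _ _ rC _] := fusP C.
have [[Xd [ev [coev [z1 z2]]]] _] := rC (eob (X : eobj A)).
exists (dual_obj z1 z2).
have ie : @invariant K L (ecat A) (edescent A) (eten (dual_obj z1 z2) X) (eunt A) ev.
  by apply/invariantP; exact: ev_equivariant.
exact: (@fixed_dual_pair K L (ecat A) (edescent A) (dual_obj z1 z2) X ev coev z1 z2 ie)
  (@invariant_coev K L (ecat A) (edescent A) (dual_obj z1 z2) X ev coev z1 z2 ie).
Qed.

Definition rev_eobj (X : eobj A) : eobj (rev_action A) :=
  @EObj K L (rev_mon C) (rev_action A) (eob X) (estr X) (estr1 X) (estrM X).

Definition unrev_eobj (X : eobj (rev_action A)) : eobj A :=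
  @EObj K L C A (eob X) (estr X) (estr1 X) (estrM X).

Lemma fixed_right_dual (X : CK) : exists Xd, dual_pair X Xd.
Proof.
have [_ _ _ rC _] := fusP C.
have [_ [Xd dX]] := rC (eob (X : eobj A)); have [ev [coev [z1 z2]]] := dX.
(* Reversing the tensor product exchanges the two zigzags, whence the order [z2 z1]. *)
pose Y := unrev_eobj (@dual_obj K L (rev_mon C) (rev_action A) (rev_eobj X) Xd ev coev z2 z1).
have ie : @invariant K L (ecat A) (edescent A) (eten X Y) (eunt A) ev.
  apply/invariantP.
  exact: (@ev_equivariant K L (rev_mon C) (rev_action A) (rev_eobj X) Xd ev coev z2 z1).
exists Y; exact: (@fixed_dual_pair K L (ecat A) (edescent A) X Y ev coev z1 z2 ie)
  (@invariant_coev K L (ecat A) (edescent A) X Y ev coev z1 z2 ie).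
Qed.

Lemma fixed_fusion : is_fusion CK.
Proof.
split.
- exact: regular_abelian fixed_zero fixed_sums fixed_split_idem fixed_all_regular.
- exact: (@gen_semisimple K CK fixed_split_idem fixed_all_regular I erep fixed_rep_base
    fixed_rep_gen).
- exact: (@gen_finitely_many K CK fixed_all_regular I erep fixed_rep_base
    fixed_rep_gen).
- by move=> X; split; [exact: fixed_left_dual | exact: fixed_right_dual].
- have [_ _ _ _ bC] := fusP C; exact: (fixed_end_is_base galLK (X := eunt A : CK)).
Qed.

Lemma fixed_split : split_cat CK.
Proof.
by move=> X; exact: (@gen_split K CK fixed_all_regular I erep fixed_rep_base fixed_rep_gen X).
Qed.

Lemma forget_es : ess_surjective (forget A).
Proof.
move=> X; have [n [f dX]] := dirsum_reps X.
have [Xh [e _]] := @equivariant_dirsum n (fun j => erep (f j)) X dX.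
by exists Xh; rewrite /= e; exists; exact: iso_id.
Qed.

Lemma form_of_action : exists CF : fusion_cat K, split_cat CF /\ is_form C CF.
Proof.
exists (FusionCat fixed_fusion); split; first exact: fixed_split.
apply: (@karoubi_equivalence L (base_ext L CK) C
  (mcomp_functor (forget A) (fixed_ext_functor (edescent A)))).
  apply: ff_es_equivalence.
    exact: ff_comp (forget_ff A) (fixed_ext_ff (edescent A) galLK).
  move=> X; have [Y hY] := forget_es X; exists Y; exact: hY.
exact: fusion_idem_split.
Qed.

End FormOfAction.

(** * From sections to actions *)

Section FramedClasses.
Variables (K : fieldType) (L : splittingFieldType K) (C : mon_cat L) (I : irr_reps C).
Local Notation Gal := (gal_of {:L}).

Definition fr_mk s (T : framed I s) : Pi_fr I :=
  @PiFr K L C I s (fr_equiv T) (ex_intro _ T erefl).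

Lemma Pi_fr_eq s (c c' : framed I s -> Prop) (h : exists T, c = fr_equiv T)
    (h' : exists T, c' = fr_equiv T) : c = c' -> PiFr h = PiFr h'.
Proof. by move=> e; case: _ / e h' => h'; rewrite (proof_irrelevance _ h h'). Qed.

Lemma fr_mk_surj (x : Pi_fr I) s : p_fr x = s -> exists T : framed I s, x = fr_mk T.
Proof.
case: x => p c h /= e; case: _ / e; case: (h) => T cT; exists T.
exact: Pi_fr_eq.
Qed.

(** The classes live over a Galois element that varies with the pair; decidable equality of Galois
    elements allows the second components to be compared. *)
Lemma fr_mk_inj s (T T' : framed I s) : fr_mk T = fr_mk T' -> fr_equiv T T'.
Proof.
move=> e; pose g (x : Pi_fr I) := existT (fun p => framed I p -> Prop)
  (p_fr x) (@fr_class K L C I x).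
have h : fr_equiv T = fr_equiv T' := Eqdep_dec.inj_pair2_eq_dec _ (@eq_comparable Gal)
  (fun p => framed I p -> Prop) _ _ _ (congr1 g e).
by rewrite h; exact: fr_equiv_refl.
Qed.

Lemma fr_mk_eq s (T T' : framed I s) : fr_equiv T T' -> fr_mk T = fr_mk T'.
Proof.
move=> e; apply: Pi_fr_eq; apply: functional_extensionality => V.
apply: propositional_extensionality; split; last exact: fr_equiv_trans.
by apply: fr_equiv_trans; exact: fr_equiv_sym.
Qed.

Lemma fr_mk_mul s t (T : framed I s) (S : framed I t) :
  Pi_fr_mul (fr_mk T) (fr_mk S) = fr_mk (fr_comp T S).
Proof.
apply: Pi_fr_eq; apply: functional_extensionality => V.
apply: propositional_extensionality; split=> [[T' [S' [TT' SS' TSV]]] | TSV].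
  exact: fr_equiv_trans (fr_comp_equiv TT' SS') TSV.
by exists T, S; split=> //; exact: fr_equiv_refl.
Qed.

(** Trades the group of classes for chosen representatives that are multiplicative up to framed
    equivalence. *)
Lemma sectionP : (exists sec : Gal -> Pi_fr I, is_section sec) <->
  exists T : forall s, framed I s,
    forall s t, fr_equiv (fr_comp (T s) (T t)) (T (gcomp s t)).
Proof.
split=> [[sec [ps secM]]|[T TM]]; last first.
  exists (fun s => fr_mk (T s)); split=> // s t; rewrite fr_mk_mul.
  exact/fr_mk_eq/fr_equiv_sym.
have h s := constructive_indefinite_description _ (fr_mk_surj (ps s)).
exists (fun s => sval (h s)) => s t; apply: fr_mk_inj.
by rewrite -fr_mk_mul -!(svalP (h _)) secM.
Qed.

Section ActionOfSection.
Variable T : forall s, framed I s.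
Hypothesis TM : forall s t, fr_equiv (fr_comp (T s) (T t)) (T (gcomp s t)).
Implicit Types X Y Z : C.

Definition sf_ob s X : C := fob (te_fun (T s)) X.

Definition sf_mor s X Y (f : mor X Y) : mor (sf_ob s X) (sf_ob s Y) :=
  @fmor L (twist_lin s C) C (te_fun (T s)) X Y f.

Definition sf_ten s X Y : iso (sf_ob s X \ox sf_ob s Y) (sf_ob s (X \ox Y)) :=
  mf_ten (te_fun (T s)) X Y.

Definition sf_unt s : iso (unt C) (sf_ob s (unt C)) := mf_unt (te_fun (T s)).

Lemma sf_mor1 s X : sf_mor s (idm X) = idm (sf_ob s X).
Proof. exact: (@fmor1 L (twist_lin s C) C (te_fun (T s))). Qed.

Lemma sf_mor_comp s X Y Z (g : mor Y Z) (f : mor X Y) :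
  sf_mor s (g \c f) = sf_mor s g \c sf_mor s f.
Proof. exact: (@fmor_comp L (twist_lin s C) C (te_fun (T s))). Qed.

Lemma sf_mor_lin s X Y a (f g : mor X Y) :
  sf_mor s (a *: f + g) = s a *: sf_mor s f + sf_mor s g.
Proof.
rewrite -(@fmor_lin L (twist_lin s C) C (te_fun (T s))).
by congr fmor; rewrite /GRing.scale /= /twist_scale galKV.
Qed.

Lemma sf_ten_nat s X Y X' Y' (f : mor X X') (g : mor Y Y') :
  sf_ten s X' Y' \c (sf_mor s f \om sf_mor s g) = sf_mor s (f \om g) \c sf_ten s X Y.
Proof. exact: (@mf_ten_nat L (twist s C) C (te_fun (T s))). Qed.

Lemma sf_assoc s X Y Z :
  sf_mor s (assoc X Y Z) \c sf_ten s (X \ox Y) Z \c (sf_ten s X Y \om idm (sf_ob s Z)) =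
  sf_ten s X (Y \ox Z) \c (idm (sf_ob s X) \om sf_ten s Y Z) \c
    assoc (sf_ob s X) (sf_ob s Y) (sf_ob s Z).
Proof. exact: (@mf_assoc L (twist s C) C (te_fun (T s))). Qed.

Lemma sf_lunit s X :
  sf_mor s (lunit X) \c sf_ten s (unt C) X \c (sf_unt s \om idm (sf_ob s X)) =
  lunit (sf_ob s X).
Proof. exact: (@mf_lunit L (twist s C) C (te_fun (T s))). Qed.

Lemma sf_runit s X :
  sf_mor s (runit X) \c sf_ten s X (unt C) \c (idm (sf_ob s X) \om sf_unt s) =
  runit (sf_ob s X).
Proof. exact: (@mf_runit L (twist s C) C (te_fun (T s))). Qed.

Definition sf_frame i s : iso (sf_ob s (rep i)) (rep i) := frame (T s) i.

(** The product is a variable [r] so that [s = t = r = 1] is an instance, without transport along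
    [1 * 1 = 1]. *)
Lemma sf_compat s t r : gcomp s t = r ->
  exists mu : forall X, iso (sf_ob s (sf_ob t X)) (sf_ob r X),
  [/\ forall X Y (f : mor X Y), mu Y \c sf_mor s (sf_mor t f) = sf_mor r f \c mu X,
      forall X Y, mu (X \ox Y) \c (sf_mor s (sf_ten t X Y) \c sf_ten s (sf_ob t X) (sf_ob t Y)) =
        sf_ten r X Y \c (mu X \om mu Y),
      mu (unt C) \c (sf_mor s (sf_unt t) \c sf_unt s) = sf_unt r
    & forall i, sf_frame i r \c mu (rep i) = sf_frame i s \c sf_mor s (sf_frame i t)].
Proof.
move=> <-; have [eta [[nat_eta ten_eta unt_eta] fr_eta]] := TM s t.
by exists eta; split.
Qed.

Definition sf_mu_sig s t := constructive_indefinite_description _ (@sf_compat s t _ erefl).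
Definition sf_mu s t := sval (sf_mu_sig s t).

Lemma sf_ff s : fully_faithful (te_fun (T s)).
Proof. exact: equivalence_fully_faithful (te_equiv (T s)). Qed.

Lemma sf_mor_inj s X Y : injective (@sf_mor s X Y).
Proof. exact: (proj1 (sf_ff s)). Qed.

(** F_1 is idempotent up to mu and fully faithful, so mu at (1, 1) is F_1 of a unique rho.
    Compatibility with frames reads [f_1 mu = f_1 F_1(f_1)]; cancelling [f_1] and then F_1 gives
    [rho = f_1] on simple representatives. *)
Lemma sf_rho_ex : exists rho : forall X, iso (sf_ob 1%g X) X,
  [/\ forall X Y (f : mor X Y), rho Y \c sf_mor 1%g f = f \c rho X,
      forall X Y, rho (X \ox Y) \c sf_ten 1%g X Y = rho X \om rho Y,
      rho (unt C) \c sf_unt 1%g = idm (unt C)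
    & forall i, sf_frame i 1%g = rho (rep i) :> mor _ _].
Proof.
have [nu [nat_nu ten_nu unt_nu fr_nu]] := @sf_compat 1%g 1%g 1%g (mulg1 _).
have [rho rhoE] : exists rho : forall X, iso (sf_ob 1%g X) X,
    forall X, sf_mor 1%g (rho X) = nu X.
  pose l X := fflift_iso (sf_ff 1%g) (nu X : @iso L C (te_fun (T 1%g) (sf_ob 1%g X))
     (te_fun (T 1%g) X)).
  exists (fun X => @Iso L C _ _ (ifw (l X)) (ibw (l X)) (ifwK (l X)) (ibwK (l X))) => X.
  exact: (@ffliftK _ _ _ _ (sf_ff 1%g)).
exists rho; split.
- by move=> X Y f; apply: (@sf_mor_inj 1%g); rewrite !sf_mor_comp !rhoE nat_nu.
- move=> X Y; apply: (@sf_mor_inj 1%g); apply: (@iso_epic _ _ _ _ (sf_ten 1%g _ _)).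
  by rewrite sf_mor_comp rhoE -compA ten_nu -!rhoE sf_ten_nat.
- apply: (@sf_mor_inj 1%g); apply: (@iso_epic _ _ _ _ (sf_unt 1%g)).
  by rewrite sf_mor_comp rhoE -compA unt_nu sf_mor1 comp1m.
- move=> i; apply: (@sf_mor_inj 1%g); rewrite rhoE; apply: (@iso_monic _ _ _ _ (sf_frame i 1%g)).
  by rewrite fr_nu.
Qed.

Definition sf_rho_sig := constructive_indefinite_description _ sf_rho_ex.
Definition sf_rho := sval sf_rho_sig.

Definition sf_action : action C.
Proof.
refine (@Action K L C sf_ob sf_mor sf_mor1 sf_mor_comp sf_mor_lin sf_ten sf_ten_nat sf_unt
  sf_assoc sf_lunit sf_runit sf_mu _ _ _ sf_rho _ _ _).
- by move=> s t; case: (svalP (sf_mu_sig s t)).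
- by move=> s t; case: (svalP (sf_mu_sig s t)).
- by move=> s t; case: (svalP (sf_mu_sig s t)).
- by case: (svalP sf_rho_sig).
- by case: (svalP sf_rho_sig).
- by case: (svalP sf_rho_sig).
Defined.

Lemma sf_frame1 i : sf_frame i 1%g = ga_rho sf_action (rep i) :> mor _ _.
Proof. by case: (svalP sf_rho_sig). Qed.

Lemma sf_frameM i s t : sf_frame i (gcomp s t) \c ga_mu sf_action s t (rep i) =
  sf_frame i s \c sf_mor s (sf_frame i t).
Proof. by case: (svalP (sf_mu_sig s t)). Qed.

End ActionOfSection.
End FramedClasses.

Lemma form_of_section (K : fieldType) (L : splittingFieldType K)
    (galLK : galois 1%AS {:L}%AS)
    (C : fusion_cat L) (splitC : split_cat C) (I : irr_reps C) :
  (exists sec : gal_of {:L} -> Pi_fr I, is_section sec) ->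
  exists CK : fusion_cat K, split_cat CK /\ is_form C CK.
Proof.
move/sectionP => [T TM].
exact: (@form_of_action K L galLK C splitC I (sf_action TM) (fun i s => sf_frame T i s)
  (sf_frame1 TM) (sf_frameM TM)).
Qed.

(** * From forms to sections *)

Section Conjugation.
Variables (K : fieldType) (L : splittingFieldType K).
Local Notation Gal := (gal_of {:L}).

Section Space.
Variable V : vectType K.

Definition ext_conj (s : Gal) (x : ext_space L V) : ext_space L V := map_mx s x.

Lemma ext_conj_lin s a x y : ext_conj s (a *: x + y) = s a *: ext_conj s x + ext_conj s y.
Proof. by rewrite /ext_conj map_mxD map_mxZ. Qed.

Lemma ext_conj_in s (v : V) : ext_conj s (ext_in L v) = ext_in L v.
Proof. by apply/rowP => i; rewrite !mxE rmorph_alg. Qed.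

Lemma ext_conjK s : cancel (ext_conj s) (ext_conj (s^-1)%g).
Proof. by move=> x; apply/rowP => i; rewrite !mxE galKV. Qed.

Lemma ext_conjVK s : cancel (ext_conj (s^-1)%g) (ext_conj s).
Proof. by move=> x; apply/rowP => i; rewrite !mxE galVK. Qed.

Lemma ext_conjM s t x : ext_conj (gcomp s t) x = ext_conj s (ext_conj t x).
Proof. by apply/rowP => i; rewrite !mxE gcompE. Qed.

End Space.

Variable CK : mon_cat K.
Local Notation E := (base_ext L CK).

Definition cj (s : Gal) (X Y : E) (f : mor X Y) : mor X Y := ext_conj s f.

Lemma cj_lin s (X Y : E) a (f g : mor X Y) : cj s (a *: f + g) = s a *: cj s f + cj s g.
Proof. exact: ext_conj_lin. Qed.

Lemma cjM s t (X Y : E) (f : mor X Y) : cj (gcomp s t) f = cj s (cj t f).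
Proof. exact: ext_conjM. Qed.

Lemma cj1 s (X : E) : cj s (idm X) = idm X.
Proof. exact: ext_conj_in. Qed.

Lemma cj_comp s (X Y Z : E) (g : mor Y Z) (f : mor X Y) : cj s (g \c f) = cj s g \c cj s f.
Proof.
elim/ext_ind: g => [g|a u v IH IH']; last first.
  by rewrite comp_linl !cj_lin comp_linl IH IH'.
elim/ext_ind: f => [f|a u v IH IH']; last first.
  by rewrite comp_linr !cj_lin comp_linr IH IH'.
by rewrite [X in cj _ X]ecomp_in /cj !ext_conj_in; exact/esym/ecomp_in.
Qed.

Lemma cj_tmor s (X Y X' Y' : E) (f : mor X X') (g : mor Y Y') :
  cj s (f \om g) = cj s f \om cj s g.
Proof.
elim/ext_ind: f => [f|a u v IH IH']; last first.
  by rewrite tmor_linl !cj_lin tmor_linl IH IH'.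
elim/ext_ind: g => [g|a u v IH IH']; last first.
  by rewrite tmor_linr !cj_lin tmor_linr IH IH'.
by rewrite [X in cj _ X]etmor_in /cj !ext_conj_in; exact/esym/etmor_in.
Qed.

Lemma cj_assoc s (X Y Z : E) : cj s (assoc X Y Z) = assoc X Y Z.
Proof. exact: ext_conj_in. Qed.

Lemma cj_lunit s (X : E) : cj s (lunit X) = lunit X.
Proof. exact: ext_conj_in. Qed.

Lemma cj_runit s (X : E) : cj s (runit X) = runit X.
Proof. exact: ext_conj_in. Qed.

Definition cj_iso (s : Gal) (X Y : E) (i : iso X Y) : iso X Y.
Proof.
exists (cj s i) (cj s (ibw i)).
  by rewrite -cj_comp ifwK cj1.
by rewrite -cj_comp ibwK cj1.
Defined.

Lemma cj_isoE s (X Y : E) (i : iso X Y) : ifw (cj_iso s i) = cj s i.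
Proof. by []. Qed.

Variables (C : mon_cat L) (G : mon_functor E C).
Hypotheses (ffG : fully_faithful G) (esG : ess_surjective G).
Local Notation S := (inv_mon_functor ffG esG).
Local Notation eps := (inv_counit ffG esG).

Section TwistedInverse.
Variable s : Gal.

Definition tw_inv_mor (X Y : C) (f : @mor L (twist s C) X Y) : mor (S X) (S Y) :=
  cj s (fmor S (f : @mor L C X Y)).

Lemma tw_inv_mor1 (X : C) : tw_inv_mor (idm X) = idm (S X).
Proof. by rewrite /tw_inv_mor fmor1 cj1. Qed.

Lemma tw_inv_mor_comp (X Y Z : C) (g : mor Y Z) (f : mor X Y) :
  tw_inv_mor (g \c f) = tw_inv_mor g \c tw_inv_mor f.
Proof. by rewrite /tw_inv_mor fmor_comp cj_comp. Qed.

Lemma tw_inv_mor_lin (X Y : twist s C) a (f g : mor X Y) :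
  tw_inv_mor (a *: f + g) = a *: tw_inv_mor f + tw_inv_mor g.
Proof.
rewrite /tw_inv_mor.
have -> : a *: f + g = ((s^-1)%g a *: (f : @mor L C X Y) + (g : @mor L C X Y)) by [].
by rewrite fmor_lin cj_lin galVK.
Qed.

Definition tw_inv_lin : lin_functor (twist s C) E :=
  @LinFunctor L (twist s C) E (fob S) tw_inv_mor tw_inv_mor1 tw_inv_mor_comp tw_inv_mor_lin.

Definition tw_inv_ten (X Y : C) : iso (S X \ox S Y) (S (X \ox Y)) := cj_iso s (mf_ten S X Y).

Definition tw_inv_unt : iso (unt E) (S (unt C)) := cj_iso s (mf_unt S).

Lemma tw_inv_ten_nat (X Y X' Y' : C) (f : mor X X') (g : mor Y Y') :
  tw_inv_ten X' Y' \c (tw_inv_mor f \om tw_inv_mor g) =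
  tw_inv_mor (f \om g) \c tw_inv_ten X Y.
Proof. by rewrite /tw_inv_mor /tw_inv_ten !cj_isoE -cj_tmor -!cj_comp mf_ten_nat. Qed.

Lemma tw_inv_assoc (X Y Z : C) :
  tw_inv_mor (assoc X Y Z) \c tw_inv_ten (X \ox Y) Z \c (tw_inv_ten X Y \om idm (S Z)) =
  tw_inv_ten X (Y \ox Z) \c (idm (S X) \om tw_inv_ten Y Z) \c assoc (S X) (S Y) (S Z).
Proof.
rewrite -(cj1 s (S X)) -(cj1 s (S Z)) -(cj_assoc s)
  /tw_inv_mor /tw_inv_ten !cj_isoE -!cj_tmor -!cj_comp.
by rewrite mf_assoc.
Qed.

Lemma tw_inv_lunit (X : C) :
  tw_inv_mor (lunit X) \c tw_inv_ten (unt C) X \c (tw_inv_unt \om idm (S X)) = lunit (S X).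
Proof.
by rewrite -(cj1 s (S X)) -(cj_lunit s)
  /tw_inv_mor /tw_inv_ten /tw_inv_unt !cj_isoE -!cj_tmor -!cj_comp mf_lunit.
Qed.

Lemma tw_inv_runit (X : C) :
  tw_inv_mor (runit X) \c tw_inv_ten X (unt C) \c (idm (S X) \om tw_inv_unt) = runit (S X).
Proof.
by rewrite -(cj1 s (S X)) -(cj_runit s)
  /tw_inv_mor /tw_inv_ten /tw_inv_unt !cj_isoE -!cj_tmor -!cj_comp mf_runit.
Qed.

Definition tw_inv : mon_functor (twist s C) E :=
  @MonFunctor L (twist s C) E tw_inv_lin tw_inv_ten tw_inv_ten_nat tw_inv_unt
    tw_inv_assoc tw_inv_lunit tw_inv_runit.

Lemma tw_inv_ff : fully_faithful tw_inv.
Proof.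
have [iS sS] := equivalence_fully_faithful (inv_functor_equivalence ffG esG).
split=> X Y; first by move=> f g /(can_inj (@ext_conjK _ s))/iS.
move=> h; have [f ef] := sS _ _ (cj (s^-1)%g h); exists f.
by rewrite -[RHS](@ext_conjVK _ s) -[ext_conj _ h]ef.
Qed.

Lemma tw_inv_es : ess_surjective tw_inv.
Proof. exact: equivalence_ess_surjective (inv_functor_equivalence ffG esG). Qed.

Definition conj_functor : mon_functor (twist s C) C := mcomp_functor G tw_inv.

Lemma conj_equivalence : is_equivalence conj_functor.
Proof. exact: ff_es_equivalence (ff_comp ffG tw_inv_ff) (es_comp esG tw_inv_es). Qed.

Definition conj_te : twisted_equiv C s := TwistedEquiv conj_equivalence.

Variable I : irr_reps C.
Local Notation Y i := (inv_ob esG (rep i)).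
Local Notation x i := (inv_iso esG (rep i)).

(** The isomorphism from [S (rep i)] to [Y i] is conjugated by [s], which leaves the object [Y i] in
    place, and [x i] leads back to [rep i]. *)
Definition conj_frame (i : I) : iso (conj_te (tw_obj s (rep i))) (rep i) :=
  iso_comp (x i) (fmap_iso G (cj_iso s
    (iso_comp (eps (Y i)) (fmap_iso S (iso_inv (x i)))))).

Definition conj_framed : framed I s := Framed conj_frame.

End TwistedInverse.

Variable I : irr_reps C.

Lemma eps_natA (X Y : E) (f : mor X Y) W (w : mor W _) :
  eps Y \c (fmor S (fmor G f) \c w) = f \c (eps X \c w).
Proof. by rewrite !compA; congr (_ \c _); exact: inv_counit_nat. Qed.

(** Writing c_s for conjugation, [F_s F_t] is [G c_s S G c_t S]. The counit [eps] cancels the inner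
    [S G]; conjugated by [s] and mapped by [G], it is the required comparison with [G c_s c_t S]. *)
Lemma conj_framed_comp s t :
  fr_equiv (fr_comp (conj_framed s I) (conj_framed t I)) (conj_framed (gcomp s t) I).
Proof.
exists (fun X : C => fmap_iso G (cj_iso s (eps (S X)))); split; first split.
- move=> X Y f.
  change (fmor G (cj s (eps (S Y))) \c fmor G (cj s (fmor S (fmor G (cj t (fmor S f))))) =
    fmor G (cj (gcomp s t) (fmor S f)) \c fmor G (cj s (eps (S X)))).
  rewrite cjM -!fmor_comp -!cj_comp; congr (fmor G (cj s _)).
  exact: inv_counit_nat.
- move=> X Y.
  change (fmor G (cj s (eps (S (X \ox Y)))) \c
    (fmor G (cj s (fmor S (fmor G (cj t (mf_ten S X Y)) \c mf_ten G (S X) (S Y)))) \c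
     (fmor G (cj s (mf_ten S (G (S X)) (G (S Y)))) \c mf_ten G (S (G (S X))) (S (G (S Y))))) =
    fmor G (cj (gcomp s t) (mf_ten S X Y)) \c mf_ten G (S X) (S Y) \c
      (fmor G (cj s (eps (S X))) \om fmor G (cj s (eps (S Y))))).
  rewrite -[RHS]compA mf_ten_nat !compA; congr (_ \c _).
  rewrite cjM -!fmor_comp -cj_tmor -!cj_comp; congr (fmor G (cj s _)).
  rewrite fmor_comp -!compA eps_natA; congr (_ \c _).
  exact: inv_counit_ten.
- change (fmor G (cj s (eps (S (unt C)))) \c
    (fmor G (cj s (fmor S (fmor G (cj t (mf_unt S)) \c mf_unt G))) \c
     (fmor G (cj s (mf_unt S)) \c mf_unt G)) =
    fmor G (cj (gcomp s t) (mf_unt S)) \c mf_unt G).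
  rewrite !compA; congr (_ \c _).
  rewrite cjM -!fmor_comp -!cj_comp; congr (fmor G (cj s _)).
  rewrite fmor_comp -!compA eps_natA -[RHS]compm1; congr (_ \c _).
  exact: inv_counit_unt.
- move=> i.
  set Y := inv_ob esG (rep i); set x := inv_iso esG (rep i).
  change (x \c fmor G (cj (gcomp s t) (eps Y \c fmor S (ibw x))) \c
      fmor G (cj s (eps (S (rep i)))) =
    x \c fmor G (cj s (eps Y \c fmor S (ibw x))) \c
      fmor G (cj s (fmor S (x \c fmor G (cj t (eps Y \c fmor S (ibw x))))))).
  rewrite -!compA; congr (_ \c _).
  rewrite cjM -!fmor_comp -!cj_comp; congr (fmor G (cj s _)).
  rewrite -[RHS]compA -fmor_comp (compA (ibw x)) ifwK comp1m.
  exact/esym/inv_counit_nat.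
Qed.

Lemma section_of_equivalence : exists sec : Gal -> Pi_fr I, is_section sec.
Proof. by apply/sectionP; exists (fun s => conj_framed s I); exact: conj_framed_comp. Qed.

End Conjugation.

(** * Finite direct sums and their preservation by linear functors *)

Section FiniteSums.
Variables (F : fieldType) (C : lin_cat F).
Hypothesis zero : exists Z : C, is_zero Z.
Hypothesis sums :
  forall X Y : C, exists P, @is_dirsum F C 2 (fun j => if j == ord0 then X else Y) P.

Lemma finite_sums (J : finType) (S : J -> C) : exists X, dsum S X.
Proof.
(* Families over all of [J] are carried along even for a partial sum: indices outside [r] receive
   zero maps, so orthogonality holds for all pairs while [p j \c i j = idm] is claimed only on
   [r]. *)
suff: forall r : seq J, uniq r -> exists X (i : forall j, mor (S j) X) (p : forall j, mor X (S j)),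
    [/\ forall j, j \in r -> p j \c i j = idm (S j),
        forall j k, j != k -> p j \c i k = 0
      & \sum_(j <- r) i j \c p j = idm X].
  case/(_ (index_enum J) (index_enum_uniq J)) => X [i [p [pi0 pi1 ip]]]; exists X, i, p.
  by split=> // j; rewrite pi0 ?mem_index_enum.
elim=> [_|k r IHr /= /andP[kr /IHr[X [i [p [pi0 pi1 ip]]]]]].
  have [Z Z0] := zero; exists Z, (fun=> 0), (fun=> 0); split=> // [j k _|].
    exact: comp0m.
  by rewrite big_nil; apply/esym/is_zeroP.
have [P [a [b [ab0 ab1 ab]]]] := sums (S k) X.
pose a0 : mor (S k) P := a ord0; pose a1 : mor X P := a ord_max.
pose b0 : mor P (S k) := b ord0; pose b1 : mor P X := b ord_max.
have e00 : b0 \c a0 = idm (S k) := ab0 ord0.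
have e11 : b1 \c a1 = idm X := ab0 ord_max.
have e01 : b0 \c a1 = 0 := ab1 ord0 ord_max isT.
have e10 : b1 \c a0 = 0 := ab1 ord_max ord0 isT.
have e : a0 \c b0 + a1 \c b1 = idm P.
  rewrite -ab big_ord_recl big_ord1 (_ : lift ord0 ord0 = ord_max) //; exact: val_inj.
pose i' := dfwith (fun j => a1 \c i j) a0; pose p' := dfwith (fun j => p j \c b1) b0.
have i'k : i' k = a0 by exact: dfwith_in.
have p'k : p' k = b0 by exact: dfwith_in.
have i'n j : k != j -> i' j = a1 \c i j by exact: dfwith_out.
have p'n j : k != j -> p' j = p j \c b1 by exact: dfwith_out.
exists P, i', p'; split.
- move=> j; rewrite inE; have [->|jk] /= := eqVneq j k; first by rewrite i'k p'k.
  rewrite eq_sym in jk => jr; rewrite i'n // p'n // -compA (compA b1) e11 comp1m.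
  exact: pi0.
- move=> j l; have [->|jk] := eqVneq j k.
    by move=> kl; rewrite p'k i'n // compA e01 comp0m.
  rewrite eq_sym in jk; rewrite p'n //; have [->|lk] := eqVneq l k.
    by rewrite i'k -compA e10 compm0.
  rewrite eq_sym in lk; rewrite i'n // -compA (compA b1) e11 comp1m.
  exact: pi1.
- rewrite big_cons i'k p'k -e; congr (_ + _).
  rewrite -[a1 in RHS]compm1 -ip.
  rewrite -[RHS]/((a1 \c (\sum_(j <- r) i j \c p j)) \c b1).
  rewrite (big_morph (fun f => a1 \c f) (fun f f' => compDr a1 f f') (compm0 _ a1)).
  rewrite (big_morph (fun f => f \c b1) (fun f f' => compDl f f' b1) (comp0m _ b1)).
  rewrite !big_seq; apply: eq_bigr => j jr.
  have kj : k != j by apply: contraNneq kr => ->.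
  by rewrite i'n // p'n // !compA.
Qed.

Lemma dirsum_unique n (S : 'I_n -> C) X Y : is_dirsum S X -> is_dirsum S Y -> isomorphic X Y.
Proof.
have half W (i : forall j, mor (S j) W) (p : forall j, mor W (S j))
    X' (i' : forall j, mor (S j) X') (p' : forall j, mor X' (S j)) :
    (forall j, p' j \c i' j = idm (S j)) -> (forall j k, j != k -> p' j \c i' k = 0) ->
    (\sum_j i j \c p' j) \c (\sum_j i' j \c p j) = \sum_j i j \c p j.
  move=> pi0 pi1; rewrite comp_suml; apply: eq_bigr => j _.
  rewrite comp_sumr (bigD1 j) //= big1 ?addr0 => [|k kj]; rewrite -compA (compA (p' j)).
    by rewrite pi0 comp1m.
  by rewrite pi1 ?comp0m ?compm0 // eq_sym.
move=> [i [p [pi0 pi1 ip]]] [i' [p' [pi0' pi1' ip']]].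
exists; exists (\sum_j i' j \c p j) (\sum_j i j \c p' j).
  by rewrite half.
by rewrite half.
Qed.

End FiniteSums.

Lemma fmor0 (F : fieldType) (A B : lin_cat F) (T : lin_functor A B) (X Y : A) :
  fmor T (0 : mor X Y) = 0.
Proof. by have := fmor_lin T (-1) (0 : mor X Y) 0; rewrite !scaleN1r oppr0 !addr0 addNr. Qed.

Lemma fmor_sum (F : fieldType) (A B : lin_cat F) (T : lin_functor A B) (J : finType) (X Y : A)
    (f : J -> mor X Y) : fmor T (\sum_j f j) = \sum_j fmor T (f j).
Proof.
apply: (big_morph (fun f => fmor T f) _ (fmor0 T X Y)) => g h.
by rewrite -[g]scale1r fmor_lin !scale1r.
Qed.

Lemma fmorZ (F : fieldType) (A B : lin_cat F) (T : lin_functor A B) (X Y : A) a (f : mor X Y) :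
  fmor T (a *: f) = a *: fmor T f.
Proof. by rewrite -[a *: f]addr0 fmor_lin fmor0 addr0. Qed.

Lemma fmor_dirsum (F : fieldType) (A B : lin_cat F) (T : lin_functor A B) n (S : 'I_n -> A) X :
  is_dirsum S X -> is_dirsum (fun j => T (S j)) (T X).
Proof.
case=> i [p [pi0 pi1 ip]]; exists (fun j => fmor T (i j)), (fun j => fmor T (p j)); split.
- by move=> j; rewrite -fmor_comp pi0 fmor1.
- by move=> j k jk; rewrite -fmor_comp pi1 // fmor0.
- by rewrite -fmor1 -ip fmor_sum; apply: eq_bigr => j _; rewrite fmor_comp.
Qed.

Lemma ff_end_is_base (F : fieldType) (A B : lin_cat F) (T : lin_functor A B) (X : A) :
  fully_faithful T -> end_is_base X -> end_is_base (T X).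
Proof.
move=> [iT sT] bX; apply: end_is_base_intro => [e|h].
  by apply: (end_is_base_neq0 bX); apply: iT; rewrite fmor1 fmor0.
have [f <-] := sT _ _ h; have [a ->] := end_is_base_scalar bX f.
by exists a; rewrite fmorZ fmor1.
Qed.

(** * Scalar endomorphisms and direct sums under extension of scalars *)

Section BaseExtension.
Variables (K : fieldType) (L : fieldExtType K) (CK : mon_cat K).
Local Notation E := (base_ext L CK).

Lemma ext_in_inj (V : vectType K) (v : V) : ext_in L v = 0 -> v = 0.
Proof.
move=> /rowP e; rewrite -[v]bcoordK big1 // => i _.
by have := e i; rewrite !mxE => /eqP; rewrite fmorph_eq0 => /eqP ->; rewrite scale0r.
Qed.

Lemma ext_end_is_base (X : CK) : end_is_base X -> @end_is_base L E X.
Proof.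
move=> bX; apply: end_is_base_intro => [/ext_in_inj|f]; first exact: end_is_base_neq0.
elim/ext_ind: f => [f|a u v [b ->] [c ->]].
  have [k ->] := end_is_base_scalar bX f; exists (k%:A); exact: ext_inZ.
by exists (a * b + c); rewrite scalerDl scalerA.
Qed.

Lemma ext_dirsum n (S : 'I_n -> CK) (X : CK) : is_dirsum S X -> @is_dirsum L E n S X.
Proof.
case=> i [p [pi0 pi1 ip]]; exists (fun j => ext_in L (i j)), (fun j => ext_in L (p j)); split.
- by move=> j; rewrite [LHS]ecomp_in pi0.
- by move=> j k jk; rewrite [LHS]ecomp_in pi1 // ext_in0.
- under eq_bigr do rewrite [_ \c _]ecomp_in.
  by rewrite -ext_in_sum ip.
Qed.

End BaseExtension.

Section EquivalenceOfForm.
Variables (K : fieldType) (L : splittingFieldType K) (C : fusion_cat L).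
Variables (CK : fusion_cat K) (splitCK : split_cat CK).
Variable T : mon_functor (scalar_ext L CK) C.
Hypothesis equivT : is_equivalence T.
Local Notation E := (base_ext L CK).

Definition form_functor : mon_functor E C := mcomp_functor T (kinc E).

Lemma form_functor_ff : fully_faithful form_functor.
Proof. exact: ff_comp (equivalence_fully_faithful equivT) (kinc_ff E). Qed.

(* [CK] being split, its simple objects stay simple after extension of scalars. *)
Lemma form_functor_simple (S : C) : simple_obj S -> exists Y : E, isomorphic (form_functor Y) S.
Proof.
move=> sS; have [Z [j]] := equivalence_ess_surjective equivT S.
have [n [Y [sY /ext_dirsum-/(_ L) dY]]] := fusion_semisimple (C := CK) (kob Z).
have [i [p [_ _ ip]]] := fmor_dirsum form_functor dY.
(* [Z] is a retract of its ambient object, so [f] is a nonzero map from [S] into a direct sum of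
   images of simple objects of [CK]. These images are simple, and Schur's lemma applies to a nonzero
   component. *)
pose f : mor S (form_functor (kob Z)) := fmor T (kincl Z) \c ibw j.
have f0 : f <> 0.
  move=> e; apply: (proj1 sS); apply/is_zeroP.
  rewrite -(ibwK j) -[ibw j]comp1m -fmor1 -kretrK fmor_comp -(compA (fmor T (kretr Z))).
  by rewrite [_ \c ibw j]e !compm0.
have [k pf] : exists k, p k \c f <> 0.
  apply: Classical_Prop.NNPP => h; apply: f0.
  rewrite -[f]comp1m -ip comp_suml big1 // => k _; rewrite -compA.
  have [->|/eqP pf] := eqVneq (p k \c f) 0; first exact: compm0.
  by case: h; exists k.
have bY : end_is_base (form_functor (Y k)).
  exact: ff_end_is_base form_functor_ff (ext_end_is_base L (splitCK (sY k))).
have [g _] := schur sS (end_base_simple (@fusion_regular L C) bY) (fusion_kernels _) pf.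
by exists (Y k); exists; exact: iso_inv.
Qed.

(** The direct sum of the preimages of the simple summands is formed in [CK], which has the same
    objects as [E]; extension of scalars and the functor preserve it. *)
Lemma form_functor_es : ess_surjective form_functor.
Proof.
move=> X; have [n [S [sS dS]]] := fusion_semisimple X.
pose Y j := sval (constructive_indefinite_description _ (form_functor_simple (sS j))).
have hY j : isomorphic (form_functor (Y j)) (S j).
  exact: svalP (constructive_indefinite_description _ (form_functor_simple (sS j))).
have [[zK sK _ _ _] _ _ _ _] := fusP CK.
have [W dW] := finite_sums zK sK (Y : 'I_n -> CK); exists W.
apply: (dirsum_unique (S := S)) dS.
exact: dirsum_iso hY (fmor_dirsum form_functor (ext_dirsum L dW)).
Qed.

End EquivalenceOfForm.

Theorem proposition2p5 (K : fieldType) (L : splittingFieldType K)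
    (galLK : galois 1%AS {:L}%AS)
    (C : fusion_cat L) (splitC : split_cat C) (I : irr_reps C) :
  (exists CK : fusion_cat K, split_cat CK /\ is_form C CK) <->
  (exists sec : gal_of {:L} -> Pi_fr I, is_section sec).
Proof.
split; last exact: form_of_section.
case=> CK [splitCK [T equivT]].
exact: (@section_of_equivalence K L CK C (form_functor T) (form_functor_ff equivT)
  (form_functor_es splitCK equivT)).
Qed.
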